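(* Let $p,q\in(0,2]$, $k\in\mathbb{N}_0$, $\alpha\in\mathbb{R}$, $\beta\ge0$ and $\lambda_1,\lambda_2\in\mathbb{R}$ be arbitrary. If the embedding $\mathrm{Co}(L^{p}_{v^{(\alpha,\beta)}}(\mathbb{R}^3\rtimes H^{\lambda_1,\lambda_2}))\hookrightarrow W^{k,q}(\mathbb{R}^3)$ holds, then $\beta\ge k$.
   Context: Group: for $\lambda_1,\lambda_2\in\mathbb{R}$, the standard shearlet group is $H=H^{\lambda_1,\lambda_2}=\left\{\epsilon\begin{pmatrix}a&ab&ac\\0&a^{\lambda_1}&0\\0&0&a^{\lambda_2}\end{pmatrix}: a>0,\ b,c\in\mathbb{R},\ \epsilon\in\{\pm1\}\right\}\subset \mathrm{GL}(\mathbb{R}^3)$. It acts on $\mathbb{R}^3$ by the dual action $(h,\xi)\mapsto h^{-T}\xi$, which acts freely and transitively on the open set $\mathcal{O}=(\mathbb{R}\setminus\{0\})\times\mathbb{R}^2$. Weight: $v^{(\alpha,\beta)}(h)=|h_{1,1}|^{\alpha}\,\|h^{-T}\|^{\beta}$, where $h_{1,1}$ is the upper left entry and $\|\cdot\|$ is a fixed norm on $3\times3$ matrices. Coorbit space: let $G=\mathbb{R}^3\rtimes H$ with law $(x,h)(y,g)=(x+hy,hg)$, quasi-regular representation $[\pi(x,h)f](y)=|\det h|^{-1/2}f(h^{-1}(y-x))$ on $L^2(\mathbb{R}^3)$ and $W_\psi f(x,h)=\langle f,\pi(x,h)\psi\rangle$. $L^{p,r}_v(G)$ is the set of measurable $F$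 with $\int_H\left(\int_{\mathbb{R}^3}|F(x,h)|^pv(h)^p\,dx\right)^{r/p}\frac{dh}{|\det h|}<\infty$ ($dh$ left Haar measure; usual modification for infinite exponents), $L^p_v:=L^{p,p}_v$, and $\mathrm{Co}(L^{p,r}_v(\mathbb{R}^3\rtimes H))=\{f\in(\mathcal{H}^1_w)^{\neg}: W_\psi f\in W(L^{p,r}_v(G))\}$ for a suitable wavelet $\psi$ and control weight $w$ associated to $v$, where $(\mathcal{H}^1_w)^{\neg}$ is the space of antilinear functionals on $\mathcal{H}^1_w=\{f\in L^2(\mathbb{R}^3):W_\psi f\in L^1_w(G)\}$ and $W(Y)=\{F\in L^\infty_{loc}(G): M_QF\in Y\}$ with $M_QF(x)=\operatorname{ess\,sup}_{y\in xQ}|F(y)|$ for a suitable unit neighborhood $Q\subset G$. The Fourier transform is an isomorphism of this space onto the decomposition space $\mathcal{D}(\mathcal{Q},L^p,\ell^r_u)$ described next, and embeddings into Sobolev spaces are by definition statements about this decomposition space. For the space $\mathrm{Co}(L^p_v)$ take $r=p$ throughout. Decomposition space: a family $(h_i)_{i\in I}$ in $H$ is well-spread if there is a relatively compact neighborhood $U\subset H$ of the identity with $\bigcup_ih_iU=H$ and a neighborhood $V\subset H$ of the identity with $h_iV\cap h_jV=\emptyset$ for $i\ne j$. Fix $\xi_0\in\mathcal{O}$, a well-spread family and $U$; put $Q=\{h^{-T}\xi_0:h\in U\}$, $Q_i=h_i^{-T}Q$ and $\mathcal{Q}=(Q_i)_{i\in I}$ (the covering of $\mathcal{O}$ induced by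 $H$). $U$ is chosen such that $Q$ is open and precompact and such that a regular partition of unity $(\varphi_i)_{i\in I}$ subordinate to $\mathcal{Q}$ exists, i.e. $\varphi_i\in C_c^\infty(\mathcal{O})$, $\varphi_i=0$ outside $Q_i$, $\sum_i\varphi_i=1$ on $\mathcal{O}$, and $\sup_i\|\partial^\sigma(\varphi_i\circ h_i^{-T})\|_{\sup}<\infty$ for every multiindex $\sigma\in\mathbb{N}_0^3$. With $u_i=|\det h_i|^{\frac12-\frac1r}v(h_i)$ ($\frac1\infty:=0$), $\mathcal{D}(\mathcal{Q},L^p,\ell^r_u)$ is the space of $f\in\mathcal{D}'(\mathcal{O})$ with $\big\|(u_i\|\mathcal{F}^{-1}(\varphi_if)\|_{L^p(\mathbb{R}^3)})_{i\in I}\big\|_{\ell^r(I)}<\infty$. Nothing below depends on the choices made. Sobolev spaces: for $q\in[1,\infty]$, $W^{k,q}(\mathbb{R}^3)=\{f\in L^q:\partial^\sigma f\in L^q\text{ for all }|\sigma|_1\le k\}$ (weak derivatives). For $0<q<1$, $W^{k,q}(\mathbb{R}^3)$ is the closure of $\{(\partial^\sigma f)_{|\sigma|_1\le k}: f\in C^\infty(\mathbb{R}^3),\ \partial^\sigma f\in L^q\ \forall|\sigma|_1\le k\}$ in $\prod_{|\sigma|_1\le k}L^q(\mathbb{R}^3)$. Embedding: $\mathrm{Co}(L^{p,r}_v(\mathbb{R}^3\rtimes H))\hookrightarrow W^{k,q}(\mathbb{R}^3)$ means: for every $\sigma\in\mathbb{N}_0^3$ with $|\sigma|_1\le k$ the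 map $\partial_*^\sigma:\mathcal{D}(\mathcal{Q},L^p,\ell^r_u)\to L^q(\mathbb{R}^3)$, $f\mapsto\sum_{i\in I}\partial^\sigma[\mathcal{F}^{-1}(\varphi_if)]$ is well-defined and bounded, with unconditional convergence of the series; and, if $q\ge1$, the map $f\mapsto\partial_*^0f$ is a well-defined, bounded and injective map $\mathcal{D}(\mathcal{Q},L^p,\ell^r_u)\to W^{k,q}(\mathbb{R}^3)$, while if $0<q<1$, the map $f\mapsto(\partial_*^\sigma f)_{|\sigma|_1\le k}$ is a well-defined and bounded map $\mathcal{D}(\mathcal{Q},L^p,\ell^r_u)\to W^{k,q}(\mathbb{R}^3)$. *)

(* Defs.v *)
From HB Require Import structures.
From mathcomp Require Import all_boot all_order all_algebra.
From mathcomp Require Import finmap.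
From mathcomp Require Import complex.
From mathcomp Require Import all_classical all_reals all_analysis.

Set Implicit Arguments.
Unset Strict Implicit.
Unset Printing Implicit Defensive.

Import Order.TTheory GRing.Theory Num.Theory.
Import numFieldNormedType.Exports.

Local Open Scope classical_set_scope.
Local Open Scope complex_scope.
Local Open Scope ring_scope.

Definition multiindex := {ffun 'I_3 -> nat}.

Definition msize (s : multiindex) : nat := (\sum_i s i)%N.

Section Calculus.
Variable R : realType.
Implicit Types (f g : 'cV[R]_3 -> R[i]) (x : 'cV[R]_3).

Definition dotp (x y : 'cV[R]_3) : R := \sum_j x j 0 * y j 0.

Definition expi2pi (t : R) : R[i] := cos (2 * pi * t) +i* sin (2 * pi * t).

(* The derivative of a complex-valued function is taken on its real and
   imaginary parts: R[i] is a normed module over itself, not over R. *)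
Definition pderiv (j : 'I_3) f : 'cV[R]_3 -> R[i] := fun x =>
  'D_(delta_mx j 0) (fun y => complex.Re (f y)) x
  +i* 'D_(delta_mx j 0) (fun y => complex.Im (f y)) x.

Definition mderiv (s : multiindex) f : 'cV[R]_3 -> R[i] :=
  foldr (fun j => iter (s j) (pderiv j)) f (enum 'I_3).

(* All iterated partial derivatives, in any order, are differentiable. *)
Definition smooth f := forall (s : seq 'I_3) x,
  differentiable (fun y => complex.Re (foldr pderiv f s y)) x /\
  differentiable (fun y => complex.Im (foldr pderiv f s y)) x.

Definition supported_in (A : set 'cV[R]_3) f := forall x, ~ A x -> f x = 0.

Definition test_function (O : set 'cV[R]_3) f :=
  smooth f /\ exists K, [/\ compact K, K `<=` O & supported_in K f].

(* Elements of D'(O). The carrier acts on arbitrary functions, but only its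
   values on test functions are meaningful, see eq_distribution. *)
Record schwartz_distribution (O : set 'cV[R]_3) := SchwartzDistribution {
  dist_val :> ('cV[R]_3 -> R[i]) -> R[i] ;
  dist_linear : forall (a : R[i]) f g, test_function O f -> test_function O g ->
    dist_val (fun x => a * f x + g x) = a * dist_val f + dist_val g ;
  dist_continuous : forall K, compact K -> K `<=` O ->
    exists (N : nat) (C : R), forall f (M : R),
      test_function O f -> supported_in K f ->
      (forall s x, (msize s <= N)%N -> Normc.normc (mderiv s f x) <= M) ->
      Normc.normc (dist_val f) <= C * M }.

Definition eq_distribution O (S T : schwartz_distribution O) :=
  forall f, test_function O f -> S f = T f.

(* F^-1 (phi T), where phi \in C_c^oo(O): the inverse Fourier transform of a
   compactly supported distribution is the smooth function obtained by pairing
   it with the characters xi |-> exp (2 i pi <x, xi>). *)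
Definition ifourier_mul O (phi : 'cV[R]_3 -> R[i]) (T : schwartz_distribution O) :
    'cV[R]_3 -> R[i] :=
  fun x => T (fun xi => phi xi * expi2pi (dotp x xi)).

End Calculus.

Section LebesgueSpaces.
Variable R : realType.
Implicit Types (f g : 'cV[R]_3 -> R[i]) (q : R).

Definition lebesgue3 :=
  ((@lebesgue_measure R \x @lebesgue_measure R) \x @lebesgue_measure R)%E.

Definition vec3 (t : measurableTypeR R * measurableTypeR R * measurableTypeR R) :
    'cV[R]_3 :=
  \col_j [:: t.1.1; t.1.2; t.2]`_j.

(* For 0 < q < 1 this is the usual quasi-norm. *)
Definition LqN q f : \bar R :=
  Lnorm lebesgue3 q%:E (fun t => (Normc.normc (f (vec3 t)))%:E).

Definition inLq q f :=
  [/\ measurable_fun setT (fun t => complex.Re (f (vec3 t))),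
      measurable_fun setT (fun t => complex.Im (f (vec3 t))) &
      (LqN q f < +oo)%E].

Definition ae_eq3 f g := {ae lebesgue3, forall t, f (vec3 t) = g (vec3 t)}.

Definition cintegral f : R[i] :=
  (\int[lebesgue3]_t complex.Re (f (vec3 t)))
  +i* (\int[lebesgue3]_t complex.Im (f (vec3 t))).

(* g is the weak derivative of f of order s, for f and g locally integrable *)
Definition weak_deriv (s : multiindex) f g := forall phi,
  test_function setT phi ->
  cintegral (fun x => f x * mderiv s phi x)
  = (-1) ^+ msize s * cintegral (fun x => g x * phi x).

(* Unconditional convergence in L^q, along the net of finite partial sums *)
Definition unconditional_sum (I : choiceType) q (F : I -> 'cV[R]_3 -> R[i]) S :=
  [/\ forall i, inLq q (F i), inLq q S &
      forall e : R, 0 < e -> exists J0 : {fset I}, forall J : {fset I},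
        (J0 `<=` J)%fset ->
        (LqN q (fun x => \sum_(i <- J) F i x - S x)%R < e%:E)%E].

(* (Quasi-)norm of a family in the product of the L^q, over |s| <= k *)
Definition jetN (k : nat) q (g : multiindex -> 'cV[R]_3 -> R[i]) : \bar R :=
  (\esum_(s in [set s | (msize s <= k)%N]) LqN q (g s))%E.

(* f \in W^{k,q}, q >= 1, with derivatives g *)
Definition sobolev_jet (k : nat) q f (g : multiindex -> 'cV[R]_3 -> R[i]) :=
  inLq q f /\
  forall s, (msize s <= k)%N -> inLq q (g s) /\ weak_deriv s f (g s).

(* g \in W^{k,q}, 0 < q < 1: closure of the jets of smooth functions *)
Definition sobolev_closure (k : nat) q (g : multiindex -> 'cV[R]_3 -> R[i]) :=
  (forall s, (msize s <= k)%N -> inLq q (g s)) /\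
  forall e : R, 0 < e -> exists f, [/\ smooth f,
    forall s, (msize s <= k)%N -> inLq q (mderiv s f) &
    forall s, (msize s <= k)%N ->
      (LqN q (fun x => mderiv s f x - g s x)%R < e%:E)%E].

End LebesgueSpaces.

Section ShearletGroup.
Variable R : realType.
Implicit Types (h : 'M[R]_3).

Definition shearlet_mx (l1 l2 a b c : R) : 'M[R]_3 :=
  \matrix_(i, j)
    (nth [::] [:: [:: a; a * b;    a * c];
                  [:: 0; a `^ l1;  0];
                  [:: 0; 0;        a `^ l2]] i)`_j.

Definition shearlet_group (l1 l2 : R) : set 'M[R]_3 :=
  [set h | exists eps a b c : R,
    [/\ eps = 1 \/ eps = -1, 0 < a & h = eps *: shearlet_mx l1 l2 a b c]].

Definition dual_act h (xi : 'cV[R]_3) : 'cV[R]_3 := (invmx h)^T *m xi.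

Definition dual_orbit : set 'cV[R]_3 := [set xi | xi ord0 0 != 0].

Definition id_nbhs (H U : set 'M[R]_3) :=
  U `<=` H /\ within H (nbhs (1%:M : 'M[R]_3)) U.

Definition lcoset_mx h (U : set 'M[R]_3) := [set h *m g | g in U].

Definition well_spread (H : set 'M[R]_3) (I : Type) (h : I -> 'M[R]_3)
    (U : set 'M[R]_3) :=
  [/\ forall i, H (h i),
      id_nbhs H U /\ (exists K, [/\ compact K, K `<=` H & U `<=` K]),
      \bigcup_i lcoset_mx (h i) U = H &
      exists V, id_nbhs H V /\
        forall i j, i <> j -> lcoset_mx (h i) V `&` lcoset_mx (h j) V = set0].

(* A covering of the dual orbit induced by the group, with a regular partition
   of unity. The \sum over \in is the finite-support sum (0 if infinitely many
   terms are nonzero), so that equality to 1 includes pointwise finiteness. *)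
Record induced_covering (l1 l2 : R) := InducedCovering {
  cov_index : choiceType ;
  cov_elt : cov_index -> 'M[R]_3 ;
  cov_nbhs : set 'M[R]_3 ;
  cov_base : 'cV[R]_3 ;
  cov_phi : cov_index -> 'cV[R]_3 -> R[i] ;
  cov_Q := [set dual_act h cov_base | h in cov_nbhs] ;
  cov_well_spread : well_spread (shearlet_group l1 l2) cov_elt cov_nbhs ;
  cov_base_orbit : dual_orbit cov_base ;
  cov_Q_open : open cov_Q ;
  cov_Q_precompact : precompact cov_Q ;
  cov_phi_test : forall i, test_function dual_orbit (cov_phi i) ;
  cov_phi_supp : forall i,
    supported_in [set dual_act (cov_elt i) xi | xi in cov_Q] (cov_phi i) ;
  cov_phi_sum : forall xi, dual_orbit xi ->
    \sum_(i \in [set: cov_index]) cov_phi i xi = 1 ;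
  cov_phi_regular : forall s : multiindex, exists C : R, forall i xi,
    Normc.normc (mderiv s (fun eta => cov_phi i (dual_act (cov_elt i) eta)) xi) <= C }.

Definition matrix_norm (nrm : 'M[R]_3 -> R) :=
  [/\ forall A, nrm A = 0 -> A = 0,
      forall (a : R) A, nrm (a *: A) = `|a| * nrm A &
      forall A B, nrm (A + B) <= nrm A + nrm B].

Definition shearlet_weight (nrm : 'M[R]_3 -> R) (alpha beta : R) h : R :=
  `|h ord0 ord0| `^ alpha * nrm (invmx h)^T `^ beta.

End ShearletGroup.

Section Embedding.
Variables (R : realType) (l1 l2 : R) (Q : induced_covering l1 l2).
Implicit Types (T : schwartz_distribution (@dual_orbit R)) (p q r : R).

Definition piece T (i : cov_index Q) : 'cV[R]_3 -> R[i] :=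
  ifourier_mul (cov_phi i) T.

(* The (quasi-)norm of D(Q, L^p, l^r_u); the space is where it is finite. *)
Definition decompN p r (u : cov_index Q -> R) T : \bar R :=
  ((\esum_(i in [set: cov_index Q])
      (((u i)%:E * LqN p (piece T i)) `^ r)) `^ r^-1)%E.

(* S is the function \partial_*^s T *)
Definition is_dstar q (s : multiindex) T S :=
  unconditional_sum q (fun i => mderiv s (piece T i)) S.

Definition decomp_embeds_sobolev p r (u : cov_index Q -> R) (k : nat) q :=
  let inD T := (decompN p r u T < +oo)%E in
  [/\ forall s, (msize s <= k)%N -> exists C : R, forall T, inD T ->
        exists S, is_dstar q s T S /\ (LqN q S <= C%:E * decompN p r u T)%E,
      1 <= q ->
        (exists C : R, forall T S, inD T -> is_dstar q [ffun=> 0%N] T S ->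
           exists g, sobolev_jet k q S g /\
             (jetN k q g <= C%:E * decompN p r u T)%E) /\
        (forall T1 T2 S1 S2, inD T1 -> inD T2 ->
           is_dstar q [ffun=> 0%N] T1 S1 -> is_dstar q [ffun=> 0%N] T2 S2 ->
           ae_eq3 S1 S2 -> eq_distribution T1 T2) &
      q < 1 ->
        exists C : R, forall T (S : multiindex -> 'cV[R]_3 -> R[i]), inD T ->
          (forall s, (msize s <= k)%N -> is_dstar q s T (S s)) ->
          sobolev_closure k q S /\
          (jetN k q S <= C%:E * decompN p r u T)%E].

(* Co(L^{p,r}_v) is identified, through the Fourier transform, with the
   decomposition space D(Q, L^p, l^r_u), u_i = |det h_i|^(1/2 - 1/r) v(h_i). *)
Definition coorbit_embeds_sobolev p r (v : 'M[R]_3 -> R) (k : nat) q :=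
  decomp_embeds_sobolev p r
    (fun i => `|\det (cov_elt i)| `^ (2^-1 - r^-1) * v (cov_elt i)) k q.

End Embedding.

(* Main.v *)
From HB Require Import structures.
Require Import Defs.
From mathcomp Require Import all_boot all_order all_algebra.
From mathcomp Require Import finmap complex.
From mathcomp Require Import all_classical all_reals all_analysis.
From mathcomp Require Import perm measurable_realfun ring lra.
Import Order.TTheory GRing.Theory Num.Theory.
Import numFieldNormedType.Exports.
Local Open Scope classical_set_scope.
Local Open Scope complex_scope.
Local Open Scope ring_scope.
Set Implicit Arguments.
Unset Strict Implicit.
Unset Printing Implicit Defensive.

(** The embedding is tested on one family of distributions T_n, n >= 1. Let rho
    be a fixed non-negative density supported in ]1, 2[ x ]0, 1[ x ]0, 1[, and
    let S_n be the shear of the group with a = 1, b = n and c = 0. Put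
    T_n (f) = int rho(t) f(S_n^T t) dt, so that the inverse Fourier transform
    of T_n is the function x |-> F^-1 rho (S_n x).

    Upper bound. The covering has the symmetry of the group: an element h_i of
    the well-spread family meets the support of T_n only if S_n h_i lies in a
    compact part of the group that does not depend on n (active_bibounded), and
    well-spreadness bounds the number of such i, uniformly in n
    (bibounded_count). For them, S_n being measure preserving, the L^p
    quasi-norms of the pieces are bounded (LqN_piece_le). Shears change
    neither the determinant nor the upper left entry, so the only growth in n
    comes from the factor ||h_i^-T||^beta of the weight (weight_le). Hence T_n
    has norm O((1 + n)^beta) in the decomposition space
    (decompN_test_dist_le).

    Lower bound. The k-th derivative in the second coordinate multiplies the
    Fourier integrand by (2 i pi <S_n e_2, t>)^k, where
    <S_n e_2, t> = n t_1 + t_2 >= n on the support of rho. As rho is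
    non-negative, nothing cancels as long as S_n x stays in a small cube, and
    the set of these x has the volume of that cube. So this derivative has
    L^q quasi-norm at least c n^k (cosc_density_ge, dstar_ge). The embedding
    yields c n^k <= C (1 + n)^beta for all n >= 1, whence k <= beta
    (growth_comparison).

    Two points need care since p and q may be less than 1. First, the L^p bound
    requires pointwise decay of order larger than 1 / p in each variable. It is
    obtained by half-period differences in place of integrations by parts
    (osc_decay), in directions adapted to S_n h_i in which the regularity of
    the partition of unity is uniform (phi_transport); the order of
    differentiability of rho is chosen accordingly. Secondly, the sum of the
    series is given only as a limit in L^q of finite partial sums, and the
    lower bound is passed to that limit by a pointwise dichotomy
    (LqN_ge_of_sum_ge). *)

Lemma sum_ord3 (R : nmodType) (f : 'I_3 -> R) : \sum_j f j = f 0 + f 1 + f 2%:R.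
Proof.
by rewrite !big_ord_recr big_ord0 /= add0r; congr (f _ + f _ + f _); apply: val_inj.
Qed.

(** * Measurability of continuous functions of three coordinates *)

Section MeasureR3.
Variable R : realType.
Local Notation X3 := (measurableTypeR R * measurableTypeR R * measurableTypeR R)%type.

Lemma continuous_cV3_dist (f : 'cV[R]_3 -> R) (x : 'cV[R]_3) : {for x, continuous f} ->
  forall e : R, 0 < e -> exists2 d : R, 0 < d &
    forall y : 'cV[R]_3, (forall j, `|x j 0 - y j 0| < d) -> `|f x - f y| < e.
Proof.
move=> cf e e0.
have /cvgrPdist_lt/(_ _ e0) := cf.
move=> /nbhs_ballP[d /= d0 H]; exists d => // y xy; apply: H.
by split => // i j; rewrite !ord1; apply: xy.
Qed.

Definition grid (n : nat) (x : R) : R := (Num.floor (n.+1%:R * x))%:~R / n.+1%:R.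

Lemma grid_dist n x : `|x - grid n x| <= n.+1%:R^-1.
Proof.
have n0 : 0 < n.+1%:R :> R by [].
rewrite -(@ler_pM2l _ n.+1%:R)// mulfV ?gt_eqF//.
rewrite -[X in X * `|_|](gtr0_norm n0) -normrM mulrBr /grid mulrCA mulfV ?gt_eqF// mulr1.
have := floor_le (n.+1%:R * x); have := floorD1_gt (n.+1%:R * x).
rewrite intrD; set z := (Num.floor _)%:~R; move=> a b.
by rewrite ler_norml; apply/andP; split; lra.
Qed.

Lemma measurable_floor_eq n (z : int) : measurable [set x : measurableTypeR R | Num.floor
  (n.+1%:R * x) = z].
Proof.
rewrite (_ : [set _ | _] = `[z%:~R / n.+1%:R, (z + 1)%:~R / n.+1%:R[%classic);
  first exact: measurable_itv.
apply/seteqP; split => x /=; rewrite in_itv/= ler_pdivrMr// ltr_pdivlMr// mulrC => H.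
- by rewrite -H floor_itv.
- exact: floor_def.
Qed.

(** Rounding the three coordinates down to multiples of 1/(n+1) exhibits f as a
    pointwise limit of functions that are constant on countably many measurable
    cells. This works in the product sigma-algebra directly, without comparing
    it with the Borel sets of the space of column vectors. *)
Lemma measurable_continuous_vec3 (f : 'cV[R]_3 -> R) : continuous f ->
  measurable_fun [set: X3] (f \o @vec3 R).
Proof.
move=> cf.
pose F (z : int * int * int) n : R := f (vec3 ((z.1.1%:~R / n.+1%:R, z.1.2%:~R / n.+1%:R,
  z.2%:~R / n.+1%:R) : X3)).
pose fl n (t : X3) : int * int * int :=
  (Num.floor (n.+1%:R * t.1.1), Num.floor (n.+1%:R * t.1.2), Num.floor (n.+1%:R * t.2)).
apply: (@measurable_fun_cvg _ _ _ _ (fun n (t : X3) => F (fl n t) n)).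
- move=> n _ Y mY; rewrite setTI.
  rewrite (_ : _ @^-1` Y = \bigcup_(z : int * int * int)
     (if F z n \in Y then fl n @^-1` [set z] else set0)); last first.
    apply/seteqP; split => [t /= Yt|t /= [z _]].
      by exists (fl n t) => //; rewrite mem_set.
    by case: ifPn => // /set_mem Yz /= ->.
  apply: countable_bigcupT_measurable => [|z]; first exact: countableP.
  case: ifPn => // _.
  case: z => [[z1 z2] z3].
  rewrite (_ : _ @^-1` _ = ((fst \o fst) @^-1` [set x : measurableTypeR R | Num.floor (n.+1%:R *
    x) = z1]
    `&` (snd \o fst) @^-1` [set x : measurableTypeR R | Num.floor (n.+1%:R * x) = z2])
    `&` snd @^-1` [set x : measurableTypeR R | Num.floor (n.+1%:R * x) = z3]); last first.
    by apply/seteqP; split => t /= => [[<- <- <-]|[[<- <-] <-]].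
  apply: measurableI; first apply: measurableI.
  + rewrite -[X in measurable X]setTI.
    apply: (measurableT_comp measurable_fst measurable_fst measurableT).
    exact: measurable_floor_eq.
  + rewrite -[X in measurable X]setTI.
    apply: (measurableT_comp measurable_snd measurable_fst measurableT).
    exact: measurable_floor_eq.
  + rewrite -[X in measurable X]setTI.
    apply: (measurable_snd measurableT).
    exact: measurable_floor_eq.
- move=> t _; apply/cvgrPdist_lt => e e0.
  have [d d0 H] := continuous_cV3_dist (cf (vec3 t)) e0.
  near=> n; apply: H => j.
  apply: (@le_lt_trans _ _ n.+1%:R^-1).
    have G (x : R) : `|x - (Num.floor (n.+1%:R * x))%:~R / n.+1%:R| <= n.+1%:R^-1 by exact:
      (grid_dist n x).
    by rewrite !mxE; case: j => -[|[|[|//]]] ?; apply: G.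
  rewrite -(invrK d) ltf_pV2 ?posrE ?invr_gt0//.
  by rewrite -natr1 ltr_wpDr//; near: n; exact: nbhs_infty_gtr.
Unshelve. all: end_near. Qed.
End MeasureR3.

(** * Lebesgue measure on three-space under translations and shears *)

(** The image of the product measure has the right values on measurable
    rectangles, and a sigma-finite product measure is determined by them. *)
Lemma product_measure_preserving d1 d2 (T1 : measurableType d1) (T2 : measurableType d2)
  (R : realType) (m1 : {sigma_finite_measure set T1 -> \bar R})
  (m2 : {sigma_finite_measure set T2 -> \bar R}) (f1 : T1 -> T1) (f2 : T2 -> T2) :
  measurable_fun setT f1 -> measurable_fun setT f2 ->
  (forall A, measurable A -> m1 (f1 @^-1` A) = m1 A) ->
  (forall A, measurable A -> m2 (f2 @^-1` A) = m2 A) ->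
  forall A, measurable A ->
  (m1 \x m2)%E ((fun t => (f1 t.1, f2 t.2)) @^-1` A) = (m1 \x m2)%E A.
Proof.
move=> mf1 mf2 H1 H2 A mA.
have pre d d' (T : measurableType d) (T' : measurableType d') (f : T -> T') B :
   measurable_fun setT f -> measurable B -> measurable (f @^-1` B).
  by move=> mf mB; rewrite -[X in measurable X]setTI; exact: mf.
have mf : measurable_fun setT (fun t : T1 * T2 => (f1 t.1, f2 t.2)).
  by apply: measurable_fun_pair; apply: measurableT_comp.
pose nu := measure_function_pushforward__canonical__measure_function_Measure (m1 \x m2)%E mf.
have H B1 B2 : measurable B1 -> measurable B2 -> nu (B1 `*` B2) = (m1 B1 * m2 B2)%E.
  move=> mB1 mB2.
  rewrite -H1// -H2//.
  have -> : nu (B1 `*` B2) = (m1 \x m2)%E ((f1 @^-1` B1) `*` (f2 @^-1` B2)) by [].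
  by rewrite product_measure1E//; exact: pre.
exact/esym/(product_measure_unique H mA).
Qed.

Lemma lebesgue2_sigma_finite (R : realType) :
  sigma_finite setT ((@lebesgue_measure R \x @lebesgue_measure R)%E).
Proof.
exists (fun n => `[- n%:R, n%:R]%classic `*` `[- n%:R, n%:R]%classic) => [|n].
  apply/esym; rewrite -subTset => -[x y] _.
  pose n := (Num.truncn (Num.max `|x| `|y|)).+1.
  have xyn : Num.max `|x| `|y| <= n%:R by rewrite ltW// truncnS_gt.
  move: xyn; rewrite ge_max !ler_norml => /andP[xn yn].
  by exists n => //; split => /=; rewrite in_itv.
split; first by apply: measurableX; exact: measurable_itv.
rewrite product_measure1E; [|exact: measurable_itv..].
have F : ((@lebesgue_measure R) (`[(- n%:R)%R, n%:R%R]%classic : set R) < +oo)%E.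
  by rewrite lebesgue_measure_itv/=; case: ifPn => _; rewrite ?ltry.
by apply: lte_mul_pinfty => //; rewrite ge0_fin_numE.
Qed.

(** The inner product measure under a name of its own, so that it carries the
    sigma-finiteness required of the left factor of a further product. *)
Definition lebesgue2 (R : realType) : set (measurableTypeR R * measurableTypeR R) -> \bar R :=
  (@lebesgue_measure R \x @lebesgue_measure R)%E.
HB.instance Definition _ (R : realType) := Measure.on (@lebesgue2 R).
HB.instance Definition _ (R : realType) :=
  Measure_isSigmaFinite.Build _ _ _ (@lebesgue2 R) (lebesgue2_sigma_finite R).

Lemma lebesgue3E (R : realType) : @lebesgue3 R = (@lebesgue2 R \x @lebesgue_measure R)%E.
Proof. by []. Qed.

Section Trans.
Variable R : realType.
Local Notation X3 := (measurableTypeR R * measurableTypeR R * measurableTypeR R)%type.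
Local Notation mu1 := (@lebesgue_measure R).
Local Notation mu3 := (@lebesgue3 R).

Lemma lebesgue_measure_shift (v : R) (A : set (measurableTypeR R)) : measurable A ->
  mu1 ((fun x : measurableTypeR R => x + v : measurableTypeR R) @^-1` A) = mu1 A.
Proof.
have mf : measurable_fun setT (fun x : measurableTypeR R => x + v : measurableTypeR R).
  exact: measurable_funD.
move=> mA; apply/esym.
rewrite -[RHS]/(pushforward mu1 (fun x : measurableTypeR R => x + v : measurableTypeR R) A).
apply: lebesgue_measure_unique => //= _ [[a b]] _ <-.
rewrite /pushforward.
rewrite (_ : _ @^-1` _ = `]a - v, b - v]%classic); last first.
  by apply/seteqP; split => x /=; rewrite !in_itv/= ltrBlDr lerBrDr.
rewrite !lebesgue_measure_itv/= !lte_fin ltrD2r.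
case: ifP => // _; rewrite -!EFinB; congr EFin; lra.
Qed.

Definition trans3 (v t : X3) : X3 := (t.1.1 + v.1.1, t.1.2 + v.1.2, t.2 + v.2).

Lemma measurable_trans3 v : measurable_fun setT (trans3 v).
Proof.
apply: measurable_fun_pair; first apply: measurable_fun_pair => /=.
- apply: measurable_funD => //.
  exact: (measurableT_comp measurable_fst measurable_fst).
- apply: measurable_funD => //.
  exact: (measurableT_comp measurable_snd measurable_fst).
- apply: measurable_funD => //.
Qed.

Lemma lebesgue3_trans v A : measurable A -> mu3 (trans3 v @^-1` A) = mu3 A.
Proof.
pose f1 (x : measurableTypeR R) : measurableTypeR R := x + v.1.1.
pose f2 (x : measurableTypeR R) : measurableTypeR R := x + v.1.2.
pose f3 (x : measurableTypeR R) : measurableTypeR R := x + v.2.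
have m1 : measurable_fun setT f1 by exact: measurable_funD.
have m2 : measurable_fun setT f2 by exact: measurable_funD.
have m3 : measurable_fun setT f3 by exact: measurable_funD.
pose f12 (t : measurableTypeR R * measurableTypeR R) := (f1 t.1, f2 t.2).
have m12 : measurable_fun setT f12.
  by apply: measurable_fun_pair; apply: measurableT_comp.
rewrite -[trans3 v]/(fun t : X3 => (f12 t.1, f3 t.2)) lebesgue3E.
apply: (product_measure_preserving m12 m3).
- by apply: (product_measure_preserving m1 m2); exact: lebesgue_measure_shift.
- exact: lebesgue_measure_shift.
Qed.

Lemma ge0_integral_shift (v : R) (f : R -> \bar R) :
  measurable_fun setT (f : measurableTypeR R -> _) -> (forall x, 0 <= f x)%E ->
  (\int[mu1]_x f (x + v)%R = \int[mu1]_x f x)%E.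
Proof.
move=> mf f0.
have ms : measurable_fun setT (fun x : measurableTypeR R => x + v : measurableTypeR R).
  exact: measurable_funD.
transitivity (\int[pushforward mu1 (fun x : measurableTypeR R => (x + v)%R : measurableTypeR
  R)]_x f x)%E.
  by rewrite ge0_integral_pushforward.
by apply: eq_measure_integral => //= A mA _; exact: lebesgue_measure_shift.
Qed.

Lemma ge0_integral_trans3 v (f : X3 -> \bar R) :
  measurable_fun setT f -> (forall x, 0 <= f x)%E ->
  (\int[mu3]_t f (trans3 v t) = \int[mu3]_t f t)%E.
Proof.
move=> mf f0.
have mt := measurable_trans3 v.
have E := @ge0_integral_pushforward _ _ _ _ R (trans3 v) mt mu3 setT f measurableT mf (fun y _
  => f0 y).
rewrite preimage_setT in E.
rewrite -[LHS]E.
apply: eq_measure_integral => A mA _; exact: lebesgue3_trans.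
Qed.

Lemma integrable_scale (c : R) w : mu3.-integrable setT (EFin \o w) ->
  mu3.-integrable setT (EFin \o (fun t => c * w t)).
Proof.
move=> iw; have := integrableZl (mu := mu3) measurableT c iw.
by apply: eq_integrable => // t _; rewrite /= EFinM.
Qed.

Lemma integrable_trans3 v (f : X3 -> R) : mu3.-integrable setT (EFin \o f) ->
  mu3.-integrable setT (EFin \o (f \o trans3 v)).
Proof.
case/integrableP => mf fi; apply/integrableP; split.
  by apply: (measurableT_comp mf); exact: measurable_trans3.
rewrite (@ge0_integral_trans3 v (fun t => `|(f t)%:E|%E))//.
exact: measurableT_comp.
Qed.

Lemma Rintegral_trans3 v (f : X3 -> R) : mu3.-integrable setT (EFin \o f) ->
  \int[mu3]_t f (trans3 v t) = \int[mu3]_t f t.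
Proof.
move=> intf; rewrite /Rintegral; congr fine.
have mf : measurable_fun setT (EFin \o f) by case/integrableP : intf.
rewrite integralE [RHS]integralE; congr (_ - _)%E.
- rewrite -[RHS](@ge0_integral_trans3 v _ (measurable_funepos mf) (funepos_ge0 _)).
  by under [RHS]eq_integral do rewrite -[_ (trans3 v _)]/((_ \o trans3 v) _) -funepos_comp.
- rewrite -[RHS](@ge0_integral_trans3 v _ (measurable_funeneg mf) (funeneg_ge0 _)).
  by under [RHS]eq_integral do rewrite -[_ (trans3 v _)]/((_ \o trans3 v) _) -funeneg_comp.
Qed.

(** For a fixed second coordinate the shear is a translation of the first one.
    This invariance is what makes all L^p estimates below uniform in the shear
    parameter n. *)
Lemma ge0_integral_shear (n : R) (f1 f2 f3 : R -> R) :
  measurable_fun setT (f1 : measurableTypeR R -> R) ->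
  measurable_fun setT (f2 : measurableTypeR R -> R) ->
  measurable_fun setT (f3 : measurableTypeR R -> R) ->
  (forall x, 0 <= f1 x) -> (forall x, 0 <= f2 x) -> (forall x, 0 <= f3 x) ->
  (\int[mu3]_t (f1 (t.1.1 + n * t.1.2) * f2 t.1.2 * f3 t.2)%:E =
   \int[mu1]_x (f1 x)%:E * \int[mu1]_x (f2 x)%:E * \int[mu1]_x (f3 x)%:E)%E.
Proof.
move=> mf1 mf2 mf3 f10 f20 f30.
have m11 : measurable_fun [set: X3] (fun t : X3 => t.1.1 : measurableTypeR R).
  exact: (measurableT_comp measurable_fst measurable_fst).
have m12 : measurable_fun [set: X3] (fun t : X3 => t.1.2 : measurableTypeR R).
  exact: (measurableT_comp measurable_snd measurable_fst).
have mA : measurable_fun setT (fun t : measurableTypeR R * measurableTypeR R => (f1 (t.1 + n *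
  t.2) * f2 t.2)).
  apply: measurable_funM; last exact: measurableT_comp.
  have mg : measurable_fun setT (fun t : measurableTypeR R * measurableTypeR R => t.1 + n * t.2
    : measurableTypeR R).
    by apply: measurable_funD => //; apply: measurable_funM.
  exact: (measurableT_comp mf1 mg).
rewrite lebesgue3E fubini_tonelli1/=; last 2 first.
- apply/measurable_EFinP; apply: measurable_funM => /=; last exact: measurableT_comp.
  exact: (measurableT_comp mA measurable_fst).
- by move=> t; rewrite lee_fin !mulr_ge0.
rewrite /fubini_F/=.
under eq_integral => t _.
  under eq_integral => y _ do rewrite EFinM.
  rewrite ge0_integralZl//; last 3 first.
  - exact/measurable_EFinP.
  - by move=> y _; rewrite lee_fin.
  - by rewrite lee_fin mulr_ge0.
  over.
rewrite ge0_integralZr//; last 3 first.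
- exact/measurable_EFinP.
- by move=> y _; rewrite lee_fin mulr_ge0.
- by apply: integral_ge0 => y _; rewrite lee_fin.
congr (_ * _)%E.
rewrite fubini_tonelli2/=; last 2 first.
- exact/measurable_EFinP.
- by move=> t; rewrite lee_fin mulr_ge0.
rewrite /fubini_G/=.
under eq_integral => y _.
  under eq_integral => x _ do rewrite EFinM.
  rewrite ge0_integralZr//; last 3 first.
  - apply/measurable_EFinP.
    have mg : measurable_fun setT (fun t : measurableTypeR R => t + n * y : measurableTypeR R)%R.
      exact: measurable_funD.
    exact: (measurableT_comp mf1 mg).
  - by move=> x _; rewrite lee_fin.
  - by rewrite lee_fin.
  rewrite (@ge0_integral_shift (n * y) (EFin \o f1))//; last exact/measurable_EFinP.
  over.
rewrite ge0_integralZl//.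
- exact/measurable_EFinP.
- by move=> y _; rewrite lee_fin.
- by apply: integral_ge0 => y _; rewrite lee_fin.
Qed.

End Trans.

(** * Bounds on iterated derivatives and on iterated differences *)

Section OneD.
Variable R : realType.

(** A quadratic remainder is the form in which derivatives are verified below:
    it is elementary for truncated powers and affine maps, and for integrals
    with a parameter it follows from a pointwise bound under the integral sign.
    *)
Lemma is_derive_quadratic (V : normedModType R) (f : V -> R) (x v : V) (l K : R) :
  (forall h, `|f (h *: v + x) - f x - h * l| <= K * h ^+ 2) -> is_derive x v f l.
Proof.
move=> H.
have C : h^-1 *: (f (h *: v + x) - f x) @[h --> 0^'] --> l.
  apply/cvgrPdist_le => e e0.
  have K0 : 0 < `|K| + 1 by rewrite ltr_wpDl.
  near=> h.
  have h0 : h != 0 by near: h; exact: nbhs_dnbhs_neq.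
  have -> : l - h^-1 *: (f (h *: v + x) - f x) = - (h^-1 * (f (h *: v + x) - f x - h * l)).
    by rewrite /GRing.scale/= !mulrBr mulKf//; lra.
  rewrite normrN normrM normfV.
  rewrite ler_pdivrMl ?normr_gt0//.
  apply: (le_trans (H h)).
  have -> : h ^+ 2 = `|h| ^+ 2 by rewrite real_normK ?num_real.
  rewrite expr2 mulrCA ler_wpM2l//.
  apply: (@le_trans _ _ ((`|K| + 1) * `|h|)).
    by rewrite ler_wpM2r// (le_trans (ler_norm K))// lerDl.
  rewrite -ler_pdivlMl//.
  near: h; apply: dnbhs0_le; rewrite mulr_gt0// invr_gt0//.
apply: DeriveDef.
  by apply/cvg_ex; exists l.
by apply/cvg_lim.
Unshelve. all: end_near. Qed.

Lemma mean_value_le (u du : R -> R) (C : R) : (forall x : R, is_derive x 1 u (du x)) ->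
  (forall x, `|du x| <= C) -> forall t s, `|u (t + s) - u t| <= C * `|s|.
Proof.
move=> du_ duC.
have cu : continuous u.
  by move=> x; apply/differentiable_continuous/derivable1_diffP; have [] := du_ x.
have H a b : a < b -> `|u b - u a| <= C * `|b - a|.
  move=> ab; have [c _ ->] := @MVT _ u du _ _ ab (fun x _ => du_ x) (continuous_subspaceT cu).
  by rewrite normrM ler_wpM2r.
move=> t s; have [s0|s0|->] := ltgtP s 0.
- rewrite -normrN opprB -(normrN s).
  have -> : - s = t - (t + s) by lra.
  by apply: H; lra.
- have {2}-> : s = (t + s) - t by lra.
  by apply: H; lra.
- by rewrite addr0 subrr !normr0 mulr0.
Qed.

(** The derivatives are supplied as witnesses, so that rules for sums, products
    and affine substitutions are structural inductions on m. *)
Fixpoint derivs_le (m : nat) (C : R) (u : R -> R) : Prop :=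
  (forall x, `|u x| <= C) /\
  match m with
  | 0 => True
  | m'.+1 => exists du : R -> R, (forall x : R, is_derive x 1 u (du x)) /\ derivs_le m' C du
  end.

Definition fdiff (s : R) (u : R -> R) (t : R) : R := u (t + s) - u t.

Lemma derivs_le_val m C u : derivs_le m C u -> forall x, `|u x| <= C.
Proof. by case: m => [|m] []. Qed.

Lemma is_derive_shift (u : R -> R) (s l x : R) : is_derive (x + s) 1 u l ->
  is_derive x 1 (fun y => u (y + s)) l.
Proof.
move=> H.
have D : is_derive x 1 (fun y => y + s) (1 : R).
  apply: is_derive_eq; by rewrite addr0.
have := @is_derive1_comp _ u (fun y => y + s) x l 1 H D.
by rewrite mulr1.
Qed.

Lemma is_derive_fdiff s m (u du : R -> R) : (forall x : R, is_derive x 1 u (du x)) ->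
  forall x : R, is_derive x 1 (iter m (fdiff s) u) (iter m (fdiff s) du x).
Proof.
elim: m u du => [//|m IH] u du H x.
rewrite !iterSr; apply: IH => {}x.
by apply: is_deriveB; apply: is_derive_shift.
Qed.

(** Differencing commutes with differentiation, so the mean value theorem can
    be applied once per difference, each time gaining a factor |s|. *)
Lemma fdiff_le m C u s : derivs_le m C u -> forall t, `|iter m (fdiff s) u t| <= C * `|s| ^+ m.
Proof.
elim: m u => [u [H _] t|m IH u [_ [du [udu Bdu]]] t]; first by rewrite mulr1.
rewrite iterS {1}/fdiff exprSr mulrA.
apply: mean_value_le.
  exact: is_derive_fdiff udu.
exact: IH.
Qed.

Lemma derivs_le_trans m C C' u : C <= C' -> derivs_le m C u -> derivs_le m C' u.
Proof.
move=> CC'; elim: m u => [|m IH] u [uC H]; split => //.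
- by move=> x; apply: le_trans CC'.
- by move=> x; apply: le_trans CC'.
- by case: H => du [? ?]; exists du; split => //; exact: IH.
Qed.

Lemma derivs_leW m C u : derivs_le m.+1 C u -> derivs_le m C u.
Proof.
elim: m u => [|m IH] u [uC H]; first by split.
case: H => du [H1 H2]; split => //; exists du; split => //; exact: IH.
Qed.

Lemma derivs_leD m C D u v : derivs_le m C u -> derivs_le m D v -> derivs_le m (C + D) (fun x =>
  u x + v x).
Proof.
elim: m u v => [|m IH] u v [uC Hu] [vD Hv]; split.
- by move=> x; rewrite (le_trans (ler_normD _ _))// lerD.
- by [].
- by move=> x; rewrite (le_trans (ler_normD _ _))// lerD.
- case: Hu => du [Hu Bu]; case: Hv => dv [Hv Bv]; exists (fun x => du x + dv x); split.
    by move=> x; apply: is_deriveD.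
  exact: IH.
Qed.

Lemma derivs_leZ m C a u : derivs_le m C u -> derivs_le m (`|a| * C) (fun x => a * u x).
Proof.
elim: m u => [|m IH] u [uC Hu]; split.
- by move=> x; rewrite normrM ler_wpM2l.
- by [].
- by move=> x; rewrite normrM ler_wpM2l.
- case: Hu => du [Hu Bu]; exists (fun x => a * du x); split; last exact: IH.
  by move=> x; apply: is_deriveZ.
Qed.

(** Leibniz's rule: each derivative doubles the number of products. *)
Lemma derivs_leM m C D u v : derivs_le m C u -> derivs_le m D v ->
  derivs_le m (2 ^+ m * (C * D)) (fun x => u x * v x).
Proof.
elim: m C D u v => [|m IH] C D u v Hu Hv.
  case: Hu => uC _; case: Hv => vD _; split => // x.
  by rewrite mul1r normrM ler_pM.
have C0 : 0 <= C by apply: le_trans (derivs_le_val Hu 0).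
have D0 : 0 <= D by apply: le_trans (derivs_le_val Hv 0).
have uC := derivs_le_val Hu; have vD := derivs_le_val Hv.
have Hu' := derivs_leW Hu; have Hv' := derivs_leW Hv.
split.
  move=> x; rewrite normrM; apply: (@le_trans _ _ (C * D)); first exact: ler_pM.
  by rewrite ler_peMl ?mulr_ge0// exprn_ege1// ler1n.
case: Hu => _ [du [Hu Bu]]; case: Hv => _ [dv [Hv Bv]].
exists (fun x => u x * dv x + v x * du x); split.
  move=> x; exact: is_deriveM.
have -> : 2 ^+ m.+1 * (C * D) = 2 ^+ m * (C * D) + 2 ^+ m * (D * C).
  by rewrite exprS; ring.
by apply: derivs_leD; apply: IH.
Qed.

Lemma derivs_le_affine m C u (a b B : R) : 1 <= B -> `|b| <= B -> derivs_le m C u ->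
  derivs_le m (B ^+ m * C) (fun t => u (a + t * b)).
Proof.
move=> B1 bB; elim: m u => [|m IH] u.
  by move=> [uC _]; split => // x; rewrite mul1r.
move=> Hu; have C0 : 0 <= C by apply: le_trans (derivs_le_val Hu 0).
case: Hu => uC [du [Hu Bu]]; split.
  move=> x; apply: (le_trans (uC _)).
  by rewrite ler_peMl// exprn_ege1.
exists (fun t => b * du (a + t * b)); split.
  move=> x.
  have D : is_derive x 1 (fun t => a + t * b) b.
    apply: (@is_derive_quadratic _ _ _ _ _ 0) => h; rewrite /GRing.scale/= mul0r.
    by rewrite (_ : _ - _ = 0) ?normr0//; ring.
  have := @is_derive1_comp _ u (fun t => a + t * b) x _ b (Hu _) D.
  by rewrite mulrC.
apply: (@derivs_le_trans _ (`|b| * (B ^+ m * C))).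
  by rewrite exprS -mulrA ler_wpM2r// mulr_ge0// exprn_ge0// (le_trans _ B1).
by apply: derivs_leZ; exact: IH.
Qed.

End OneD.

(** * A bump function with finitely many bounded derivatives *)

Section Bump.
Variable R : realType.

Definition pospow (m : nat) (x : R) : R := Num.max 0 x ^+ m.

(** The square is the first truncated power that is differentiable at the kink;
    in all four sign patterns the remainder is at most h^2. *)
Lemma is_derive_pospow2 (x : R) : is_derive x 1 (pospow 2) (2 * pospow 1 x).
Proof.
apply: (@is_derive_quadratic _ _ _ _ _ _ 1) => h.
rewrite /pospow expr1 mul1r /GRing.scale/= mulr1 ler_norml.
have [x0|x0] := leP 0 x; have [y0|y0] := leP 0 (h + x); apply/andP; split; nra.
Qed.

Lemma is_derive_pospow m (x : R) : is_derive x 1 (pospow m.+2) (m.+2%:R * pospow m.+1 x).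
Proof.
have E : pospow m.+2 = (fun y => y ^+ m) * pospow 2.
  apply/funext => y; rewrite fctE /pospow; have [y0|y0] := leP 0 y.
    by rewrite -exprD addn2.
  by rewrite !expr0n mulr0.
rewrite E.
have D : is_derive x 1 (fun y : R => y ^+ m) (m%:R * x ^+ m.-1).
  have := @is_deriveX _ _ id m x 1 1 (is_derive_id x 1).
  by rewrite exprfctE /GRing.scale/= mulr1.
apply: is_derive_eq; first exact: (is_deriveM D (is_derive_pospow2 x)).
rewrite /GRing.scale/= /pospow expr1; have [x0|x0] := leP 0 x.
  rewrite expr2; case: m {E D} => [|m]; first by rewrite expr0 expr1; ring.
  by rewrite /= -[m.+3]addn2 natrD !exprS; ring.
by rewrite !expr0n /= !mulr0 mul0r addr0.
Qed.

(** A piecewise polynomial bump on [0, 1]. Finitely many bounded derivatives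
    are all that the decay estimates use, and its derivatives are combinations
    of bumps with smaller exponents, which makes the constants explicit. *)
Definition bump (m l : nat) (t : R) : R := pospow m t * pospow l (1 - t).

Lemma is_derive_bump m l (x : R) : is_derive x 1 (bump m.+2 l.+2)
  (m.+2%:R * bump m.+1 l.+2 x - l.+2%:R * bump m.+2 l.+1 x).
Proof.
have D : is_derive x 1 (fun t => 1 - t) (-1 : R).
  by apply: (@is_derive_quadratic _ _ _ _ _ _ 0) => h; rewrite /GRing.scale/= mul0r
    (_ : _ - _ = 0) ?normr0//; ring.
have D2 := @is_derive1_comp _ (pospow l.+2) (fun t => 1 - t) x _ _ (is_derive_pospow l (1 - x)) D.
have := @is_deriveM _ _ (pospow m.+2) (pospow l.+2 \o (fun t => 1 - t)) x 1 _ _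
  (is_derive_pospow m x) D2.
rewrite (_ : bump m.+2 l.+2 = pospow m.+2 * (pospow l.+2 \o (fun t => 1 - t))) //; move=> H;
  apply: (is_derive_eq H).
by rewrite /GRing.scale/= /bump; ring.
Qed.

Lemma bump_ge0 m l t : 0 <= bump m l t.
Proof. by rewrite mulr_ge0// exprn_ge0// le_max lexx. Qed.

Lemma bump_supp m l t : ~~ (0 < t < 1) -> bump m.+1 l.+1 t = 0.
Proof.
rewrite negb_and -!leNgt => /orP[t0|t1]; rewrite /bump /pospow.
  by rewrite max_l// expr0n mul0r.
by rewrite [Num.max 0 (1 - t)]max_l ?subr_le0// [0 ^+ l.+1]expr0n mulr0.
Qed.

Lemma bump_le1 m l t : bump m.+1 l.+1 t <= 1.
Proof.
have [/andP[t0 t1]|t01] := boolP (0 < t < 1); last by rewrite bump_supp.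
rewrite /bump /pospow !max_r ?subr_ge0 ?(ltW t0) ?(ltW t1)//.
have ? := ltW t0; have ? := ltW t1.
by rewrite mulr_ile1// ?exprn_ge0 ?subr_ge0// exprn_ile1// ?subr_ge0 // gerBl.
Qed.

Lemma bump_ge m t : 4^-1 <= t <= 3 / 4 -> 4^-1 ^+ (m + m) <= bump m m t.
Proof.
move=> /andP[t0 t1]; rewrite /bump /pospow !max_r; [|lra|lra].
by rewrite exprD ler_pM ?exprn_ge0// ?invr_ge0// lerXn2r ?nnegrE//; lra.
Qed.

(** A derivative lowers one of the two exponents by one and brings down a
    factor at most N, whence the factor 2 N per derivative. *)
Lemma derivs_le_bump N j m l : (j < m <= N)%N -> (j < l <= N)%N ->
  derivs_le j ((2 * N%:R) ^+ j) (bump m l).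
Proof.
elim: j m l => [|j IH] m l.
  case: m => // m; case: l => // l _ _; split => // x.
  by rewrite ger0_norm ?bump_ge0// bump_le1.
case: m => [|[|m]]//; case: l => [|[|l]]// /andP[jm mN] /andP[jl lN]; split.
  move=> x; rewrite ger0_norm ?bump_ge0// (le_trans (bump_le1 _ _ _))//.
  rewrite exprn_ege1// -natrM ler1n muln_gt0/= (leq_trans _ mN)//.
exists (fun x => m.+2%:R * bump m.+1 l.+2 x - l.+2%:R * bump m.+2 l.+1 x); split.
  by move=> x; exact: is_derive_bump.
pose K : R := (2 * N%:R) ^+ j.
have K0 : 0 <= K by rewrite exprn_ge0// mulr_ge0.
apply: (@derivs_le_trans _ j (N%:R * K + N%:R * K)).
  by rewrite exprS -/K; nra.
have E : (fun x => m.+2%:R * bump m.+1 l.+2 x - l.+2%:R * bump m.+2 l.+1 x) =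
  (fun x => m.+2%:R * bump m.+1 l.+2 x + (- l.+2%:R) * bump m.+2 l.+1 x).
  by apply/funext => x; rewrite mulNr.
rewrite E; apply: derivs_leD.
  apply: (@derivs_le_trans _ _ (`|m.+2%:R| * K)).
    by rewrite ger0_norm// ler_wpM2r// ler_nat.
  by apply: derivs_leZ; apply: IH; apply/andP; split => //; apply: ltnW.
apply: (@derivs_le_trans _ _ (`|- l.+2%:R| * K)).
  by rewrite normrN ger0_norm// ler_wpM2r// ler_nat.
by apply: derivs_leZ; apply: IH; apply/andP; split => //; apply: ltnW.
Qed.

End Bump.

(** * Oscillatory integrals and their decay *)

Section Osc.
Variable R : realType.
Local Notation X3 := (measurableTypeR R * measurableTypeR R * measurableTypeR R)%type.
Local Notation mu3 := (@lebesgue3 R).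
Implicit Types (w : X3 -> R) (v y : 'cV[R]_3) (t : X3).

Definition unvec v : X3 := (v 0 0, v 1 0, v 2%:R 0).
Definition shiftv v t : X3 := trans3 (unvec v) t.

Lemma vec3_shiftv v t : vec3 (shiftv v t) = vec3 t + v.
Proof.
by apply/matrixP => i j; rewrite !ord1 !mxE; case: i => -[|[|[|//]]] ? /=;
  congr (_ + v _ 0); apply: val_inj.
Qed.

Lemma unvecK t : unvec (vec3 t) = t.
Proof. by case: t => [[a b] c]; rewrite /unvec !mxE. Qed.

Lemma vec3_inj : injective (@vec3 R).
Proof. exact: can_inj unvecK. Qed.

Lemma shiftvD u v t : shiftv u (shiftv v t) = shiftv (u + v) t.
Proof. by apply: vec3_inj; rewrite !vec3_shiftv addrAC addrA. Qed.

Lemma shiftv0 t : shiftv 0 t = t.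
Proof. by apply: vec3_inj; rewrite vec3_shiftv addr0. Qed.

Lemma measurable_shiftv v : measurable_fun setT (shiftv v).
Proof. exact: measurable_trans3. Qed.

Definition box (L : R) : set X3 :=
  (`[- L, L]%classic `*` `[- L, L]%classic) `*` `[- L, L]%classic.

Lemma boxE L t : box L t <-> forall j, `|vec3 t j 0| <= L.
Proof.
case: t => [[a b] c]; split => [[[/= + +] +] j|H].
  by rewrite !in_itv/= -!ler_norml => ? ? ?; rewrite mxE; case: j => -[|[|[|//]]].
have := H 0; have := H 1; have := H 2%:R; rewrite !mxE/= !ler_norml => ? ? ?.
by split; [split|]; rewrite /= in_itv.
Qed.

Lemma measurable_box L : measurable (box L).
Proof. by apply: measurableX; [apply: measurableX|]; exact: measurable_itv. Qed.

Lemma box_fin L : (mu3 (box L) < +oo)%E.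
Proof.
have F : ((@lebesgue_measure R) (`[(- L)%R, L]%classic : set R) < +oo)%E.
  by rewrite lebesgue_measure_itv/=; case: ifPn => _; rewrite ?ltry.
pose I : set (measurableTypeR R) := `[(- L)%R, L]%classic.
have mI : measurable I by exact: measurable_itv.
have E2 : lebesgue2 (I `*` I) = ((@lebesgue_measure R) I * (@lebesgue_measure R) I)%E.
  by apply: product_measure1E.
have -> : mu3 (box L) = (lebesgue2 (I `*` I) * (@lebesgue_measure R) I)%E.
  by apply: product_measure1E => //; exact: measurableX.
rewrite E2.
have F2 : ((@lebesgue_measure R) I * (@lebesgue_measure R) I < +oo)%E.
  by apply: lte_mul_pinfty; rewrite ?ge0_fin_numE.
by apply: lte_mul_pinfty; rewrite ?ge0_fin_numE ?mule_ge0.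
Qed.

Definition boxvol L : R := fine (mu3 (box L)).

Lemma boxvol_ge0 L : 0 <= boxvol L.
Proof. exact: fine_ge0. Qed.

(** Measurability, boundedness and bounded support are carried together: they
    make the oscillatory integrals converge, and they are stable under the
    operations performed on amplitudes. *)
Definition boxed (L C : R) w := measurable_fun setT w /\ forall t, `|w t| <= C * \1_(box L) t.

Lemma boxed_C0 L C w : 0 <= L -> boxed L C w -> 0 <= C.
Proof.
move=> L0 [_ /(_ (unvec 0))]; rewrite indicE mem_set ?mulr1; first exact: le_trans.
by apply/boxE => j; rewrite !mxE; case: j => -[|[|[|//]]] ?; rewrite /= mxE normr0.
Qed.

Lemma integrable_indic_box L : mu3.-integrable setT (EFin \o (\1_(box L) : X3 -> R)).
Proof.
have mL := measurable_box L.
apply/integrableP; split; first exact/measurable_EFinP/measurable_indic.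
under eq_integral => t _ do rewrite /= ger0_norm//.
by rewrite integral_indic// setIT; exact: box_fin.
Qed.

Lemma boxed_integrable L C w : boxed L C w -> mu3.-integrable setT (EFin \o w).
Proof.
move=> [mw wC].
apply: (@le_integrable _ _ _ mu3 setT measurableT _ (fun t => (C * \1_(box L) t)%:E)).
- exact/measurable_EFinP.
- by move=> t _; rewrite /= lee_fin (le_trans (wC t))// ler_norm.
- exact: integrable_scale (integrable_indic_box L).
Qed.

Lemma boxed_Rintegral_le L C w : boxed L C w -> `|\int[mu3]_t w t| <= C * boxvol L.
Proof.
move=> bw; have iw := boxed_integrable bw; have [mw wC] := bw.
apply: (le_trans (le_normr_Rintegral measurableT iw)).
have -> : C * boxvol L = \int[mu3]_t (C * \1_(box L) t).
  rewrite RintegralZl//; last exact: integrable_indic_box.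
  by rewrite /boxvol /Rintegral integral_indic ?setIT//; exact: measurable_box.
apply: le_Rintegral => //.
- exact: (integrable_norm iw).
- exact: integrable_scale (integrable_indic_box L).
Qed.

Lemma boxed_mono L L' C w : 0 <= L -> L <= L' -> boxed L C w -> boxed L' C w.
Proof.
move=> L0 LL' bw; have C0 := boxed_C0 L0 bw; have [mw wC] := bw; split => // t.
apply: (le_trans (wC t)); rewrite ler_wpM2l// !indicE ler_nat.
have [/set_mem/boxE H|//] := boolP (t \in box L).
by rewrite mem_set//; apply/boxE => j; apply: le_trans LL'.
Qed.

Lemma boxedM L C D w (g : X3 -> R) : 0 <= L -> boxed L C w -> measurable_fun setT g ->
  (forall t, box L t -> `|g t| <= D) -> boxed L (C * D) (fun t => w t * g t).
Proof.
move=> L0 bw mg gD; have C0 := boxed_C0 L0 bw; have [mw wC] := bw; split.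
  exact: measurable_funM.
move=> t; rewrite normrM; have := wC t; rewrite !indicE.
have [/set_mem Lt|_] := boolP (t \in box L); rewrite ?mulr1 ?mulr0 => wt.
  by rewrite ler_pM// gD.
by rewrite (le_anti (introT andP (conj wt (normr_ge0 _)))) mul0r.
Qed.

Lemma boxedD L C D w1 w2 : boxed L C w1 -> boxed L D w2 -> boxed L (C + D) (fun t => w1 t + w2 t).
Proof.
move=> [m1 c1] [m2 c2]; split; first exact: measurable_funD.
by move=> t; rewrite mulrDl (le_trans (ler_normD _ _))// lerD.
Qed.

Lemma boxedN L C w : boxed L C w -> boxed L C (fun t => - w t).
Proof.
move=> [m1 c1]; split; first exact: measurable_funN.
by move=> t; rewrite normrN.
Qed.

Lemma boxed_shiftv L C a w v : 0 <= L -> boxed L C w -> (forall j, `|v j 0| <= a) ->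
  boxed (L + a) C (w \o shiftv v).
Proof.
move=> L0 bw va; have C0 := boxed_C0 L0 bw; have [mw wC] := bw; split.
  by apply: measurableT_comp => //; exact: measurable_shiftv.
move=> t; apply: (le_trans (wC _)); rewrite ler_wpM2l// !indicE ler_nat.
have [/set_mem/boxE H|//] := boolP (_ \in box L).
rewrite mem_set//; apply/boxE => j.
have := H j; rewrite vec3_shiftv mxE => {}H.
by have -> : vec3 t j 0 = (vec3 t j 0 + v j 0) - v j 0;
  [rewrite addrK|rewrite (le_trans (ler_normB _ _))// lerD].
Qed.

Lemma dotpE y v : dotp y v = y 0 0 * v 0 0 + y 1 0 * v 1 0 + y 2%:R 0 * v 2%:R 0.
Proof. exact: sum_ord3. Qed.

Lemma dotpDr y u v : dotp y (u + v) = dotp y u + dotp y v.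
Proof. by rewrite /dotp -big_split/=; apply: eq_bigr => j _; rewrite mxE mulrDr. Qed.

Lemma dotpZr y s v : dotp y (s *: v) = s * dotp y v.
Proof. by rewrite /dotp mulr_sumr; apply: eq_bigr => j _; rewrite mxE mulrCA. Qed.

Lemma dotpC y v : dotp y v = dotp v y.
Proof. by apply: eq_bigr => j _; rewrite mulrC. Qed.

Lemma continuous_dotp y : continuous (dotp y : 'cV[R]_3 -> R).
Proof.
have -> : dotp y = (fun x : 'cV[R]_3 => y 0 0 * x 0 0 + y 1 0 * x 1 0 + y 2%:R 0 * x 2%:R 0).
  by apply/funext => x; rewrite dotpE.
have C j : continuous (fun x : 'cV[R]_3 => y j 0 * x j 0).
  by move=> x; apply: cvgMl_tmp; [exact: nbhs_filter|exact: coord_continuous].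
by move=> x; exact: (continuousD (continuousD (@C 0 x) (@C 1 x)) (@C 2%:R x)).
Qed.

(** The phase c is a parameter because differentiation advances it by a quarter
    turn; sines then need no separate treatment. *)
Definition wave y (c : R) t : R := cos (2 * pi * dotp y (vec3 t) + c).

Lemma measurable_wave y c : measurable_fun setT (wave y c).
Proof.
apply: (@measurable_continuous_vec3 R (fun x => cos (2 * pi * dotp y x + c))) => x.
apply: continuous_comp; last exact: continuous_cos.
have C : {for x, continuous (fun x : 'cV[R]_3 => 2 * pi * dotp y x)}.
  by apply: cvgMl_tmp; [exact: nbhs_filter|exact: continuous_dotp].
exact: (continuousD C (@cst_continuous _ _ c x)).
Qed.

Lemma wave_le1 y c t : `|wave y c t| <= 1.
Proof. by rewrite ler_norml cos_geN1 cos_le1. Qed.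

Definition osc w y c : R := \int[mu3]_t (w t * wave y c t).

Lemma boxed_wave L C w y c : 0 <= L -> boxed L C w -> boxed L C (fun t => w t * wave y c t).
Proof.
move=> L0 bw; rewrite -[C]mulr1; apply: boxedM => //; [exact: measurable_wave|by move=> t _;
  exact: wave_le1].
Qed.

Definition vdiff v w t : R := w (shiftv v t) - w t.

Lemma boxed_vdiff L C a w v : 0 <= L -> 0 <= a -> boxed L C w -> (forall j, `|v j 0| <= a) ->
  boxed (L + a) (C + C) (vdiff v w).
Proof.
move=> L0 a0 bw va; apply: boxedD; first exact: boxed_shiftv.
by apply/boxedN/(boxed_mono L0) => //; rewrite lerDl.
Qed.

(** Translating by half a period changes the sign of the wave, while the
    Lebesgue measure is invariant under translations. *)
Lemma osc_vdiff L C w y c v : 0 <= L -> boxed L C w -> dotp y v = 2^-1 ->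
  osc (vdiff v w) y c = - 2 * osc w y c.
Proof.
move=> L0 bw yv; rewrite /osc.
have bww := boxed_wave y c L0 bw.
have E t : wave y c (shiftv v t) = - wave y c t.
  rewrite /wave vec3_shiftv dotpDr yv.
  by rewrite (_ : _ + c = 2 * pi * dotp y (vec3 t) + c + pi) ?cosDpi//; field.
have i1 := boxed_integrable bww.
have i2 := integrable_trans3 (unvec v) i1.
have H : \int[mu3]_t (w (shiftv v t) * wave y c (shiftv v t)) = \int[mu3]_t (w t * wave y c t).
  exact: (Rintegral_trans3 (unvec v) i1).
rewrite (_ : (fun _ => _) = (fun t => (- 1) * (w (shiftv v t) * wave y c (shiftv v t)) + (-1) *
  (w t * wave y c t))); last first.
  by apply/funext => t; rewrite E /vdiff; ring.
rewrite RintegralD//; last 2 first.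
- exact: integrable_scale i2.
- exact: integrable_scale i1.
rewrite (RintegralZl (f := fun t => w (shiftv v t) * wave y c (shiftv v t)))//.
rewrite RintegralZl// H; ring.
Qed.

Lemma osc_iter_vdiff L C a w y c v M : 0 <= L -> 0 <= a -> boxed L C w -> (forall j,
  `|v j 0| <= a) ->
  dotp y v = 2^-1 ->
  (exists C', boxed (L + a *+ M) C' (iter M (vdiff v) w)) /\
  osc (iter M (vdiff v) w) y c = (- 2) ^+ M * osc w y c.
Proof.
move=> L0 a0 bw va yv; elim: M => [|M [[C' IH1] IH2]].
  by rewrite mulr0n addr0 expr0 mul1r; split => //; exists C.
have LM : 0 <= L + a *+ M by rewrite addr_ge0// mulrn_wge0.
split; last by rewrite iterS (osc_vdiff _ LM IH1)// IH2 exprS mulrA.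
by exists (C' + C'); rewrite iterS mulrSr addrA; exact: (boxed_vdiff LM a0 IH1 va).
Qed.

(** Reduces bounds on differences of the amplitude to functions of one
    variable, where the mean value theorem applies. *)
Lemma iter_vdiffE M s v w t :
  iter M (vdiff (s *: v)) w t = iter M (fdiff s) (fun r => w (shiftv (r *: v) t)) 0.
Proof.
have E : forall r, iter M (fdiff s) (fun r => w (shiftv (r *: v) t)) r =
   iter M (vdiff (s *: v)) w (shiftv (r *: v) t).
  elim: M => [//|M IH] r; rewrite !iterS {1}/fdiff !IH /vdiff shiftvD.
  by rewrite (addrC r) scalerDl.
by rewrite E scale0r shiftv0.
Qed.

(** The substitute for M integrations by parts: after M half-period differences
    along v the integral is multiplied by (-2)^M, while the amplitude shrinks
    by the M-th power of the step 1 / (2 <y, v>). The assumption |<y, v>| >= 1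
    keeps the step at most 1, so that the support stays in a cube of fixed
    size. *)
Lemma osc_decay w y v c M L C D a : 0 <= L -> 0 <= a -> boxed L C w ->
  (forall j, `|v j 0| <= a) -> 1 <= `|dotp y v| ->
  (forall s t, `|iter M (fdiff s) (fun r => w (shiftv (r *: v) t)) 0| <= D * `|s| ^+ M) ->
  `|osc w y c| <= D * boxvol (L + a *+ M) / `|dotp y v| ^+ M.
Proof.
move=> L0 a0 bw va yv1 wD.
have yv0 : dotp y v != 0 by rewrite -normr_gt0 (lt_le_trans _ yv1).
(* The step for which s v is half a period of the wave. *)
pose s := (2 * dotp y v)^-1.
have s1 : `|s| <= 1.
  rewrite normfV invf_le1 ?normr_gt0 ?mulf_neq0 ?pnatr_eq0// normrM ger0_norm//.
  by rewrite (le_trans yv1)// ler_peMl// ler1n.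
have D0 : 0 <= D by have := wD 1 (unvec 0); rewrite normr1 expr1n mulr1; apply: le_trans.
have sv j : `|(s *: v) j 0| <= a.
  by rewrite mxE normrM (le_trans (ler_wpM2r _ s1))// mul1r.
have ysv : dotp y (s *: v) = 2^-1.
  by rewrite dotpZr /s invfM -mulrA mulVf// mulr1.
have [[C' B] E] := osc_iter_vdiff c M L0 a0 bw sv ysv.
have LM : 0 <= L + a *+ M by rewrite addr_ge0// mulrn_wge0.
have B' : boxed (L + a *+ M) (D * `|s| ^+ M) (iter M (vdiff (s *: v)) w).
  case: B => mB B; split => // t; have := B t; rewrite !indicE.
  case: (t \in box _); first by rewrite !mulr1 => _; rewrite iter_vdiffE.
  by rewrite !mulr0.
have := boxed_Rintegral_le (boxed_wave y c LM B').
rewrite -/(osc _ y c) E normrM normrX normrN (ger0_norm (ler0n R 2))//.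
rewrite /s normfV normrM (ger0_norm (ler0n R 2))// => H.
have P : 0 < (2 : R) ^+ M by rewrite exprn_gt0.
rewrite -(ler_pM2l P); apply: (le_trans H).
rewrite exprVn exprMn invfM [leLHS](_ : _ = (2 ^+ M)^-1 * (D * boxvol (L + a *+ M) / `|dotp y v|
  ^+ M)); last by ring.
rewrite ler_wpM2r ?mulr_ge0 ?boxvol_ge0 ?invr_ge0 ?exprn_ge0//.
by rewrite (@le_trans _ _ 1)// ?invf_le1// exprn_ege1// ler1n.
Qed.

End Osc.

(** * Derivatives of oscillatory integrals *)

Section OscDeriv.
Variable R : realType.
Local Notation X3 := (measurableTypeR R * measurableTypeR R * measurableTypeR R)%type.
Local Notation mu3 := (@lebesgue3 R).
Implicit Types (w : X3 -> R) (v y : 'cV[R]_3) (t : X3).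

Lemma cos_taylor1 (a u : R) : `|cos (a + u) - cos a - u * cos (a + pi / 2)| <= u ^+ 2.
Proof.
have D (b x : R) : is_derive x (1:R) (fun x => cos (b + x)) (- sin (b + x)).
  have D1 : is_derive x (1:R) (fun x => b + x) (1:R).
    by apply: (@is_derive_quadratic _ _ _ _ _ _ 0) => h; rewrite /GRing.scale/= mul0r
      (_ : _ - _ = 0) ?normr0//; ring.
  have := @is_derive1_comp _ cos (fun x => b + x) x _ _ (is_derive_cos (b + x)) D1.
  by rewrite mulr1.
have cC (b : R) : continuous (fun x : R => cos (b + x)).
  by move=> x; apply/differentiable_continuous/derivable1_diffP; have [] := D b x.
have sL x : `|sin (a + x) - sin a| <= `|x|.
  have E z : sin (a + z) = cos (a - pi / 2 + z).
    by rewrite -cosBpihalf; congr cos; lra.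
  have := @mean_value_le R (fun x => cos (a - pi / 2 + x)) _ 1 (D (a - pi / 2)) _ 0 x.
  rewrite mul1r add0r -!E addr0; apply => z.
  by rewrite normrN ler_norml sin_geN1 sin_le1.
rewrite cosDpihalf.
have H z : `|z| <= `|u| -> cos (a + u) - cos a = - sin (a + z) * u ->
    `|cos (a + u) - cos a - u * - sin a| <= u ^+ 2.
  move=> zu ->; rewrite (_ : _ - _ = - (sin (a + z) - sin a) * u); last by ring.
  rewrite normrM normrN -real_normK ?num_real// expr2 ler_wpM2r//.
  exact: le_trans zu.
have [u0|u0] := leP 0 u.
  have [z] := @MVT_segment _ (fun x => cos (a + x)) _ _ _ u0 (fun x _ => D a x)
    (continuous_subspaceT (cC a)).
  rewrite in_itv/= subr0 addr0 => /andP[z0 zu] E; apply: (H z) => //.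
  by rewrite !ger0_norm.
have [z] := @MVT_segment _ (fun x => cos (a + x)) _ _ _ (ltW u0) (fun x _ => D a x)
  (continuous_subspaceT (cC a)).
rewrite in_itv/= sub0r addr0 => /andP[z0 zu] E; apply: (H z).
  by rewrite !ler0_norm ?lerN2 // ltW.
by rewrite -[LHS]opprB E; ring.
Qed.

Lemma dotp_box_le L y t : box L t -> `|dotp y (vec3 t)| <= (\sum_j `|y j 0|) * L.
Proof.
move=> /boxE bt; rewrite /dotp (le_trans (ler_norm_sum _ _ _))// mulr_suml.
by apply: ler_sum => j _; rewrite normrM ler_wpM2l.
Qed.

Lemma measurable_dotp y : measurable_fun setT (fun t : X3 => dotp y (vec3 t)).
Proof. exact: (measurable_continuous_vec3 (@continuous_dotp R y)). Qed.

Definition freq (v : 'cV[R]_3) t : R := 2 * pi * dotp v (vec3 t).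

Lemma measurable_freq v : measurable_fun setT (freq v).
Proof. by apply: measurable_funM => //; exact: measurable_dotp. Qed.

Lemma boxed_freq L C w v m : 0 <= L -> boxed L C w ->
  boxed L (C * (2 * pi * ((\sum_j `|v j 0|) * L)) ^+ m) (fun t => w t * freq v t ^+ m).
Proof.
move=> L0 bw; apply: boxedM => //.
  by apply: measurable_funX; exact: measurable_freq.
move=> t bt; rewrite normrX lerXn2r ?nnegrE//.
  by rewrite !mulr_ge0 ?pi_ge0// sumr_ge0.
rewrite /freq normrM ger0_norm ?mulr_ge0 ?pi_ge0//.
by rewrite ler_wpM2l ?mulr_ge0 ?pi_ge0// dotp_box_le.
Qed.

(** Differentiation under the integral sign: the second-order remainder of the
    wave is bounded uniformly on the support of the amplitude. *)
Lemma is_derive_osc L C w (B : 'M[R]_3) (c : R) (v x : 'cV[R]_3) : 0 <= L -> boxed L C w ->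
  is_derive x v (fun x => osc w (B *m x) c)
    (osc (fun t => w t * freq (B *m v) t) (B *m x) (c + pi / 2)).
Proof.
move=> L0 bw.
(* A bound for the frequency <B v, t> on the support of the amplitude. *)
pose D : R := 2 * pi * ((\sum_j `|(B *m v) j 0|) * L).
have bf : boxed L (C * D) (fun t => w t * freq (B *m v) t).
  by have := boxed_freq (B *m v) 1 L0 bw; rewrite expr1.
apply: (@is_derive_quadratic _ _ _ _ _ _ (C * D ^+ 2 * boxvol L)) => h.
have b1 := boxed_wave (B *m (h *: v + x)) c L0 bw.
have b2 := boxed_wave (B *m x) c L0 bw.
have b3 := boxed_wave (B *m x) (c + pi / 2) L0 bf.
have i1 := boxed_integrable b1; have i2 := boxed_integrable b2; have i3 := boxed_integrable b3.
pose G t := w t * wave (B *m (h *: v + x)) c t - w t * wave (B *m x) c t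
  - h * (w t * freq (B *m v) t * wave (B *m x) (c + pi / 2) t).
have i3' : mu3.-integrable setT (EFin \o (fun t => h * (w t * freq (B *m v) t * wave (B *m x) (c
  + pi / 2) t))).
  exact: integrable_scale i3.
have i12 : mu3.-integrable setT (EFin \o (fun t => w t * wave (B *m (h *: v + x)) c t - w t *
  wave (B *m x) c t)).
  have := integrableB (mu := mu3) measurableT i1 i2.
  by apply: eq_integrable => // t _; rewrite /= EFinB.
have -> : osc w (B *m (h *: v + x)) c - osc w (B *m x) c -
    h * osc (fun t => w t * freq (B *m v) t) (B *m x) (c + pi / 2) = \int[mu3]_t G t.
  by rewrite /osc /G RintegralB// RintegralB// RintegralZl.
rewrite mulrAC; apply: (boxed_Rintegral_le (L := L)); split.
  have [m1 _] := b1; have [m2 _] := b2; have [m3 _] := b3.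
  by apply: measurable_funB; [apply: measurable_funB|apply: measurable_funM].
move=> t.
have E : G t = w t * (cos (2 * pi * dotp (B *m x) (vec3 t) + c + h * freq (B *m v) t)
   - cos (2 * pi * dotp (B *m x) (vec3 t) + c) -
   (h * freq (B *m v) t) * cos (2 * pi * dotp (B *m x) (vec3 t) + c + pi / 2)).
  rewrite /G /wave !mulrBr addrA; congr (_ * cos _ - _ - _); last by ring.
  rewrite mulmxDr -scalemxAr dotpC dotpDr dotpZr /freq -2!(dotpC (vec3 t)) ; ring.
rewrite E normrM.
have [_ /(_ t)] := bw; rewrite indicE; have [/set_mem bt|_] := boolP (t \in box L);
  rewrite ?mulr1 ?mulr0 => wC; last first.
  by rewrite (le_anti (introT andP (conj wC (normr_ge0 _)))) mul0r.
rewrite -[X in _ <= X]mulrA; apply: ler_pM => //.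
apply: (le_trans (cos_taylor1 _ _)).
rewrite exprMn mulrC ler_wpM2r ?sqr_ge0//.
have D0 : 0 <= D by rewrite !mulr_ge0 ?pi_ge0// sumr_ge0.
rewrite -real_normK ?num_real// lerXn2r ?nnegrE//.
rewrite /freq normrM ger0_norm ?mulr_ge0 ?pi_ge0//.
by rewrite ler_wpM2l ?mulr_ge0 ?pi_ge0// dotp_box_le.
Qed.

(** The function x |-> int (wr + i wi)(t) (2 i pi <B v, t>)^m exp (2 i pi <B x,
    t>) dt, where the factor i^m is absorbed into the phases m pi / 2. With v =
    e_j it is the m-th derivative in direction j of its value for m = 0. *)
Definition cosc (wr wi : X3 -> R) (B : 'M[R]_3) (v : 'cV[R]_3) (m : nat) (x : 'cV[R]_3) : R[i] :=
  let f w := (fun t => w t * freq (B *m v) t ^+ m) in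
  let c := m%:R * (pi / 2) in
  (osc (f wr) (B *m x) c + osc (f wi) (B *m x) (c + pi / 2))
  +i* (osc (f wr) (B *m x) (c - pi / 2) + osc (f wi) (B *m x) c).

Lemma pderiv_cosc L C wr wi B j m : 0 <= L -> boxed L C wr -> boxed L C wi ->
  pderiv j (cosc wr wi B (delta_mx j 0) m) = cosc wr wi B (delta_mx j 0) m.+1.
Proof.
move=> L0 br bi; apply/funext => x; rewrite /pderiv /cosc/=.
set v := delta_mx j 0.
have H w c c' : boxed L C w -> c + pi / 2 = c' -> is_derive x v
   (fun x => osc (fun t => w t * freq (B *m v) t ^+ m) (B *m x) c)
   (osc (fun t => w t * freq (B *m v) t ^+ m.+1) (B *m x) c').
  move=> bw <-; have := is_derive_osc B c v x L0 (boxed_freq (B *m v) m L0 bw).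
  rewrite (_ : (fun t => w t * _ ^+ m * _) = (fun t => w t * freq (B *m v) t ^+ m.+1))//.
  by apply/funext => t; rewrite exprSr mulrA.
have E : m.+1%:R * (pi / 2) = m%:R * (pi / 2) + pi / 2 :> R by rewrite -natr1 mulrDl mul1r.
congr (_ +i* _).
- have := @is_deriveD _ _ _ _ _ x v _ _ (H wr (m%:R * (pi / 2)) (m.+1%:R * (pi / 2)) br (esym E))
    (H wi (m%:R * (pi / 2) + pi / 2) (m.+1%:R * (pi / 2) + pi / 2) bi _).
  by case; [by rewrite E|move=> _ ->].
- have := @is_deriveD _ _ _ _ _ x v _ _ (H wr (m%:R * (pi / 2) - pi / 2) (m.+1%:R * (pi / 2) -
  pi / 2) br _)
    (H wi (m%:R * (pi / 2)) (m.+1%:R * (pi / 2)) bi (esym E)).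
  by case; [by rewrite E; ring|move=> _ ->].
Qed.

Lemma iter_pderiv_cosc L C wr wi B j m : 0 <= L -> boxed L C wr -> boxed L C wi ->
  iter m (pderiv j) (cosc wr wi B (delta_mx j 0) 0) = cosc wr wi B (delta_mx j 0) m.
Proof.
by move=> L0 br bi; elim: m => [//|m IH]; rewrite iterS IH; exact: (pderiv_cosc _ _ _ L0 br bi).
Qed.

Lemma mderiv_pure (j : 'I_3) m (f : 'cV[R]_3 -> R[i]) :
  mderiv [ffun i => if i == j then m else 0%N] f = iter m (pderiv j) f.
Proof.
rewrite /mderiv.
have H (s : seq 'I_3) : uniq s -> foldr (fun i => iter ([ffun i => if i == j then m else 0%N] i)
  (pderiv i)) f s
   = if j \in s then iter m (pderiv j) f else f.
  elim: s => [//|i s IH] /= /andP[is_ us]; rewrite IH// ffunE inE eq_sym.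
  have [->|//] := eqVneq j i.
  by case: (eqVneq i i) => // _; rewrite (negbTE is_).
by rewrite H ?enum_uniq// mem_enum.
Qed.

Lemma msize_pure (j : 'I_3) m : msize [ffun i => if i == j then m else 0%N] = m.
Proof.
rewrite /msize (bigD1 j)//= ffunE eqxx big1 ?addn0// => i ij.
by rewrite ffunE (negbTE ij).
Qed.

End OscDeriv.

(** * Iterated partial derivatives after a linear change of variables *)

Section Chain.
Variable R : realType.
Implicit Types (f : 'cV[R]_3 -> R[i]) (x v : 'cV[R]_3) (A : 'M[R]_3).

Lemma is_derive_mulmx (u : 'cV[R]_3 -> R) A v x : differentiable u (A *m x) ->
  is_derive x v (fun x => u (A *m x)) (\sum_a (A *m v) a 0 * 'D_(delta_mx a 0) u (A *m x)).
Proof.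
move=> du.
have D : is_derive (A *m x) (A *m v) u ('D_(A *m v) u (A *m x)).
  by apply: derivableP; exact: diff_derivable.
have E : 'D_(A *m v) u (A *m x) = \sum_a (A *m v) a 0 * 'D_(delta_mx a 0) u (A *m x).
  rewrite deriveE// [in LHS](_ : A *m v = \sum_a (A *m v) a 0 *: delta_mx a 0); last first.
    by rewrite [LHS]matrix_sum_delta; apply: eq_bigr => a _; rewrite big_ord1.
  rewrite linear_sum; apply: eq_bigr => a _.
  by rewrite linearZ/= -deriveE.
rewrite -E; case: D => dA _.
have F h : (A *m (h *: v + x)) = h *: (A *m v) + A *m x by rewrite mulmxDr scalemxAr.
have FE : (fun h => h^-1 *: (((fun x => u (A *m x)) \o shift x) (h *: v) - u (A *m x))) =
    (fun h => h^-1 *: ((u \o shift (A *m x)) (h *: (A *m v)) - u (A *m x))).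
  by apply/funext => h; rewrite /= F.
by apply: DeriveDef; rewrite /derivable /derive FE.
Qed.

Variables (f : 'cV[R]_3 -> R[i]) (A : 'M[R]_3).
Hypothesis sf : smooth f.

(** Linear combinations of iterated partial derivatives of f, evaluated at A x.
    Recording coefficients and index sequences in a list gives a class of
    functions that contains f \o A and is closed under differentiation. *)
Definition chain_sum (l : seq (R * seq 'I_3)) : 'cV[R]_3 -> R[i] := fun x =>
  (\sum_(k <- l) k.1 * complex.Re (foldr (@pderiv R) f k.2 (A *m x)))
  +i* (\sum_(k <- l) k.1 * complex.Im (foldr (@pderiv R) f k.2 (A *m x))).

Definition chain_step (j : 'I_3) (l : seq (R * seq 'I_3)) :=
  [seq (k.1 * (A *m (delta_mx j 0 : 'cV[R]_3)) a 0, a :: k.2) | k <- l, a <- enum 'I_3].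

Lemma is_derive_chain_sum j l x :
  is_derive x (delta_mx j 0) (fun x => complex.Re (chain_sum l x)) (complex.Re (chain_sum
    (chain_step j l) x)) /\
  is_derive x (delta_mx j 0) (fun x => complex.Im (chain_sum l x)) (complex.Im (chain_sum
    (chain_step j l) x)).
Proof.
have H (p : R[i] -> R) : (forall s x, differentiable (fun y => p (foldr (@pderiv R) f s y)) x) ->
   (forall a s x, 'D_(delta_mx a 0) (fun y => p (foldr (@pderiv R) f s y)) x = p (foldr (@pderiv
     R) f (a :: s) x)) ->
   is_derive x (delta_mx j 0) (fun x => \sum_(k <- l) k.1 * p (foldr (@pderiv R) f k.2 (A *m x)))
      (\sum_(k <- chain_step j l) k.1 * p (foldr (@pderiv R) f k.2 (A *m x))).
  move=> dp Dp; elim: l => [|[c s] l IH].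
    rewrite /chain_step/= big_nil.
    under eq_fun do rewrite big_nil.
    exact: is_derive_cst.
  rewrite /chain_step /= big_cat/= -/(chain_step j l).
  under eq_fun do rewrite big_cons/=.
  apply: is_deriveD => //.
  have K := @is_deriveZ _ _ _ _ c _ _ _ (@is_derive_mulmx (fun y => p (foldr (@pderiv R) f s y))
    A (delta_mx j 0) x (dp s (A *m x))).
  apply: (is_derive_eq K).
  rewrite big_map /GRing.scale/= mulr_sumr -[index_enum _]enumT; apply: eq_bigr => a _ /=.
  by rewrite Dp mulrA.
split; apply: H => //.
- by move=> s y; have [] := sf s y.
- by move=> s y; have [] := sf s y.
Qed.

Lemma pderiv_chain_sum j l : pderiv j (chain_sum l) = chain_sum (chain_step j l).
Proof.
apply/funext => x; rewrite /pderiv.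
have [[_ ->] [_ ->]] := is_derive_chain_sum j l x.
by [].
Qed.

Definition pulled : 'cV[R]_3 -> R[i] := fun x => f (A *m x).

Lemma iter_pderiv_pulled j m : exists l, iter m (pderiv j) pulled = chain_sum l.
Proof.
elim: m => [|m [l IH]]; last by exists (chain_step j l); rewrite iterS IH pderiv_chain_sum.
exists [:: (1, [::])]; apply/funext => x; rewrite /chain_sum !big_seq1/= !mul1r /pulled.
by case: (f _).
Qed.

Lemma is_derive_iter_pulled j m x :
  is_derive x (delta_mx j 0) (fun x => complex.Re (iter m (pderiv j) pulled x))
    (complex.Re (iter m.+1 (pderiv j) pulled x)) /\
  is_derive x (delta_mx j 0) (fun x => complex.Im (iter m (pderiv j) pulled x))
    (complex.Im (iter m.+1 (pderiv j) pulled x)).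
Proof.
have [l E] := iter_pderiv_pulled j m; rewrite iterS E pderiv_chain_sum.
exact: is_derive_chain_sum.
Qed.

Lemma is_derive_line (u : 'cV[R]_3 -> R) (z v : 'cV[R]_3) (r l : R) :
  is_derive (z + r *: v) v u l -> is_derive r (1:R) (fun r => u (z + r *: v)) l.
Proof.
have F h : z + (h *: (1:R) + r) *: v = h *: v + (z + r *: v).
  by rewrite /GRing.scale/= mulr1 -/(GRing.scale _ _) scalerDl addrCA.
case=> dA E.
have FE : (fun h : R => h^-1 *: (((fun r => u (z + r *: v)) \o shift r) (h *: (1 : R)) - u (z +
  r *: v))) =
    (fun h => h^-1 *: ((u \o shift (z + r *: v)) (h *: v) - u (z + r *: v))).
  by apply/funext => h; rewrite /= F.
by apply: DeriveDef; rewrite /derivable ?/derive FE.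
Qed.

Lemma Re_Im_le_normc (z : R[i]) : `|complex.Re z| <= Normc.normc z /\ `|complex.Im z| <=
  Normc.normc z.
Proof.
case: z => a b /=; split; rewrite -sqrtr_sqr ler_sqrt ?addr_ge0 ?sqr_ge0//.
  by rewrite lerDl sqr_ge0.
by rewrite lerDr sqr_ge0.
Qed.

(** Along a line in direction j the derivatives of f \o A are its iterated
    partial derivatives, and smoothness of f makes each of them differentiable.
    *)
Lemma derivs_le_pulled j M C z :
  (forall m x, (m <= M)%N -> Normc.normc (iter m (pderiv j) pulled x) <= C) ->
  derivs_le M C (fun r => complex.Re (pulled (z + r *: delta_mx j 0))) /\
  derivs_le M C (fun r => complex.Im (pulled (z + r *: delta_mx j 0))).
Proof.
move=> H.
have G (p : R[i] -> R) : (forall z, `|p z| <= Normc.normc z) ->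
  (forall m x, is_derive x (delta_mx j 0) (fun x => p (iter m (pderiv j) pulled x))
     (p (iter m.+1 (pderiv j) pulled x))) ->
  derivs_le M C (fun r => p (pulled (z + r *: delta_mx j 0))).
  move=> pn dp.
  suff K n m : (m + n <= M)%N -> derivs_le n C (fun r => p (iter m (pderiv j) pulled (z + r *:
    delta_mx j 0))).
    exact: (K M 0%N).
  elim: n m => [|n IH] m mn; split => //.
  - by move=> x; apply: (le_trans (pn _)); apply: H; rewrite -(addn0 m).
  - by move=> x; apply: (le_trans (pn _)); apply: H; rewrite (leq_trans _ mn)// leq_addr.
  - exists (fun r => p (iter m.+1 (pderiv j) pulled (z + r *: delta_mx j 0))); split.
      by move=> x; apply: (@is_derive_line (fun x => p (iter m (pderiv j) pulled x))).
    by apply: IH; rewrite addSnnS.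
split; apply: G => [y|m x].
- by have [] := Re_Im_le_normc y.
- by have [] := is_derive_iter_pulled j m x.
- by have [] := Re_Im_le_normc y.
- by have [] := is_derive_iter_pulled j m x.
Qed.

End Chain.

(** * Entrywise bounds and the shearlet group *)

Section Mx.
Variable R : realType.
Implicit Types A B : 'M[R]_3.

Definition entries_le (K : R) m n (A : 'M[R]_(m, n)) := forall i j, `|A i j| <= K.

Lemma entries_le_mul K1 K2 m n p (A : 'M[R]_(m, n)) (B : 'M[R]_(n, p)) :
  entries_le K1 A -> entries_le K2 B -> entries_le (n%:R * (K1 * K2)) (A *m B).
Proof.
move=> HA HB i j; rewrite mxE (le_trans (ler_norm_sum _ _ _))//.
apply: (@le_trans _ _ (\sum_(a < n) K1 * K2)).
  by apply: ler_sum => a _; rewrite normrM ler_pM.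
by rewrite sumr_const card_ord mulr_natl.
Qed.

Lemma entries_le_trans K1 K2 m n (A : 'M[R]_(m, n)) : K1 <= K2 -> entries_le K1 A -> entries_le
  K2 A.
Proof. by move=> K12 HA i j; apply: le_trans K12. Qed.

Lemma entries_le_det K n (A : 'M[R]_n) : entries_le K A -> `|\det A| <= n`!%:R * K ^+ n.
Proof.
move=> HA; rewrite /determinant (le_trans (ler_norm_sum _ _ _))//.
apply: (@le_trans _ _ (\sum_(s : 'S_n) K ^+ n)).
  apply: ler_sum => s _; rewrite normrM normrX normrN1 expr1n mul1r normr_prod.
  rewrite -[X in K ^+ X](card_ord n) -prodr_const.
  by apply: ler_prod => i _; rewrite normr_ge0 HA.
by rewrite sumr_const card_Sn mulr_natl.
Qed.

(** By the formula for the inverse through the adjugate, whose entries are 2 x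
    2 minors. *)
Lemma entries_le_inv K d A : 0 <= K -> 0 < d -> entries_le K A -> d <= `|\det A| ->
  entries_le (2 * K ^+ 2 / d) (invmx A).
Proof.
move=> K0 d0 HA dA i j.
have uA : A \in unitmx by rewrite unitmxE unitfE -normr_gt0 (lt_le_trans d0).
rewrite /invmx uA !mxE normrM normfV mulrC.
apply: ler_pM => //; last first.
  by rewrite lef_pV2 ?posrE// (lt_le_trans d0).
rewrite /cofactor normrM normrX normrN1 expr1n mul1r.
have := @entries_le_det K 2 (row' j (col' i A)).
by rewrite [2`!]/=; apply => a b; rewrite !mxE; exact: HA.
Qed.

Lemma mulmx_inv A B : A *m B = 1%:M -> A \in unitmx /\ invmx A = B.
Proof.
move=> AB; have [uA _] := mulmx1_unit AB; split => //.
by rewrite -[RHS]mul1mx -(mulVmx uA) -mulmxA AB mulmx1.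
Qed.

Lemma invmxM A B : A \in unitmx -> B \in unitmx ->
  A *m B \in unitmx /\ invmx (A *m B) = invmx B *m invmx A.
Proof.
by move=> uA uB; apply: mulmx_inv; rewrite mulmxA mulmxK// mulmxV.
Qed.

Variables l1 l2 : R.
Local Notation SM := (shearlet_mx l1 l2).
Local Notation H := (shearlet_group l1 l2).

Lemma shearlet_mul a b c a' b' c' : 0 < a -> 0 < a' ->
  SM a b c *m SM a' b' c' = SM (a * a') (b' + b * a' `^ l1 / a') (c' + c * a' `^ l2 / a').
Proof.
move=> a0 a'0; have a'n : a' != 0 by rewrite gt_eqF.
apply/matrixP => i j; rewrite !mxE !big_ord_recr big_ord0 /= !mxE /= add0r.
rewrite !powRM ?ltW//.
by case: i => -[|[|[|//]]] ? /=; case: j => -[|[|[|//]]] ? /=; field.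
Qed.

Lemma shearlet_mx1 : SM 1 0 0 = 1%:M.
Proof.
apply/matrixP => i j; rewrite !mxE !powR1.
by case: i => -[|[|[|//]]] ? /=; case: j => -[|[|[|//]]] ? /=; rewrite ?mulr0.
Qed.

Lemma shearlet_inv a b c : 0 < a ->
  SM a b c *m SM a^-1 (- (b * a^-1 `^ l1 * a)) (- (c * a^-1 `^ l2 * a)) = 1%:M.
Proof.
move=> a0; have an : a != 0 by rewrite gt_eqF.
rewrite shearlet_mul ?invr_gt0// mulfV// invrK !addNr.
exact: shearlet_mx1.
Qed.

Lemma group_mul A B : H A -> H B -> H (A *m B).
Proof.
move=> [e [a [b [c [he a0 ->]]]]] [e' [a' [b' [c' [he' a'0 ->]]]]].
rewrite -scalemxAl -scalemxAr scalerA shearlet_mul//.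
do 4 eexists; split; last by [].
  by case: he => ->; case: he' => ->; [left|right|right|left]; rewrite ?mulr1 ?mul1r ?mulrN1 ?opprK.
exact: mulr_gt0.
Qed.

Lemma group_inv A : H A -> A \in unitmx /\ H (invmx A).
Proof.
move=> [e [a [b [c [he a0 ->]]]]].
have e2 : e * e = 1 by case: he => ->; rewrite ?mulr1 ?mulrNN ?mulr1.
have E : (e *: SM a b c) *m (e *: SM a^-1 (- (b * a^-1 `^ l1 * a)) (- (c * a^-1 `^ l2 * a))) = 1%:M.
  by rewrite -scalemxAl -scalemxAr scalerA e2 scale1r shearlet_inv.
have [-> ->] := mulmx_inv E; split => //.
by do 4 eexists; split; [exact: he| |reflexivity]; rewrite invr_gt0.
Qed.

Lemma group1 : H 1%:M.
Proof.
by exists 1, 1, 0, 0; split; [left| |rewrite scale1r shearlet_mx1].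
Qed.

Lemma group_shear n : H (SM 1 n 0).
Proof. by exists 1, 1, n, 0; split; [left| |rewrite scale1r]. Qed.

Lemma group_det a b c : \det (SM a b c) = a * a `^ l1 * a `^ l2.
Proof.
rewrite (expand_det_col _ 0) !big_ord_recr big_ord0/= add0r !mxE /= !mul0r !addr0.
rewrite /cofactor/= expr0 mul1r -mulrA; congr (_ * _).
rewrite (expand_det_row _ 0) !big_ord_recr big_ord0/= add0r !mxE /= mul0r addr0.
by rewrite /cofactor/= expr0 mul1r det_mx11 !mxE.
Qed.

End Mx.

(** * Bounded pieces of the shearlet group *)

Section Cov.
Variable R : realType.

Lemma compact_image_le (V : topologicalType) (K : set V) (f : V -> R) :
  compact K -> (forall x, K x -> {for x, continuous f}) -> exists M, forall x, K x -> `|f x| <= M.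
Proof.
move=> cK cf.
have : compact (f @` K).
  apply: continuous_compact => //.
  by apply: continuous_in_subspaceT => x /set_mem Kx; exact: cf.
move=> /(@compact_bounded R R)[M [_ HM]].
exists (M + 1) => x Kx; apply: (HM (M + 1)); first by rewrite ltrDl.
by exists x.
Qed.

Lemma powR_le_ge (D a l : R) : 1 <= D -> D^-1 <= a <= D -> (D `^ `|l|)^-1 <= a `^ l <= D `^ `|l|.
Proof.
move=> D1 /andP[aD1 aD].
have D0 : 0 < D by rewrite (lt_le_trans _ D1).
have a0 : 0 < a by rewrite (lt_le_trans _ aD1)// invr_gt0.
have L : `|l * ln a| <= `|l| * ln D.
  rewrite normrM ler_wpM2l// ler_norml; apply/andP; split; last by rewrite ler_ln.
  by rewrite -lnV// ler_ln// posrE invr_gt0.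
move: L; rewrite ler_norml => /andP[L1 L2].
rewrite /powR !gt_eqF// -expRN !ler_expR.
by rewrite L2 L1.
Qed.

Variables l1 l2 : R.
Local Notation SM := (shearlet_mx l1 l2).
Local Notation H := (shearlet_group l1 l2).

Definition bibounded (C : R) (k : 'M[R]_3) := entries_le C k /\ entries_le C (invmx k).

(** Properness of the dual action: the first coordinate of g^T eta is e a
    eta_0, which confines a to a compact subset of ]0, +oo[, and the other two
    coordinates then bound a b and a c. *)
Lemma orbit_bibounded (xi : 'cV[R]_3) : dual_orbit xi -> exists2 C : R,
  1 <= C & forall g (eta : 'cV[R]_3),
  H g -> 1 <= eta 0 0 <= 2 -> `|eta 1 0| <= 1 -> `|eta 2%:R 0| <= 1 -> g^T *m eta = xi ->
    bibounded C g.
Proof.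
move=> xi0; rewrite /dual_orbit/= in xi0.
pose X := `|xi 0 0|; have X0 : 0 < X by rewrite normr_gt0.
pose D := 1 + X + 2 / X.
have X2 : 0 < 2 / X by rewrite divr_gt0.
have D1 : 1 <= D by rewrite /D -addrA lerDl addr_ge0// ltW.
have D0 : 0 < D by rewrite (lt_le_trans _ D1).
pose E1 := D `^ `|l1|; pose E2 := D `^ `|l2|.
have E10 : 0 < E1 by exact: powR_gt0.
have E20 : 0 < E2 by exact: powR_gt0.
pose K := D + E1 + E2 + `|xi 1 0| + `|xi 2%:R 0|.
have K1 : 1 <= K.
  by rewrite /K; have := normr_ge0 (xi 1 0); have := normr_ge0 (xi 2%:R 0); lra.
pose d := D^-1 * E1^-1 * E2^-1.
have d0 : 0 < d by rewrite !mulr_gt0 ?invr_gt0.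
exists (K + 2 * K ^+ 2 / d).
  by rewrite (le_trans K1)// lerDl mulr_ge0 ?invr_ge0 ?(ltW d0)// mulr_ge0// sqr_ge0.
move=> g eta [e [a [b [c [he a0 ->]]]]] /andP[t1 t2] u1 u2 E.
have ne : `|e| = 1 by case: he => ->; rewrite ?normrN1 ?normr1.
have eE j : xi j 0 = ((e *: SM a b c)^T *m eta) j 0 by rewrite E.
have x0 : xi 0 0 = e * (a * eta 0 0).
  by rewrite eE !mxE !big_ord_recr big_ord0 /= !mxE/= add0r !mulr0 !mul0r !addr0 mulrA;
   congr (_ * eta _ _); apply: val_inj.
have x1 : xi 1 0 = e * (a * b * eta 0 0 + a `^ l1 * eta 1 0).
  rewrite eE !mxE !big_ord_recr big_ord0 /= !mxE/= add0r !mulr0 !mul0r !addr0 mulrDr !mulrA.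
  by congr (_ * eta _ _ + _ * eta _ _); apply: val_inj.
have x2 : xi 2%:R 0 = e * (a * c * eta 0 0 + a `^ l2 * eta 2%:R 0).
  rewrite eE !mxE !big_ord_recr big_ord0 /= !mxE/= add0r !mulr0 !mul0r !addr0 mulrDr !mulrA.
  by congr (_ * eta _ _ + _ * eta _ _); apply: val_inj.
have XE : X = a * eta 0 0.
  by rewrite /X x0 normrM ne mul1r ger0_norm// mulr_ge0 ?(ltW a0)// (le_trans _ t1).
have aD : D^-1 <= a <= D.
  apply/andP; split; last first.
    have : a <= X by rewrite XE ler_peMr// ltW.
    by rewrite /D; lra.
  rewrite -[a]invrK lef_pV2 ?posrE ?invr_gt0//.
  have : a^-1 <= 2 / X.
    by rewrite ler_pdivlMr// ler_pdivrMl// XE ler_wpM2l// ltW.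
  by rewrite /D; lra.
have /andP[e1 e1'] := powR_le_ge l1 D1 aD; have /andP[e2 e2'] := powR_le_ge l2 D1 aD.
have /andP[ad ad'] := aD.
rewrite -/E1 in e1 e1'; rewrite -/E2 in e2 e2'.
have F (y z w P : R) : `|w| <= 1 -> 0 <= P -> `|P| <= P -> 1 <= eta 0 0 ->
    z = e * (y * eta 0 0 + P * w) -> `|y| <= `|z| + P.
  move=> w1 P0 _ _ ->; rewrite normrM ne mul1r.
  have : `|y| <= `|y * eta 0 0| by rewrite normrM ler_peMr// (le_trans t1)// ler_norm.
  move=> h; apply: (le_trans h).
  have := ler_normB (y * eta 0 0 + P * w) (P * w); rewrite addrK => h2.
  by apply: (le_trans h2); rewrite lerD2l normrM ger0_norm// ler_piMr.
have B1 : `|a * b| <= `|xi 1 0| + a `^ l1.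
  by apply: F x1 => //; rewrite ?powR_ge0// ger0_norm ?powR_ge0.
have B2 : `|a * c| <= `|xi 2%:R 0| + a `^ l2.
  by apply: F x2 => //; rewrite ?powR_ge0// ger0_norm ?powR_ge0.
have x10 := normr_ge0 (xi 1 0); have x20 := normr_ge0 (xi 2%:R 0).
have K0 : 0 <= K by rewrite (le_trans _ K1).
have Kg : entries_le K (e *: SM a b c).
  have [P1 P2 P3 P4 P5] : [/\ a <= K, a `^ l1 <= K, a `^ l2 <= K, `|a * b| <= K & `|a * c| <= K].
    move: e1' e2' x10 x20 B1 B2 ad' E10 E20 D0; rewrite /K; clear; move=> *; split; lra.
  move=> i j; rewrite !mxE normrM ne mul1r.
  by case: i => -[|[|[|//]]] ? /=; case: j => -[|[|[|//]]] ? /=;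
    rewrite ?normr0 ?(ger0_norm (powR_ge0 _ _)) ?(gtr0_norm a0).
have Dg : d <= `|\det (e *: SM a b c)|.
  rewrite detZ normrM normrX ne expr1n mul1r group_det !normrM (gtr0_norm a0) !ger0_norm
    ?powR_ge0//.
  by rewrite /d !ler_pM// ?mulr_ge0 ?invr_ge0 ?ltW.
split.
  by apply: entries_le_trans Kg; rewrite lerDl mulr_ge0 ?invr_ge0 ?(ltW d0)// mulr_ge0// sqr_ge0.
by apply: entries_le_trans (entries_le_inv K0 d0 Kg Dg); rewrite lerDr.
Qed.

(** The diagonal entries do not vanish on the group, so on a compact subset
    they are bounded away from 0, and so is the determinant of these triangular
    matrices. *)
Lemma compact_bibounded (K : set 'M[R]_3) : compact K -> K `<=` H ->
  exists2 C : R, 1 <= C & forall u, K u -> bibounded C u.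
Proof.
move=> cK KH.
have ent (i j : 'I_3) : exists M : R, forall u : 'M[R]_3, K u -> `|u i j| <= M.
  apply: compact_image_le => // u _; exact: coord_continuous.
have dg (u : 'M[R]_3) j : H u -> u j j != 0.
  move=> [e [a [b [c [he a0 ->]]]]]; rewrite !mxE mulf_neq0//.
    by case: he => ->; rewrite ?oppr_eq0 oner_eq0.
  by case: j => -[|[|[|//]]] ? /=; rewrite gt_eqF// powR_gt0.
have inv (j : 'I_3) : exists M : R, forall u : 'M[R]_3, K u -> `|(u j j)^-1| <= M.
  apply: compact_image_le => // u Ku.
  by apply: cvgV; [exact: nbhs_filter|exact/dg/KH|exact: coord_continuous].
pose M1 i j := projT1 (cid (ent i j)).
have M1P i j u : K u -> `|u i j| <= M1 i j by rewrite /M1; case: cid => /= M; apply.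
pose M2 j := projT1 (cid (inv j)).
have M2P j u : K u -> `|(u j j)^-1| <= M2 j by rewrite /M2; case: cid => /= M; apply.
pose C1 := 1 + \sum_i \sum_j `|M1 i j|.
have C1P u : K u -> entries_le C1 u.
  move=> Ku i j; rewrite (le_trans (M1P i j u Ku))// (le_trans (ler_norm _))// /C1.
  rewrite (bigD1 i)//= (bigD1 j)//=.
  have : 0 <= \sum_(i0 | i0 != j) `|M1 i i0| by exact: sumr_ge0.
  have : 0 <= \sum_(i0 | i0 != i) \sum_j0 `|M1 i0 j0| by apply: sumr_ge0 => i' _; exact: sumr_ge0.
  lra.
have C11 : 1 <= C1 by rewrite lerDl; apply: sumr_ge0 => i _; apply: sumr_ge0.
pose d := (1 + `|M2 0|)^-1 * (1 + `|M2 1|)^-1 * (1 + `|M2 2%:R|)^-1.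
have P j : 0 < 1 + `|M2 j| by rewrite ltr_pwDl.
have d0 : 0 < d by rewrite !mulr_gt0// invr_gt0.
have dP u : K u -> d <= `|\det u|.
  move=> Ku.
  have Q j : (1 + `|M2 j|)^-1 <= `|u j j|.
    have uj : u j j != 0 by exact/dg/KH.
    rewrite -[leRHS]invrK lef_pV2 ?posrE ?invr_gt0 ?normr_gt0// -normfV.
    by rewrite (le_trans (M2P j u Ku))// (le_trans (ler_norm _))// lerDr.
  have -> : \det u = u 0 0 * u 1 1 * u 2%:R 2%:R.
    have [e [a [b [c [he a0 ->]]]]] := KH _ Ku.
    rewrite detZ group_det !mxE/=; ring.
  by rewrite !normrM /d !ler_pM// ?mulr_ge0 ?invr_ge0 ?ltW.
exists (C1 + 2 * C1 ^+ 2 / d).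
  by rewrite (le_trans C11)// lerDl mulr_ge0 ?invr_ge0 ?(ltW d0)// mulr_ge0// sqr_ge0.
have C10 : 0 <= C1 by rewrite (le_trans _ C11).
move=> u Ku; split.
  by apply: entries_le_trans (C1P u Ku); rewrite lerDl mulr_ge0 ?invr_ge0 ?(ltW d0)// mulr_ge0//
    sqr_ge0.
by apply: entries_le_trans (entries_le_inv C10 d0 (C1P u Ku) (dP u Ku)); rewrite lerDr.
Qed.

End Cov.

(** * The elements of the covering that meet a sheared box *)

Section Covering.
Variables (R : realType) (l1 l2 : R) (Q : induced_covering l1 l2).
Local Notation SM := (shearlet_mx l1 l2).
Local Notation H := (shearlet_group l1 l2).
Local Notation I := (cov_index Q).
Local Notation h := (@cov_elt R l1 l2 Q).

Definition shear (n : R) : 'M[R]_3 := SM 1 n 0.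

Lemma cov_eltH (i : I) : H (h i).
Proof. by have [] := cov_well_spread Q. Qed.

Lemma unit_elt (i : I) : h i \in unitmx.
Proof. by have [] := group_inv (cov_eltH i). Qed.

Lemma unit_shear (n : R) : shear n \in unitmx.
Proof. by have [] := group_inv (group_shear l1 l2 n). Qed.

(** A neighbourhood of the support of the test density, kept at distance 1 from
    the complement of the orbit. *)
Definition region (eta : 'cV[R]_3) :=
  [/\ 1 <= eta 0 0 <= 2, `|eta 1 0| <= 1 & `|eta 2%:R 0| <= 1].

(** If phi_i does not vanish at S^T eta, then S^T eta = h_i^-T u^-T xi_0 for
    some u in the neighbourhood U, so that g = S h_i u satisfies g^T eta =
    xi_0. Properness bounds g, compactness bounds u, and S h_i = g u^-1. *)
Lemma active_bibounded : exists2 C : R, 1 <= C & forall (n : R) (i : I) eta,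
  region eta -> cov_phi i ((shear n)^T *m eta) != 0 -> bibounded C (shear n *m h i).
Proof.
have [C1 C11 HC1] := orbit_bibounded l1 l2 (cov_base_orbit Q).
have [_ [_ [K [cK KH UK]]] _ _] := cov_well_spread Q.
have [C2 C21 HC2] := compact_bibounded cK KH.
exists (3%:R * (C1 * C2)).
  have CC : 1 <= C1 * C2 by exact: mulr_ege1.
  by rewrite (le_trans CC)// ler_peMl ?ler1n// (le_trans _ CC).
move=> n i eta [e0 e1 e2] phi0.
have : [set dual_act (h i) xi | xi in cov_Q Q] ((shear n)^T *m eta).
  by apply: contrapT => N; move: phi0; rewrite (cov_phi_supp N) eqxx.
move=> [xi [u Uu <-]] E.
have uH : H u by exact/KH/UK.
have [uu uiH] := group_inv uH.
have [ui hiH] := group_inv (cov_eltH i).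
pose g := shear n *m h i *m u.
have gH : H g by apply: group_mul => //; apply: group_mul; [exact: group_shear|exact: cov_eltH].
have [ug giH] := group_inv gH.
have gE : g^T *m eta = cov_base Q.
  rewrite /g !trmx_mul -!mulmxA -E /dual_act.
  rewrite (mulmxA (h i)^T) -trmx_mul mulVmx// trmx1 mul1mx.
  by rewrite mulmxA -trmx_mul mulVmx// trmx1 mul1mx.
have [B1 B2] := HC1 g eta gH e0 e1 e2 gE.
have [D1 D2] := HC2 u (UK _ Uu).
have kE : shear n *m h i = g *m invmx u by rewrite /g mulmxK.
have uui : invmx u \in unitmx by rewrite unitmx_inv.
have kI : invmx (shear n *m h i) = u *m invmx g.
  by rewrite kE; have [_ ->] := invmxM ug uui; rewrite invmxK.
split; first by rewrite kE; apply: entries_le_mul.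
by rewrite kI (mulrC C1); apply: entries_le_mul.
Qed.

Lemma nbhs1_mx (V : set 'M[R]_3) : id_nbhs H V -> exists2 d : R, 0 < d &
  forall M : 'M[R]_3, H M -> (forall i j, `|(M - 1%:M) i j| < d) -> V M.
Proof.
move=> [_ +]; rewrite /within/= => /nbhs_ballP[d /= d0 B].
exists d => // M HM Md; apply: B => //; split => // i j.
by rewrite /ball/= distrC; have := Md i j; rewrite !mxE.
Qed.

(** If S h_i and S h_j are close then h_j^-1 h_i = (S h_j)^-1 (S h_i) is close
    to the identity, which contradicts the disjointness of h_i V and h_j V.
    Rounding the entries of S h_i to a fixed mesh is therefore injective on the
    indices, and the number of possible roundings does not depend on the shear.
    *)
Lemma bibounded_count (C : R) : 1 <= C -> exists N : nat, forall (n : R) (s : seq I), uniq s ->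
  (forall i, i \in s -> bibounded C (shear n *m h i)) -> (size s <= N)%N.
Proof.
move=> C1; have C0 : 0 < C by rewrite (lt_le_trans _ C1).
have [_ _ _ [V [nV disj]]] := cov_well_spread Q.
have [d d0 Vd] := nbhs1_mx nV.
(* An entry of (S h_j)^-1 (S h_i - S h_j) is a sum of three products with a
   factor bounded by C, so this mesh keeps it below d. *)
pose e := d / (3%:R * C).
have e0 : 0 < e by rewrite divr_gt0// mulr_gt0.
pose m := (Num.truncn (C / e)).+2.
exists #|{ffun 'I_3 * 'I_3 -> 'I_(m + m)}| => n s us Hs.
pose k i := shear n *m h i.
pose code i : {ffun 'I_3 * 'I_3 -> 'I_(m + m).-1.+1} :=
  [ffun ab => inord (Num.truncn (k i ab.1 ab.2 / e + m%:R))].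
have mC : C / e <= m%:R - 1.
  have := truncnS_gt (C / e); rewrite /m -[(_.+2)%:R]natr1 addrK => /ltW; exact.
have inj : {in s &, injective code}.
  move=> i j si sj ij; apply: contrapT => nij.
  have [Hi1 Hi2] := Hs _ si; have [Hj1 Hj2] := Hs _ sj.
  have close a b : `|k i a b - k j a b| < e.
    have := congr1 (fun f : {ffun _ -> _} => nat_of_ord (f (a, b))) ij.
    rewrite !ffunE/=.
    have pos (l : I) : l \in s -> 0 <= k l a b / e + m%:R < (m + m)%:R.
      move=> sl; have [/(_ a b) B _] := Hs _ sl.
      have : `|k l a b / e| <= m%:R - 1.
        by rewrite normrM normfV (gtr0_norm e0) (le_trans _ mC)// ler_wpM2r// invr_ge0 ltW.
      rewrite ler_norml natrD; move: (k l a b / e) => z; lra.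
    have bd (l : I) : l \in s -> (Num.truncn (k l a b / e + m%:R)%R < (m + m).-1.+1)%N.
      move=> sl; have /andP[p1 p2] := pos _ sl.
      rewrite prednK ?addn_gt0// -(ltr_nat R) (le_lt_trans _ p2)// truncn_le//.
    rewrite !inordK ?bd// => E.
    have /andP[p1 _] := pos _ si; have /andP[q1 _] := pos _ sj.
    have /andP[a1 a2] := truncn_itv p1; have /andP[b1 b2] := truncn_itv q1.
    rewrite E in a1 a2.
    have : `|k i a b / e - k j a b / e| < 1.
      by rewrite ltr_norml; rewrite -natr1 in a2 b2; move: a1 a2 b1 b2;
        move: (_ / e) (k j a b / e) (_%:R) => x y z; lra.
    by rewrite -mulrBl normrM normfV (gtr0_norm e0) ltr_pdivrMr// mul1r.
  have ui := unit_elt i; have uj := unit_elt j.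
  pose v := invmx (h j) *m h i.
  have vH : H v by apply: group_mul; [have [] := group_inv (cov_eltH j)|exact: cov_eltH].
  have vE : v - 1%:M = invmx (k j) *m (k i - k j).
    have [uk kI] := invmxM (unit_shear n) uj.
    rewrite mulmxBr mulVmx// /k kI -!mulmxA (mulmxA (invmx (shear n))) mulVmx ?unit_shear// mul1mx.
    by [].
  have Vv : V v.
    apply: Vd => // a b; rewrite vE mxE.
    apply: (@le_lt_trans _ _ (\sum_c `|invmx (k j) a c * (k i - k j) c b|)).
      exact: ler_norm_sum.
    apply: (@lt_le_trans _ _ (\sum_(c < 3) C * e)); last first.
      by rewrite sumr_const card_ord -mulr_natl /e mulrA mulrCA divff ?mulr1// mulf_neq0// gt_eqF.
    apply: ltr_sum.
      by apply/hasP; exists 0; rewrite ?mem_index_enum.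
    move=> c _; rewrite normrM.
    have E : (k i - k j) c b = k i c b - k j c b.
      by rewrite [LHS]mxE; congr (_ + _); rewrite mxE.
    rewrite E; apply: (@le_lt_trans _ _ (C * `|k i c b - k j c b|)); first by rewrite ler_wpM2r.
    by rewrite ltr_pM2l.
  have V1 : V 1%:M.
    by apply: Vd; [exact: group1|move=> a b; rewrite subrr mxE normr0].
  have : (lcoset_mx (h i) V `&` lcoset_mx (h j) V) (h i).
    split; first by exists 1%:M => //; rewrite mulmx1.
    by exists v => //; rewrite /v mulmxA mulmxV// mul1mx.
  by rewrite disj.
rewrite -(size_map code) -(card_uniqP (_ : uniq (map code s))); last by rewrite map_inj_in_uniq.
have -> : #|{ffun 'I_3 * 'I_3 -> 'I_(m + m)}| = #|{ffun 'I_3 * 'I_3 -> 'I_(m + m).-1.+1}|.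
  by rewrite prednK// addn_gt0.
exact: max_card.
Qed.

End Covering.

(** * Growth of the weight along the shears *)

Section Weight.
Variables (R : realType) (nrm : 'M[R]_3 -> R).
Hypothesis Hn : matrix_norm nrm.

Lemma matrix_norm0 : nrm 0 = 0.
Proof. by have [_ Z _] := Hn; rewrite -(scale0r (0 : 'M[R]_3)) Z normr0 mul0r. Qed.

Lemma matrix_norm_ge0 A : 0 <= nrm A.
Proof.
have [_ Z T] := Hn; have := T A (- A); rewrite subrr matrix_norm0.
by rewrite -scaleN1r Z normrN1 mul1r; lra.
Qed.

Lemma matrix_norm_le : exists2 D : R, 0 <= D & forall K A, entries_le K A -> nrm A <= D * K.
Proof.
have [_ Z T] := Hn.
exists (\sum_(i < 3) \sum_(j < 3) nrm (delta_mx i j)).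
  by apply: sumr_ge0 => i _; apply: sumr_ge0 => j _; exact: matrix_norm_ge0.
have nS (J : Type) (r : seq J) (F : J -> 'M[R]_3) : nrm (\sum_(j <- r) F j) <= \sum_(j <- r) nrm
  (F j).
  elim: r => [|j r IH]; first by rewrite !big_nil matrix_norm0.
  by rewrite !big_cons (le_trans (T _ _))// lerD2l.
move=> K A HA; rewrite [A in nrm A]matrix_sum_delta (le_trans (nS _ _ _))// mulr_suml.
apply: ler_sum => i _; rewrite (le_trans (nS _ _ _))// mulr_suml.
apply: ler_sum => j _; rewrite Z mulrC ler_wpM2l//; exact: matrix_norm_ge0.
Qed.

Variables (l1 l2 : R) (Q : induced_covering l1 l2).

Lemma det_shear n : \det (shear l1 l2 n) = 1.
Proof. by rewrite group_det !powR1 !mulr1. Qed.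

Lemma entries_le_shear n : 0 <= n -> entries_le (1 + n) (shear l1 l2 n).
Proof.
move=> n0 i j; rewrite !mxE.
by case: i => -[|[|[|//]]] ? /=; case: j => -[|[|[|//]]] ? /=;
  rewrite ?powR1 ?mul1r ?mulr0 ?normr0 ?normr1 ?(ger0_norm n0) ?lerDl ?lerDr ?addr_ge0.
Qed.

(** A shear is unipotent and fixes e_1, so h and k = S h have the same
    determinant and the same upper left entry, both bounded in terms of k. Only
    the norm of h^-1 = k^-1 S sees the shear, and S has entries of size at most
    1 + n. *)
Lemma weight_le (alpha beta gamma C : R) : 0 <= beta -> 1 <= C ->
  exists2 D : R, 0 <= D & forall (n : R) (i : cov_index Q), 0 <= n ->
    bibounded C (shear l1 l2 n *m cov_elt i) ->
    `|\det (cov_elt i)| `^ gamma * shearlet_weight nrm alpha beta (cov_elt i)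
      <= D * (1 + n) `^ beta.
Proof.
move=> b0 C1; have C0 : 0 < C by rewrite (lt_le_trans _ C1).
have [D0 D00 HD] := matrix_norm_le.
pose E := 6%:R * C ^+ 3.
have E1 : 1 <= E by rewrite mulr_ege1 ?ler1n// exprn_ege1.
exists (E `^ `|gamma| * (C `^ `|alpha| * (D0 * (3%:R * C)) `^ beta)).
  by rewrite !mulr_ge0// powR_ge0.
move=> n i n0 [k1 k2].
set h := cov_elt i in k1 k2 *; set k := shear l1 l2 n *m h in k1 k2.
have uh : h \in unitmx by exact: unit_elt.
have us := unit_shear l1 l2 n.
have [uk kI] := invmxM us uh.
have hI : invmx h = invmx k *m shear l1 l2 n by rewrite kI mulmxKV.
have dE : \det h = \det k by rewrite det_mulmx det_shear mul1r.
have dk : E^-1 <= `|\det k| <= E.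
  apply/andP; split; last by have := entries_le_det k1.
  have := entries_le_det k2; rewrite -[_`!]/6%N -/E det_inv normrV ?unitfE; last first.
    by rewrite -unitfE -unitmxE.
  move=> h1; rewrite -[leRHS]invrK lef_pV2 ?posrE//; first exact: lt_le_trans E1.
  by rewrite invr_gt0 normr_gt0 -unitfE -unitmxE.
have /andP[_ P1] := powR_le_ge gamma E1 dk.
have [e [a [b [c [he a0 hE]]]]] := cov_eltH i; rewrite -/h in hE.
have h10 : h 1 0 = 0 by rewrite hE !mxE/= mulr0.
have h20 : h 2%:R 0 = 0 by rewrite hE !mxE/= mulr0.
have kc : [/\ k 0 0 = h 0 0, k 1 0 = 0 & k 2%:R 0 = 0].
  by split; rewrite /k mxE sum_ord3 h10 h20 !mxE/= ?powR1 ?mulr0 ?mul0r ?addr0 ?add0r ?mul1r.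
have [k00 k10 k20] := kc.
have kk : invmx k 0 0 * k 0 0 = 1.
  have := congr1 (fun M : 'M[R]_3 => M 0 0) (mulVmx uk).
  by rewrite [LHS]mxE [RHS]mxE sum_ord3 k10 k20 !mulr0 !addr0 => ->.
have h00 : C^-1 <= `|h 0 0| <= C.
  rewrite -k00; apply/andP; split; last exact: k1.
  have k0 : k 0 0 != 0.
    by apply/eqP => k0; move: kk; rewrite k0 mulr0 => /esym/eqP; rewrite oner_eq0.
  rewrite -[leRHS]invrK lef_pV2 ?posrE ?invr_gt0 ?normr_gt0// -normfV.
  have -> : (k 0 0)^-1 = invmx k 0 0 by rewrite -[LHS]mul1r -kk mulfK.
  exact: k2.
have /andP[_ P2] := powR_le_ge alpha C1 h00.
have B : nrm (invmx h)^T <= D0 * (3%:R * C) * (1 + n).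
  rewrite -!mulrA; apply: HD => i' j'; rewrite mxE hI.
  exact: (entries_le_mul k2 (entries_le_shear n0)).
rewrite -mulrA dE ler_pM ?powR_ge0 ?mulr_ge0 ?powR_ge0//.
rewrite /shearlet_weight -mulrA ler_pM ?powR_ge0//.
rewrite -powRM ?mulr_ge0 ?addr_ge0// ?(ltW C0)//.
rewrite ge0_ler_powR// nnegrE ?matrix_norm_ge0//.
by rewrite !mulr_ge0 ?addr_ge0// ltW.
Qed.

End Weight.

(** * Quasi-norms of functions with product decay *)

Section Lp.
Variable R : realType.
Local Notation X3 := (measurableTypeR R * measurableTypeR R * measurableTypeR R)%type.
Local Notation mu1 := (@lebesgue_measure R).
Local Notation mu3 := (@lebesgue3 R).

(** Monotonicity read off the supremum over simple functions, for integrands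
    that are known through pointwise bounds only. *)
Lemma ge0_le_integralT d (T : measurableType d) (mu : {measure set T -> \bar R}) (f g : T ->
  \bar R) :
  (forall x, 0 <= f x)%E -> (forall x, f x <= g x)%E ->
  (\int[mu]_x f x <= \int[mu]_x g x)%E.
Proof.
move=> f0 fg; rewrite !ge0_integralTE//; last by move=> x; apply: le_trans (fg x).
apply: ereal_sup_le => /= _ [h hf <-].
by exists h => // x; apply: le_trans (fg x).
Qed.

Lemma integral_oneDsqrV_lty : (\int[mu1]_x (oneDsqr x)^-1%:E < +oo)%E.
Proof.
have m0 : measurable_fun [set: R] (fun x : R => (oneDsqr x)^-1).
  exact: (continuous_measurable_fun (@continuous_oneDsqrV R)).
have mE : measurable_fun [set: R] (fun x : R => (oneDsqr x)^-1%:E) by exact/measurable_EFinP.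
have g0 (x : R) : (0 <= (oneDsqr x)^-1%:E)%E by rewrite lee_fin invr_ge0 (le_trans _
  (oneDsqr_ge1 _)).
have P := @integral0y_oneDsqr R.
have N : (\int[mu1]_(x in `]-oo, 0%R]) (oneDsqr x)^-1%:E = (pi / 2)%:E)%E.
  rewrite -P (@ge0_integration_by_substitution0 R (fun x => (oneDsqr x)^-1%:E) mE g0).
  by apply: eq_integral => x _; rewrite /oneDsqr sqrrN.
have E : [set: R] = `]-oo, 0%R[ `|` `[0%R, +oo[.
  by apply/seteqP; split => x // _; case: (ltP x 0) => x0; [left|right]; rewrite /= in_itv/= ?andbT.
rewrite E ge0_integral_setU//=; last 2 first.
- exact: measurable_funTS.
- apply/disj_setPS => x [] /=; rewrite !in_itv/= andbT => h1 h2.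
  by move: (lt_le_trans h1 h2); rewrite ltxx.
rewrite P; apply: lte_add_pinfty; last by rewrite ltry.
apply: (@le_lt_trans _ _ (pi / 2)%:E); last by rewrite ltry.
rewrite -N; apply: ge0_subset_integral => //.
- exact: measurable_funTS.
- by move=> x /=; rewrite !in_itv/= => /ltW.
Qed.

(** One power of (1 + t^2)^-1 is integrable, which turns the bound N p >= 1
    into integrability of the p-th power, also for p < 1. *)
Definition decay (N : nat) (t : R) : R := (oneDsqr t)^-1 ^+ N.

Lemma decay_ge0 N t : 0 <= decay N t.
Proof. by rewrite exprn_ge0// invr_ge0 (le_trans _ (oneDsqr_ge1 _)). Qed.

Lemma measurable_decay N : measurable_fun setT (decay N).
Proof.
by apply: measurable_funX; exact: (continuous_measurable_fun (@continuous_oneDsqrV R)).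
Qed.

Lemma powR_decay_le N p t : 0 < p -> 1 <= N%:R * p -> decay N t `^ p <= (oneDsqr t)^-1.
Proof.
move=> p0 Np; have o1 := oneDsqr_ge1 t.
have o0 : 0 < oneDsqr t by rewrite (lt_le_trans _ o1).
rewrite /decay; set z := (oneDsqr t)^-1.
have z0 : 0 < z by rewrite invr_gt0.
have z1 : z <= 1 by rewrite invf_le1.
rewrite -powR_mulrn ?(ltW z0)// -powRrM -[X in _ <= X]powRr1 ?(ltW z0)//.
by apply: ger_powR => //; rewrite z0.
Qed.

Lemma measurable_shear_prod (n : R) (f1 f2 f3 : R -> R) :
  measurable_fun setT (f1 : measurableTypeR R -> R) ->
  measurable_fun setT (f2 : measurableTypeR R -> R) ->
  measurable_fun setT (f3 : measurableTypeR R -> R) ->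
  measurable_fun setT (fun t : X3 => f1 (t.1.1 + n * t.1.2) * f2 t.1.2 * f3 t.2).
Proof.
move=> mf1 mf2 mf3.
have m11 : measurable_fun [set: X3] (fun t : X3 => t.1.1 : measurableTypeR R).
  exact: (measurableT_comp measurable_fst measurable_fst).
have m12 : measurable_fun [set: X3] (fun t : X3 => t.1.2 : measurableTypeR R).
  exact: (measurableT_comp measurable_snd measurable_fst).
have mg : measurable_fun setT (fun t : X3 => t.1.1 + n * t.1.2 : measurableTypeR R).
  by apply: measurable_funD => //; apply: measurable_funM.
apply: measurable_funM; last exact: (measurableT_comp mf3 measurable_snd).
by apply: measurable_funM; [exact: (measurableT_comp mf1 mg)|exact: (measurableT_comp mf2 m12)].
Qed.

(** The p-th power of the bound is a sheared product of integrable functions of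
    one variable, and its integral does not depend on the shear. *)
Lemma LqN_decay (N : nat) (p E : R) : 0 < p -> 1 <= N%:R * p -> 0 <= E ->
  exists B : R, forall n (f : 'cV[R]_3 -> R[i]),
  (forall t : X3, Normc.normc (f (vec3 t)) <= E * (decay N (t.1.1 + n * t.1.2) * decay N t.1.2 *
    decay N t.2)) ->
  (LqN p f <= B%:E)%E.
Proof.
move=> p0 Np E0.
pose r (x : R) := decay N x `^ p.
have mr : measurable_fun setT (r : measurableTypeR R -> R).
  exact: (measurableT_comp (measurable_powR p) (measurable_decay N)).
have r0 x : 0 <= r x by exact: powR_ge0.
have ir : (\int[mu1]_x (r x)%:E < +oo)%E.
  apply: le_lt_trans integral_oneDsqrV_lty.
  by apply: ge0_le_integralT => x; rewrite lee_fin ?powR_ge0// powR_decay_le.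
have ir0 : (0 <= \int[mu1]_x (r x)%:E)%E by apply: integral_ge0 => x _; rewrite lee_fin.
have irE : (\int[mu1]_x (r x)%:E = (fine (\int[mu1]_x (r x)%:E))%:E)%E by rewrite fineK//
  ge0_fin_numE.
pose J := fine (\int[mu1]_x (r x)%:E).
exists ((E `^ p * (J * J * J)) `^ p^-1) => n f fb.
rewrite /LqN unlock.
rewrite -poweR_EFin; apply: gt0_ler_poweR.
- by rewrite invr_ge0 ltW.
- by rewrite in_itv/= leey andbT integral_ge0// => x _; exact: poweR_ge0.
- by rewrite in_itv/= leey andbT lee_fin !mulr_ge0 ?powR_ge0// fine_ge0.
have -> : ((E `^ p * (J * J * J))%:E =
  \int[mu3]_t ((E `^ p)%:E * (r (t.1.1 + n * t.1.2) * r t.1.2 * r t.2)%:E))%E.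
  rewrite ge0_integralZl//=.
  - by rewrite ge0_integral_shear// !EFinM -irE.
  - by apply/measurable_EFinP; exact: (measurable_shear_prod n mr mr mr).
  - by move=> t _; rewrite lee_fin !mulr_ge0.
  - by rewrite lee_fin powR_ge0.
apply: ge0_le_integralT => t; first exact: poweR_ge0.
have nn : 0 <= Normc.normc (f (vec3 t)).
  by case: (f _) => a b; exact: sqrtr_ge0.
rewrite /= ger0_norm// ?poweR_EFin -EFinM lee_fin /r.
rewrite -!powRM ?mulr_ge0 ?decay_ge0//.
rewrite ge0_ler_powR ?nnegrE ?(ltW p0)//.
by rewrite !mulr_ge0 ?decay_ge0.
Qed.

End Lp.

(** * The test density *)

Section Dens.
Variable R : realType.
Local Notation X3 := (measurableTypeR R * measurableTypeR R * measurableTypeR R)%type.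

(** The first coordinate is confined to ]1, 2[: the sheared second partial
    derivative multiplies by n t_1 + t_2, which is then at least n. *)
Definition density (m : nat) (t : X3) : R :=
  bump m.+1 m.+1 (t.1.1 - 1) * bump m.+1 m.+1 t.1.2 * bump m.+1 m.+1 t.2.

Lemma measurable_pospow m : measurable_fun setT (pospow m : R -> R).
Proof. by apply: measurable_funX; apply: measurable_maxr. Qed.

Lemma measurable_bump m l : measurable_fun setT (bump m l : measurableTypeR R -> R).
Proof.
apply: measurable_funM; first exact: measurable_pospow.
apply: (measurableT_comp (measurable_pospow l)).
exact: measurable_funB.
Qed.

Lemma measurable_density m : measurable_fun setT (density m).
Proof.
have m1 : measurable_fun setT (fun x : measurableTypeR R => bump m.+1 m.+1 (x - 1) : R).
  have mg : measurable_fun setT (fun x : measurableTypeR R => x - 1 : measurableTypeR R).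
    exact: measurable_funB.
  exact: (measurableT_comp (@measurable_bump m.+1 m.+1) mg).
have := @measurable_shear_prod R 0 _ _ _ m1 (@measurable_bump m.+1 m.+1) (@measurable_bump m.+1
  m.+1).
by under eq_fun do rewrite mul0r addr0.
Qed.

Lemma density_ge0 m t : 0 <= density m t.
Proof. by apply: mulr_ge0; [apply: mulr_ge0|]; exact: bump_ge0. Qed.

Lemma density_le1 m t : density m t <= 1.
Proof.
have b0 x : 0 <= bump m.+1 m.+1 x :> R by exact: bump_ge0.
have b1 x : bump m.+1 m.+1 x <= 1 :> R by exact: bump_le1.
by apply: mulr_ile1 => //; [exact: mulr_ge0|exact: mulr_ile1].
Qed.

Lemma density_supp m t : density m t != 0 -> [/\ 1 < t.1.1 < 2, 0 < t.1.2 < 1 & 0 < t.2 < 1].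
Proof.
move=> d0.
have [h1|h1] := boolP (0 < t.1.1 - 1 < 1); last by move: d0;
  rewrite /density bump_supp// !mul0r eqxx.
have [h2|h2] := boolP (0 < t.1.2 < 1); last by move: d0;
  rewrite /density (bump_supp m m h2) mulr0 mul0r eqxx.
have [h3|h3] := boolP (0 < t.2 < 1); last by move: d0;
  rewrite /density (bump_supp m m h3) mulr0 eqxx.
by split => //; lra.
Qed.

Lemma density_region m t : density m t != 0 -> region (vec3 t).
Proof.
move=> /density_supp[/andP[a1 a2] /andP[b1 b2] /andP[c1 c2]].
by split; rewrite !mxE/=; [lra|rewrite ger0_norm; lra|rewrite ger0_norm; lra].
Qed.

Lemma boxed_density m : boxed 2 1 (density m).
Proof.
split; first exact: measurable_density.
move=> t; rewrite mul1r ger0_norm ?density_ge0// indicE.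
have [tb|] := boolP (t \in box 2); first exact: density_le1.
have [->//|d0] := eqVneq (density m t) 0; rewrite notin_setE => H; exfalso; apply: H.
apply/boxE => j; have [/andP[a1 a2] /andP[b1 b2] /andP[c1 c2]] := density_supp d0.
by rewrite mxE; case: j => -[|[|[|//]]] ? /=; rewrite ger0_norm; lra.
Qed.

Lemma derivs_le_density m (C : R) (v : 'cV[R]_3) (t : X3) : 1 <= C -> (forall j, `|v j 0| <= C) ->
  derivs_le m (2 ^+ m * (2 ^+ m * ((C ^+ m * (2 * m.+1%:R) ^+ m) * (C ^+ m * (2 * m.+1%:R) ^+
    m)) * (C ^+ m * (2 * m.+1%:R) ^+ m)))
    (fun r => density m (shiftv (r *: v) t)).
Proof.
move=> C1 vC.
have B : derivs_le m ((2 * m.+1%:R : R) ^+ m) (bump m.+1 m.+1).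
  by apply: (@derivs_le_bump R m.+1 m m.+1 m.+1); rewrite leqnn.
have E : (fun r => density m (shiftv (r *: v) t)) =
  (fun r => bump m.+1 m.+1 (t.1.1 - 1 + r * v 0 0) * bump m.+1 m.+1 (t.1.2 + r * v 1 0)
     * bump m.+1 m.+1 (t.2 + r * v 2%:R 0)).
  by apply/funext => r; rewrite /density /shiftv /trans3 /unvec/= !mxE addrAC.
rewrite E; apply: derivs_leM; first apply: derivs_leM.
- by apply: derivs_le_affine => //; exact: B.
- by apply: derivs_le_affine => //; exact: B.
- by apply: derivs_le_affine => //; exact: B.
Qed.

Lemma continuous_mulmx (A : 'M[R]_3) : continuous (fun x : 'cV[R]_3 => A *m x).
Proof.
move=> x U /nbhs_ballP[e /= e0 HU].
pose K := 1 + \sum_i \sum_j `|A i j|.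
have K0 : 0 < K by rewrite ltr_pwDl// sumr_ge0// => i _; rewrite sumr_ge0.
apply/nbhs_ballP; exists (e / K) => /=; first by rewrite divr_gt0.
move=> z [_ xz]; apply: HU; split => // i j.
have E : (A *m x) i j - (A *m z) i j = (A *m (x - z)) i j by rewrite mulmxBr !mxE.
rewrite /ball/= E mxE (le_lt_trans (ler_norm_sum _ _ _))//.
apply: (@le_lt_trans _ _ (\sum_a `|A i a| * (e / K))).
  apply: ler_sum => a _; rewrite normrM ler_wpM2l// ltW//.
  by have := xz a j; rewrite /ball/= !mxE.
rewrite -mulr_suml mulrCA gtr_pMr// ltr_pdivrMr// mul1r /K [X in _ < 1 + X](bigD1 i)//=.
have : 0 <= \sum_(i0 < 3 | i0 != i) \sum_j0 `|A i0 j0| by apply: sumr_ge0 => i' _; exact: sumr_ge0.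
lra.
Qed.

(** The coordinates of y are controlled by the largest coordinate of z, so
    decay of order 6 N = 3 (2 N) in that one coordinate can be shared among
    three factors of order 2 N. *)
Lemma decay_combine (N : nat) (C A B X : R) (z y : 'cV[R]_3) : 1 <= C -> 0 <= A -> 0 <= B ->
  X <= A -> (forall j, 1 <= `|z j 0| -> X <= B / `|z j 0| ^+ (6 * N)) ->
  (forall Z, (forall j, `|z j 0| <= Z) -> forall l, `|y l 0| <= 3 * C * Z) ->
  X <= (A + B) * (1 + 9 * C ^+ 2) ^+ (3 * N) * (decay N (y 0 0) * decay N (y 1 0) * decay N (y
    2%:R 0)).
Proof.
move=> C1 A0 B0 XA XB yz.
have [j jmax] : exists j : 'I_3, forall l, `|z l 0| <= `|z j 0|.
  exists [arg max_(j > ord0) `|z j 0|]%O => l; by case: arg_maxP => // j _; apply.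
pose Z := `|z j 0|; have Z0 : 0 <= Z by exact: normr_ge0.
have yZ := yz _ jmax; rewrite -/Z in yZ.
pose K := 1 + 9 * C ^+ 2.
have K0 : 0 < K by rewrite /K ltr_pwDl// mulr_ge0// sqr_ge0.
have Dl (W : R) : 0 < W -> (forall l, oneDsqr (y l 0) <= K * W) ->
    ((K * W) ^+ (3 * N))^-1 <= decay N (y 0 0) * decay N (y 1 0) * decay N (y 2%:R 0).
  move=> W0 oW.
  have o0 l : 0 < oneDsqr (y l 0) by rewrite (lt_le_trans _ (oneDsqr_ge1 _)).
  have KW : 0 < K * W by rewrite mulr_gt0.
  have q l : ((K * W) ^+ N)^-1 <= decay N (y l 0).
    rewrite /decay -exprVn lerXn2r ?nnegrE ?invr_ge0 ?(ltW KW) ?(ltW (o0 l))//.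
    by rewrite lef_pV2 ?posrE.
  have q0 : 0 <= ((K * W) ^+ N)^-1 by rewrite invr_ge0 exprn_ge0// ltW.
  rewrite (_ : (3 * N = N + N + N)%N); last by rewrite mulSn mulSn mul1n addnA.
  by rewrite !exprD !invfM; apply: ler_pM => //; [exact: mulr_ge0|exact: ler_pM].
have osq l (W : R) : Z ^+ 2 <= W -> 1 <= W -> oneDsqr (y l 0) <= K * W.
  move=> ZW W1; rewrite /oneDsqr /K.
  have : (y l 0) ^+ 2 <= 9 * C ^+ 2 * Z ^+ 2.
    rewrite -real_normK ?num_real// (_ : 9 * C ^+ 2 * Z ^+ 2 = (3 * C * Z) ^+ 2); last by ring.
    by rewrite lerXn2r ?nnegrE ?mulr_ge0// (le_trans _ C1).
  move=> h; rewrite mulrDl mul1r; apply: lerD => //; apply: (le_trans h).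
  by apply: ler_wpM2l => //; rewrite mulr_ge0// sqr_ge0.
have KN : 0 < K ^+ (3 * N) by rewrite exprn_gt0.
have [Z1|Z1] := leP 1 Z.
- have W0 : 0 < Z ^+ 2 by rewrite exprn_gt0// (lt_le_trans _ Z1).
  have := Dl _ W0 (fun l => osq l _ (lexx _) (exprn_ege1 _ Z1)).
  rewrite exprMn invfM => h.
  apply: (le_trans (XB j Z1)).
  rewrite -mulrA; apply: (@le_trans _ _ (B * (K ^+ (3 * N) * ((K ^+ (3 * N))^-1 * (Z ^+ 2 ^+ (3
    * N))^-1)))).
    by rewrite mulVKf ?gt_eqF// -exprM mulnA.
  apply: ler_pM => //.
  - by rewrite mulr_ge0 ?(ltW KN)// mulr_ge0// invr_ge0 exprn_ge0// ltW.
  - by rewrite lerDr.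
  - by apply: ler_wpM2l => //; exact: ltW.
- have := Dl 1 ltr01 (fun l => osq l 1 (exprn_ile1 _ Z0 (ltW Z1)) (lexx _)).
  rewrite mulr1 => h.
  apply: (le_trans XA); rewrite -mulrA.
  apply: (@le_trans _ _ (A * (K ^+ (3 * N) * (K ^+ (3 * N))^-1))).
    by rewrite mulfV ?gt_eqF// mulr1.
  apply: ler_pM => //.
  - by rewrite mulfV ?gt_eqF.
  - by rewrite lerDl.
  - by apply: ler_wpM2l => //; exact: ltW.
Qed.

End Dens.

(** * Decay of the localised density *)

Section Pieces.
Variables (R : realType) (l1 l2 : R) (Q : induced_covering l1 l2).
Local Notation X3 := (measurableTypeR R * measurableTypeR R * measurableTypeR R)%type.
Local Notation I := (cov_index Q).
Local Notation h := (@cov_elt R l1 l2 Q).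
Local Notation S := (shear l1 l2).

(** Real and imaginary parts are treated by one argument, selected by a
    boolean. *)
Definition part (b : bool) (z : R[i]) : R := if b then complex.Re z else complex.Im z.

Lemma part_le b z : `|part b z| <= Normc.normc z.
Proof. by have [] := Re_Im_le_normc z; case: b. Qed.

Lemma smooth_continuous (f : 'cV[R]_3 -> R[i]) b : smooth f -> continuous (fun x => part b (f x)).
Proof.
move=> sf x; have [d1 d2] := sf [::] x.
by case: b; exact: differentiable_continuous.
Qed.

(** The real or imaginary part of the amplitude of the i-th piece of a sheared
    test distribution. *)
Definition piece_part b m (n : R) (i : I) (t : X3) : R :=
  density m t * part b (cov_phi i ((S n)^T *m vec3 t)).

Lemma phi_smooth (i : I) : smooth (cov_phi i).
Proof. by have [] := cov_phi_test i. Qed.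

(** The finitely many regularity constants for pure derivatives of order at
    most M, merged into one. *)
Lemma regular_le (M : nat) : exists2 C : R, 0 <= C & forall m j (i : I) x, (m <= M)%N ->
  Normc.normc (iter m (pderiv j) (pulled (cov_phi i) (invmx (h i))^T) x) <= C.
Proof.
have ex (m : nat) (j : 'I_3) : exists C : R, forall (i : I) x,
    Normc.normc (iter m (pderiv j) (pulled (cov_phi i) (invmx (h i))^T) x) <= C.
  have [C HC] := cov_phi_regular Q [ffun a => if a == j then m else 0%N].
  by exists C => i x; have := HC i x; rewrite mderiv_pure.
pose c m j := projT1 (cid (ex m j)).
have cP m j i x : Normc.normc (iter m (pderiv j) (pulled (cov_phi i) (invmx (h i))^T) x) <= c m j.
  by rewrite /c; case: cid => /= C; apply.
exists (\sum_(m < M.+1) \sum_j `|c m j|).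
  by apply: sumr_ge0 => m _; apply: sumr_ge0.
move=> m j i x mM.
apply: (le_trans (cP m j i x)); apply: (le_trans (ler_norm _)).
have mM' : (m < M.+1)%N by [].
rewrite (bigD1 (Ordinal mM'))//= (bigD1 j)//= -addrA lerDl addr_ge0// ?sumr_ge0// => a _.
exact: sumr_ge0.
Qed.

Lemma normc_ge0 (z : R[i]) : 0 <= Normc.normc z.
Proof. by case: z => a b; exact: sqrtr_ge0. Qed.

Lemma phi_le : exists2 C : R, 0 <= C & forall (i : I) x, Normc.normc (cov_phi i x) <= C.
Proof.
have [C C0 HC] := regular_le 0; exists C => // i x.
have := HC 0%N 0 i ((h i)^T *m x) (leqnn _); rewrite /= /pulled.
by rewrite mulmxA -trmx_mul mulmxV ?unit_elt// trmx1 mul1mx.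
Qed.

Lemma boxed_piece_part : exists2 C : R, 0 <= C & forall b m n i, boxed 2 C (piece_part b m n i).
Proof.
have [C C0 HC] := phi_le; exists C => // b m n i.
rewrite -[C]mul1r; apply: boxedM => //.
- exact: boxed_density.
- apply: (@measurable_continuous_vec3 R (fun x => part b (cov_phi i ((S n)^T *m x)))) => x.
  apply: (@continuous_comp _ _ _ (fun x => (S n)^T *m x) (fun x => part b (cov_phi i x))).
    exact: continuous_mulmx.
  by apply: smooth_continuous; exact: phi_smooth.
- by move=> t _; rewrite (le_trans (part_le _ _)).
Qed.

(** A step along (S h_i)^-T e_j in the variable of the density is a step along
    e_j in the normalised variable of phi_i. Hence the regularity of the
    partition of unity bounds the derivatives of all amplitudes uniformly in i
    and n. *)
Lemma phi_transport n (i : I) (k := S n *m h i) (eta : 'cV[R]_3) r j :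
  (S n)^T *m (eta + r *: ((invmx k)^T *m delta_mx j 0))
  = (invmx (h i))^T *m (k^T *m eta + r *: delta_mx j 0).
Proof.
have [uk kI] := invmxM (unit_shear l1 l2 n) (unit_elt i).
rewrite !mulmxDr -!scalemxAr /k trmx_mul.
congr (_ + _ *: _).
- by rewrite 2!mulmxA -trmx_mul mulmxV ?unit_elt// trmx1 mul1mx.
- rewrite mulmxA -trmx_mul kI -mulmxA mulVmx ?unit_shear// mulmx1//.
Qed.

(** The three directions k^-T e_j, with k = S h_i, have bounded entries, and in
    these directions both factors of the amplitude have bounded derivatives.
    The corresponding frequencies are the coordinates of k^-1 y, which are
    comparable with those of y. *)
Lemma osc_piece_part_decay (N : nat) (C : R) : 1 <= C -> exists2 E : R, 0 <= E &
  forall b n (i : I) y c, bibounded C (S n *m h i) ->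
  `|osc (piece_part b (6 * N) n i) y c| <= E * (decay N (y 0 0) * decay N (y 1 0) * decay N (y
    2%:R 0)).
Proof.
move=> C1; have C0 : 0 <= C by rewrite (le_trans _ C1).
set M := (6 * N)%N.
have [P P0 HP] := regular_le M.
have [B B0 HB] := boxed_piece_part.
pose D0 : R := (2 ^+ M * (2 ^+ M * ((C ^+ M * (2 * M.+1%:R) ^+ M) * (C ^+ M * (2 * M.+1%:R) ^+
  M)) * (C ^+ M * (2 * M.+1%:R) ^+ M))).
pose D := 2 ^+ M * (D0 * P).
have D00 : 0 <= D0 by rewrite !mulr_ge0// exprn_ge0.
have D_ge0 : 0 <= D by rewrite mulr_ge0 ?exprn_ge0// mulr_ge0.
exists ((B * boxvol 2 + D * boxvol (2 + C *+ M)) * (1 + 9 * C ^+ 2) ^+ (3 * N)).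
  by rewrite mulr_ge0 ?addr_ge0 ?mulr_ge0 ?boxvol_ge0// exprn_ge0// addr_ge0// mulr_ge0// sqr_ge0.
move=> b n i y c [k1 k2]; set k := S n *m h i in k1 k2.
have [uk kI] := invmxM (unit_shear l1 l2 n) (unit_elt i).
have vE j a : ((invmx k)^T *m (delta_mx j 0 : 'cV[R]_3)) a 0 = invmx k j a.
  by rewrite -colE mxE [LHS]mxE.
pose z := invmx k *m y.
have zE j : z j 0 = dotp y ((invmx k)^T *m delta_mx j 0).
  rewrite /dotp mxE; apply: eq_bigr => a _; rewrite mulrC; congr (_ * _).
  by rewrite vE.
(* The trivial bound serves where all coordinates of z are small, the decay
   along the direction of its largest coordinate elsewhere. *)
apply: (decay_combine (z := z)) => //.
- by rewrite mulr_ge0 ?boxvol_ge0.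
- by rewrite mulr_ge0 ?boxvol_ge0.
- by apply: boxed_Rintegral_le; apply: boxed_wave.
- move=> j zj; rewrite zE in zj *.
  apply: (@osc_decay R _ _ _ _ M 2 B _ C _ _ (HB b M n i)) => //.
    by move=> a; rewrite vE; exact: k2.
  move=> s t; apply: fdiff_le; rewrite -/M.
  apply: derivs_leM.
    by apply: derivs_le_density => // a; rewrite vE; exact: k2.
  have [G1 G2] := @derivs_le_pulled R (cov_phi i) (invmx (h i))^T (phi_smooth i) j M P (k^T *m
    vec3 t)
    (fun m x mM => HP m j i x mM).
  rewrite (_ : (fun r => _) = (fun r => part b (pulled (cov_phi i) (invmx (h i))^T (k^T *m vec3
    t + r *: delta_mx j 0)))).
    by case: b.
  by apply/funext => r; rewrite vec3_shiftv phi_transport.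
- move=> Z zZ l.
  have -> : y = k *m z by rewrite /z mulmxA mulmxV// mul1mx.
  have zb : entries_le Z z by move=> a a'; rewrite ord1.
  by have := entries_le_mul k1 zb l 0; rewrite mulrA.
Qed.

End Pieces.

(** * The sheared test distributions *)

Section TestDistribution.
Variables (R : realType) (l1 l2 : R).
Local Notation X3 := (measurableTypeR R * measurableTypeR R * measurableTypeR R)%type.
Local Notation mu3 := (@lebesgue3 R).
Local Notation S := (shear l1 l2).

Lemma normc_le (z : R[i]) : Normc.normc z <= `|complex.Re z| + `|complex.Im z|.
Proof.
case: z => a b /=; rewrite -[leRHS]ger0_norm ?addr_ge0// -sqrtr_sqr ler_sqrt ?sqr_ge0//.
rewrite sqrrD !real_normK ?num_real// lerD2r lerDl mulrn_wge0// mulr_ge0//.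
Qed.

Lemma dotp_trmx (A : 'M[R]_3) x y : dotp x (A^T *m y) = dotp (A *m x) y.
Proof.
have E (u v : 'cV[R]_3) : dotp u v = (u^T *m v) 0 0.
  by rewrite mxE; apply: eq_bigr => j _; rewrite mxE.
by rewrite !E trmx_mul mulmxA.
Qed.

Definition test_part b m (n : R) (f : 'cV[R]_3 -> R[i]) (t : X3) : R :=
  density m t * part b (f ((S n)^T *m vec3 t)).

Lemma boxed_test_part b m n C f : smooth f -> (forall x,
  Normc.normc (f x) <= C) -> boxed 2 C (test_part b m n f).
Proof.
move=> sf fC; rewrite -[C]mul1r; apply: boxedM => //.
- exact: boxed_density.
- apply: (@measurable_continuous_vec3 R (fun x => part b (f ((S n)^T *m x)))) => x.
  apply: (@continuous_comp _ _ _ (fun x => (S n)^T *m x) (fun x => part b (f x))).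
    exact: continuous_mulmx.
  exact: smooth_continuous.
- by move=> t _; rewrite (le_trans (part_le _ _)).
Qed.

Lemma test_function_le (O : set 'cV[R]_3) (f : 'cV[R]_3 -> R[i]) : test_function O f ->
  exists C : R, forall x, Normc.normc (f x) <= C.
Proof.
move=> [sf [K [cK _ fK]]].
have [A HA] := compact_image_le cK (fun x _ => @smooth_continuous R f true sf x).
have [B HB] := compact_image_le cK (fun x _ => @smooth_continuous R f false sf x).
exists (`|A| + `|B|) => x; have [Kx|nK] := pselect (K x).
  rewrite (le_trans (normc_le _))// lerD//.
    exact: (le_trans (HA x Kx) (ler_norm _)).
  exact: (le_trans (HB x Kx) (ler_norm _)).
by rewrite (fK _ nK) Normc.normc0 addr_ge0.
Qed.

(** The pairing of f with the absolutely continuous distribution that the dual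
    action of S transports from the density. *)
Definition test_val m n (f : 'cV[R]_3 -> R[i]) : R[i] :=
  (\int[mu3]_t test_part true m n f t) +i* (\int[mu3]_t test_part false m n f t).

Lemma test_val_linear m n (a : R[i]) (f g : 'cV[R]_3 -> R[i]) :
  test_function (@dual_orbit R) f -> test_function (@dual_orbit R) g ->
  test_val m n (fun x => a * f x + g x) = a * test_val m n f + test_val m n g.
Proof.
move=> tf tg; have [Cf HCf] := test_function_le tf; have [Cg HCg] := test_function_le tg.
have [sf _] := tf; have [sg _] := tg.
have If b := boxed_integrable (@boxed_test_part b m n _ _ sf HCf).
have Ig b := boxed_integrable (@boxed_test_part b m n _ _ sg HCg).
have ad w1 w2 : mu3.-integrable setT (EFin \o w1) -> mu3.-integrable setT (EFin \o w2) ->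
    mu3.-integrable setT (EFin \o (fun t => w1 t + w2 t)).
  move=> i1 i2; have := integrableD (mu := mu3) measurableT i1 i2.
  by apply: eq_integrable => // t _; rewrite /= EFinD.
case: a => a b; rewrite /test_val; congr (_ +i* _).
- rewrite (_ : (fun t => _) = (fun t => a * test_part true m n f t + (- b) * test_part false m n
  f t + test_part true m n g t)); last first.
    apply/funext => t; rewrite /test_part/=; case: (f _) => f1 f2; case: (g _) => g1 g2 /=; ring.
  rewrite (RintegralD measurableT (ad _ _ (integrable_scale a (If true)) (integrable_scale (- b)
    (If false))) (Ig true)).
  rewrite (RintegralD measurableT (integrable_scale a (If true)) (integrable_scale (- b) (If
    false))).
  by rewrite (RintegralZl _ measurableT (If true)) (RintegralZl _ measurableT (If false)) mulNr.
- rewrite (_ : (fun t => _) = (fun t => a * test_part false m n f t + b * test_part true m n f t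
  + test_part false m n g t)); last first.
    apply/funext => t; rewrite /test_part/=; case: (f _) => f1 f2; case: (g _) => g1 g2 /=; ring.
  rewrite (RintegralD measurableT (ad _ _ (integrable_scale a (If false)) (integrable_scale b
    (If true))) (Ig false)).
  rewrite (RintegralD measurableT (integrable_scale a (If false)) (integrable_scale b (If true))).
  by rewrite (RintegralZl _ measurableT (If true)) (RintegralZl _ measurableT (If false)).
Qed.

(** Integration against a bounded density of bounded support is a distribution
    of order 0. *)
Lemma test_val_continuous m n (K : set 'cV[R]_3) : compact K -> K `<=` @dual_orbit R ->
    exists (N : nat) (C : R), forall f (M : R),
      test_function (@dual_orbit R) f -> supported_in K f ->
      (forall s x, (msize s <= N)%N -> Normc.normc (mderiv s f x) <= M) ->
      Normc.normc (test_val m n f) <= C * M.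
Proof.
move=> _ _; exists 0%N, (2 * boxvol 2) => f M [sf _] _ fM.
have fM0 x : Normc.normc (f x) <= M.
  by have := fM [ffun i => if i == 0 then 0%N else 0%N] x; rewrite msize_pure mderiv_pure; apply.
have H b := boxed_Rintegral_le (@boxed_test_part b m n _ _ sf fM0).
rewrite (le_trans (normc_le _))//= (le_trans (lerD (H true) (H false)))//.
by rewrite le_eqVlt; apply/orP; left; apply/eqP; ring.
Qed.

Definition test_dist m n : schwartz_distribution (@dual_orbit R) :=
  SchwartzDistribution (@test_val_linear m n) (@test_val_continuous m n).

Variable (Q : induced_covering l1 l2).
Local Notation I := (cov_index Q).
Local Notation h := (@cov_elt R l1 l2 Q).

(** Since <x, S^T t> = <S x, t>, pairing with the characters gives a Fourier
    integral in the sheared variable. The direction v is left free for the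
    derivatives taken later. *)
Lemma piece_cosc m n (i : I) v :
  piece (test_dist m n) i = cosc (piece_part true m n i) (piece_part false m n i) (S n) v 0.
Proof.
apply/funext => x; rewrite /piece /ifourier_mul /test_dist/= /test_val /cosc.
have [C C0 B] := boxed_piece_part Q.
have Iw b c := boxed_integrable (boxed_wave (S n *m x) c (ler0n R 2) (B b m n i)).
congr (_ +i* _).
- rewrite mul0r add0r /osc -RintegralD//; last 2 first.
  + by under eq_fun do rewrite expr0 mulr1; exact: Iw.
  + by under eq_fun do rewrite expr0 mulr1; exact: Iw.
  congr Rintegral; apply/funext => t; rewrite /test_part /piece_part /wave/= !expr0 !mulr1 addr0
    dotp_trmx cosDpihalf.
  case: (cov_phi _ _) => f1 f2 /=; ring.
- rewrite mul0r sub0r /osc -RintegralD//; last 2 first.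
  + by under eq_fun do rewrite expr0 mulr1; exact: Iw.
  + by under eq_fun do rewrite expr0 mulr1; exact: Iw.
  congr Rintegral; apply/funext => t; rewrite /test_part /piece_part /wave/= !expr0 !mulr1 addr0
    dotp_trmx cosBpihalf.
  case: (cov_phi _ _) => f1 f2 /=; ring.
Qed.

Lemma inactive_piece_part C m n (i : I) :
  (forall eta, region eta -> cov_phi i ((S n)^T *m eta) != 0 -> bibounded C (S n *m h i)) ->
  ~ bibounded C (S n *m h i) -> forall b, piece_part b m n i = (fun=> 0).
Proof.
move=> H nk b; apply/funext => t; rewrite /piece_part.
have [->|d0] := eqVneq (density m t) 0; first by rewrite mul0r.
have [->|p0] := eqVneq (cov_phi i ((S n)^T *m vec3 t)) 0; first by case: b; rewrite /= mulr0.
by exfalso; apply: nk; apply: H p0; exact: density_region d0.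
Qed.

Lemma cosc0 B v k x : cosc (fun=> 0) (fun=> 0) B v k x = 0 :> R[i].
Proof.
rewrite /cosc.
have E y c : osc (fun t => 0 * freq (B *m v) t ^+ k) y c = 0 :> R.
  rewrite /osc (_ : (fun t => _) = (fun=> 0)); last by apply/funext => t; rewrite !mul0r.
  by rewrite /Rintegral integral0.
by rewrite !E addr0.
Qed.

End TestDistribution.

(** * Upper bound for the decomposition norm *)

Section Upper.
Variables (R : realType) (l1 l2 : R) (Q : induced_covering l1 l2).
Local Notation X3 := (measurableTypeR R * measurableTypeR R * measurableTypeR R)%type.
Local Notation S := (shear l1 l2).
Local Notation I := (cov_index Q).
Local Notation h := (@cov_elt R l1 l2 Q).

Lemma shear_vec3 n (t : X3) : [/\ (S n *m vec3 t) 0 0 = t.1.1 + n * t.1.2,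
  (S n *m vec3 t) 1 0 = t.1.2 & (S n *m vec3 t) 2%:R 0 = t.2].
Proof.
by split; rewrite mxE sum_ord3 !mxE/= ?powR1 ?mulr0 ?mul0r ?addr0 ?add0r ?mul1r ?mulr1.
Qed.

(** All pieces are evaluated at S x, so that the invariance under shears makes
    the bound independent of n. *)
Lemma LqN_piece_le (p : R) N (C : R) : 0 < p -> 1 <= N%:R * p -> 1 <= C ->
  exists B : R, forall n (i : I), bibounded C (S n *m h i) ->
    (LqN p (piece (test_dist l1 l2 (6 * N) n) i) <= B%:E)%E.
Proof.
move=> p0 Np C1.
have [E E0 HE] := osc_piece_part_decay Q N C1.
have [B HB] := LqN_decay p0 Np (mulr_ge0 (ler0n R 4) E0).
exists B => n i k; apply: (HB n) => t.
rewrite (piece_cosc (6 * N) n i 0) (le_trans (normc_le _))//.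
have [y0 y1 y2] := shear_vec3 n t.
rewrite -y0 -{1}y1 -y2.
set P := decay N _ * _ * _.
have F b c : `|osc (fun t => piece_part b (6 * N) n i t * freq (S n *m 0) t ^+ 0) (S n *m vec3
  t) c| <= E * P.
  rewrite (_ : (fun t => _) = piece_part b (6 * N) n i); first exact: HE.
  by apply/funext => s; rewrite expr0 mulr1.
rewrite /cosc/=.
rewrite (_ : 4 * E * P = (E * P + E * P) + (E * P + E * P)); last by ring.
by rewrite lerD// (le_trans (ler_normD _ _))// lerD.
Qed.

(** At most K pieces are non-zero, each has an L^p quasi-norm bounded
    independently of n, and each weight is of order (1 + n)^beta. *)
Lemma decompN_test_dist_le (p : R) N (nrm : 'M[R]_3 -> R) (alpha beta : R) : 0 < p -> 1 <= N%:R
  * p ->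
  matrix_norm nrm -> 0 <= beta ->
  exists2 D : R, 0 <= D & forall n : R, 0 <= n ->
  (decompN p p (fun i : I => `|\det (h i)| `^ (2^-1 - p^-1) * shearlet_weight nrm alpha beta (h
    i))%R
     (test_dist l1 l2 (6 * N) n) <= (D * (1 + n) `^ beta)%R%:E)%E.
Proof.
move=> p0 Np Hn b0.
have [C C1 HC] := active_bibounded Q.
have [B HB] := LqN_piece_le p0 Np C1.
have [D D0 HD] := weight_le Hn Q alpha (2^-1 - p^-1) b0 C1.
have [K HK] := bibounded_count Q C1.
exists ((K%:R `^ p^-1) * (D * `|B|)).
  by rewrite mulr_ge0 ?powR_ge0// mulr_ge0.
move=> n n0; rewrite /decompN.
pose u (i : I) := `|\det (h i)| `^ (2^-1 - p^-1) * shearlet_weight nrm alpha beta (h i).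
set T := test_dist _ _ _ _.
pose U := D * (1 + n) `^ beta * `|B|.
have U0 : 0 <= U by rewrite mulr_ge0// mulr_ge0// powR_ge0.
have u0 i : 0 <= u i by rewrite /u mulr_ge0 ?powR_ge0// mulr_ge0 ?powR_ge0.
have act i : bibounded C (S n *m h i) -> (((u i)%:E * LqN p (piece T i)) `^ p <= (U `^ p)%R%:E)%E.
  move=> k; rewrite -poweR_EFin; apply: gt0_ler_poweR; first exact: ltW.
  - by rewrite in_itv/= leey andbT mule_ge0// ?lee_fin// Lnorm_ge0.
  - by rewrite in_itv/= leey andbT lee_fin.
  - rewrite /U [X in (_ <= X)%E]EFinM; apply: lee_pmul => //.
    + by rewrite lee_fin.
    + exact: Lnorm_ge0.
    + by rewrite lee_fin; apply: HD.
    + by apply: (le_trans (HB n i k)); rewrite lee_fin ler_norm.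
have inact i : ~ bibounded C (S n *m h i) -> (((u i)%:E * LqN p (piece T i)) `^ p = 0)%E.
  move=> nk; rewrite (_ : LqN p _ = 0%E) ?mule0 ?poweR0r ?gt_eqF//.
  rewrite /LqN (_ : (fun t => _) = cst 0%E) ?Lnorm0 ?eqe ?gt_eqF//.
  apply/funext => t; rewrite (piece_cosc (6 * N) n i 0).
  by rewrite !(inactive_piece_part _ (HC n i) nk) cosc0 Normc.normc0.
have -> : (K%:R `^ p^-1 * (D * `|B|) * (1 + n) `^ beta) = (K%:R * U `^ p) `^ p^-1.
  rewrite powRM ?powR_ge0// -powRrM mulfV ?gt_eqF// powRr1// /U; ring.
rewrite -poweR_EFin; apply: gt0_ler_poweR.
- by rewrite invr_ge0 ltW.
- by rewrite in_itv/= leey andbT esum_ge0// => i _; exact: poweR_ge0.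
- by rewrite in_itv/= leey andbT lee_fin mulr_ge0// powR_ge0.
rewrite /esum; apply: ge_ereal_sup => _ [X [finX _] <-].
rewrite fsbig_finite//=.
set s := fset_set X.
rewrite (bigID (fun i => `[< bibounded C (S n *m h i) >]))/= [X in (_ + X)%E]big1 ?adde0;
  last first.
  by move=> i /asboolPn; exact: inact.
rewrite -big_filter.
apply: (@le_trans _ _ (\sum_(i <- [seq i <- s | `[< bibounded C (S n *m h i) >]]) (U `^ p)%R%:E)%E).
  rewrite !big_seq; apply: lee_sum => i; rewrite mem_filter => /andP[/asboolP k _].
  exact: act.
rewrite sumEFin lee_fin big_const_seq count_predT iter_addr_0 -[X in X <= _]mulr_natl.
rewrite ler_wpM2r ?powR_ge0// ler_nat; apply: (HK n).
  by apply: filter_uniq; exact: fset_uniq.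
by move=> i; rewrite mem_filter => /andP[/asboolP].
Qed.

End Upper.

(** * Lower bound for the derivatives *)

Section Slabs.
Variables (R : realType).
Local Notation X3 := (measurableTypeR R * measurableTypeR R * measurableTypeR R)%type.
Local Notation mu1 := (@lebesgue_measure R).
Local Notation mu3 := (@lebesgue3 R).

(** After k derivatives the phase is k pi / 2. This addition formula recovers
    from the real and imaginary parts the integral with phase 0, the one that
    positivity bounds from below. *)
Lemma osc_rotate L C (w : X3 -> R) y (c : R) : 0 <= L -> boxed L C w ->
  osc w y 0 = cos c * osc w y c + sin c * osc w y (c - pi / 2).
Proof.
move=> L0 bw; have i1 := boxed_integrable (boxed_wave y c L0 bw).
have i2 := boxed_integrable (boxed_wave y (c - pi / 2) L0 bw).
rewrite /osc -(RintegralZl _ measurableT i1) -(RintegralZl _ measurableT i2).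
rewrite -(RintegralD measurableT (integrable_scale (cos c) i1) (integrable_scale (sin c) i2)).
congr Rintegral; apply/funext => t; rewrite /wave addr0.
set a := 2 * pi * _; have -> : a + (c - pi / 2) = (a + c) - pi / 2 by lra.
rewrite cosBpihalf.
have -> : cos a = cos ((a + c) - c) by congr cos; lra.
by rewrite cosB; ring.
Qed.

Lemma oscD L C D (w1 w2 : X3 -> R) y (c : R) : 0 <= L -> boxed L C w1 -> boxed L D w2 ->
  osc (fun t => w1 t + w2 t) y c = osc w1 y c + osc w2 y c.
Proof.
move=> L0 b1 b2; have i1 := boxed_integrable (boxed_wave y c L0 b1).
have i2 := boxed_integrable (boxed_wave y c L0 b2).
rewrite /osc -(RintegralD measurableT i1 i2); congr Rintegral; apply/funext => t; ring.
Qed.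

Lemma boxed0 L : boxed L 0 (fun=> 0 : R).
Proof. by split => // t; rewrite normr0 mul0r. Qed.

Lemma boxed_sum (I : Type) (s : seq I) L C (w : I -> X3 -> R) :
  (forall i, boxed L C (w i)) -> boxed L (C *+ size s) (fun t => \sum_(i <- s) w i t).
Proof.
move=> bw; elim: s => [|i s IH].
  by rewrite mulr0n; under eq_fun do rewrite big_nil; exact: boxed0.
rewrite [size _]/= mulrS; under eq_fun do rewrite big_cons.
exact: boxedD.
Qed.

Lemma cosc_sum (I : Type) (s : seq I) L C (wr wi : I -> X3 -> R) (B : 'M[R]_3) (v : 'cV[R]_3) m x :
  0 <= L -> (forall i, boxed L C (wr i)) -> (forall i, boxed L C (wi i)) ->
  \sum_(i <- s) cosc (wr i) (wi i) B v m x =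
  cosc (fun t => \sum_(i <- s) wr i t) (fun t => \sum_(i <- s) wi i t) B v m x.
Proof.
move=> L0 br bi; elim: s => [|i s IH].
  rewrite big_nil (_ : (fun t => _) = fun=> 0); last by apply/funext => t; rewrite big_nil.
  rewrite (_ : (fun t => \sum_(i <- [::]) wi i t) = fun=> 0); last by apply/funext => t;
    rewrite big_nil.
  by rewrite cosc0.
rewrite big_cons IH /cosc.
have E (w : I -> X3 -> R) y c : (forall i, boxed L C (w i)) ->
    osc (fun t => (\sum_(j <- i :: s) w j t) * freq (B *m v) t ^+ m) y c =
    osc (fun t => w i t * freq (B *m v) t ^+ m) y c + osc (fun t => (\sum_(j <- s) w j t) * freq
      (B *m v) t ^+ m) y c.
  move=> bw; rewrite -(oscD y c L0 (boxed_freq (B *m v) m L0 (bw i)) (boxed_freq (B *m v) m L0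
    (boxed_sum s bw))).
  by congr osc; apply/funext => t; rewrite big_cons mulrDl.
have addC (a b c d : R) : (a +i* b) + (c +i* d) = (a + c) +i* (b + d) by [].
rewrite !E// addC; congr (_ +i* _); ring.
Qed.

Definition itv_ind (a b : R) (x : R) : R := \1_(`[a, b]%classic : set R) x.

Lemma measurable_itv_ind a b : measurable_fun setT (itv_ind a b : measurableTypeR R -> R).
Proof.
have mI : measurable (`[a, b]%classic : set (measurableTypeR R)) by exact: measurable_itv.
exact: (@measurable_indic _ (measurableTypeR R) R setT _ mI).
Qed.

Lemma itv_ind_ge0 a b x : 0 <= itv_ind a b x.
Proof. by rewrite /itv_ind indicE. Qed.

Lemma itv_ind_neq0 a b x : itv_ind a b x != 0 -> a <= x <= b.
Proof.
rewrite /itv_ind indicE; have [/set_mem/=|] := boolP (_ \in _); last by rewrite eqxx.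
by rewrite in_itv.
Qed.

Lemma itv_ind_cases a b x : itv_ind a b x = 0 \/ itv_ind a b x = 1.
Proof. by rewrite /itv_ind indicE; case: (_ \in _); [right|left]. Qed.

Lemma integral_itv_ind a b : a < b -> (\int[mu1]_x (itv_ind a b x)%:E = (b - a)%:E)%E.
Proof.
move=> ab.
have mI : measurable (`[a, b]%classic : set (measurableTypeR R)) by exact: measurable_itv.
rewrite /itv_ind (integral_indic mu1 measurableT mI) setIT.
have H := @lebesgue_measure_itv R `[a, b]; rewrite /= lte_fin ab in H.
by rewrite EFinB; exact: H.
Qed.

(** The indicator function of the preimage of a cuboid under a shear. *)
Definition slab (n : R) (a1 b1 a2 b2 a3 b3 : R) (t : X3) : R :=
  itv_ind a1 b1 (t.1.1 + n * t.1.2) * itv_ind a2 b2 t.1.2 * itv_ind a3 b3 t.2.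

Lemma measurable_slab n a1 b1 a2 b2 a3 b3 : measurable_fun setT (slab n a1 b1 a2 b2 a3 b3).
Proof. exact: (measurable_shear_prod n (@measurable_itv_ind a1 b1) (@measurable_itv_ind a2 b2)
  (@measurable_itv_ind a3 b3)). Qed.

Lemma integral_slab n a1 b1 a2 b2 a3 b3 : a1 < b1 -> a2 < b2 -> a3 < b3 ->
  (\int[mu3]_t (slab n a1 b1 a2 b2 a3 b3 t)%:E = ((b1 - a1) * (b2 - a2) * (b3 - a3))%:E)%E.
Proof.
move=> h1 h2 h3; rewrite /slab (ge0_integral_shear n (@measurable_itv_ind a1 b1)
  (@measurable_itv_ind a2 b2)
  (@measurable_itv_ind a3 b3) (itv_ind_ge0 a1 b1) (itv_ind_ge0 a2 b2) (itv_ind_ge0 a3 b3)).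
by rewrite !integral_itv_ind// !EFinM.
Qed.

Lemma slab_ge0 n a1 b1 a2 b2 a3 b3 t : 0 <= slab n a1 b1 a2 b2 a3 b3 t.
Proof. by apply: mulr_ge0; [apply: mulr_ge0|]; exact: itv_ind_ge0. Qed.

Lemma slab_cases n a1 b1 a2 b2 a3 b3 t : slab n a1 b1 a2 b2 a3 b3 t = 0 \/
  slab n a1 b1 a2 b2 a3 b3 t = 1 /\ [/\ a1 <= t.1.1 + n * t.1.2 <= b1,
    a2 <= t.1.2 <= b2 & a3 <= t.2 <= b3].
Proof.
rewrite /slab.
have [->|H1] := itv_ind_cases a1 b1 (t.1.1 + n * t.1.2); first by left; rewrite !mul0r.
have [->|H2] := itv_ind_cases a2 b2 t.1.2; first by left; rewrite mulr0 mul0r.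
have [->|H3] := itv_ind_cases a3 b3 t.2; first by left; rewrite mulr0.
right; split; first by rewrite H1 H2 H3 !mulr1.
by split; apply: itv_ind_neq0; rewrite ?H1 ?H2 ?H3 oner_eq0.
Qed.

(** Each of the three bumps is bounded below on the middle half of its support.
    *)
Lemma density_integral_gt0 m : 0 < \int[mu3]_t density m t :> R.
Proof.
(* Both factors of the bump are at least 1/4 on [1/4, 3/4]. *)
pose c : R := 4^-1 ^+ (m.+1 + m.+1).
have c0 : 0 < c by rewrite exprn_gt0// invr_gt0.
pose d : R := c * c * c.
have d0 : 0 < d by rewrite !mulr_gt0.
pose s := slab 0 (5 / 4) (7 / 4) (1 / 4) (3 / 4) (1 / 4) (3 / 4).
have sE : (\int[mu3]_t (s t)%:E = (2^-1 * 2^-1 * 2^-1)%:E)%E.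
  rewrite /s integral_slab; [|lra|lra|lra].
  by congr (_%:E); lra.
have is_ : mu3.-integrable setT (EFin \o s).
  apply/integrableP; split; first by apply/measurable_EFinP; exact: measurable_slab.
  under eq_integral => t _ do rewrite /= ger0_norm ?slab_ge0//.
  by rewrite sE ltry.
have id := boxed_integrable (boxed_density R m).
apply: (@lt_le_trans _ _ (\int[mu3]_t (d * s t))).
  by rewrite RintegralZl// mulr_gt0// /Rintegral sE/= !mulr_gt0// invr_gt0.
apply: le_Rintegral => //; first exact: integrable_scale.
move=> t _; rewrite /s; have [->|[-> [h1 h2 h3]]] := slab_cases 0 (5 / 4) (7 / 4) (1 / 4) (3 /
  4) (1 / 4) (3 / 4) t.
  by rewrite mulr0 density_ge0.
rewrite mul0r addr0 in h1; rewrite mulr1 /density /d.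
have c0' := ltW c0.
have B x : 4^-1 <= x <= 3 / 4 -> c <= bump m.+1 m.+1 x by exact: bump_ge.
apply: ler_pM; rewrite ?mulr_ge0//; last by apply: B; lra.
by apply: ler_pM; rewrite ?mulr_ge0//; apply: B; lra.
Qed.

(** Wherever |F| + |G| >= kappa, one of the two is at least kappa / 2, so |F|^q
    + |G|^q >= (kappa / 2)^q there. Integrating this replaces the triangle
    inequality, which fails for q < 1. *)
Lemma LqN_ge_of_sum_ge (q kappa M : R) (A : X3 -> R) (F G : 'cV[R]_3 -> R[i]) :
  0 < q -> 0 < kappa -> 0 < M ->
  measurable_fun setT A -> (forall t, 0 <= A t) -> (\int[mu3]_t (A t)%:E = M%:E)%E ->
  (forall b, measurable_fun setT (fun t => part b (F (vec3 t)))) ->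
  (forall b, measurable_fun setT (fun t => part b (G (vec3 t)))) ->
  (forall t, A t = 0 \/ A t = 1 /\ kappa <= Normc.normc (F (vec3 t)) + Normc.normc (G (vec3 t))) ->
  (LqN q F < (kappa / 2 * (M / 2) `^ q^-1)%:E)%E ->
  ((kappa / 2 * (M / 2) `^ q^-1)%:E <= LqN q G)%E.
Proof.
move=> q0 k0 M0 mA A0 iA mF mG H LF.
have nm (f : 'cV[R]_3 -> R[i]) : (forall b, measurable_fun setT (fun t => part b (f (vec3 t)))) ->
    measurable_fun setT (fun t : X3 => Normc.normc (f (vec3 t))).
  move=> mf; rewrite (_ : (fun t => _) = (fun t => Num.sqrt (part true (f (vec3 t)) ^+ 2 + part
    false (f (vec3 t)) ^+ 2))); last first.
    by apply/funext => t; rewrite /part; case: (f _).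
  apply: (measurableT_comp (continuous_measurable_fun (@sqrt_continuous R))).
  by apply: measurable_funD; apply: measurable_funX; exact: mf.
pose N (f : 'cV[R]_3 -> R[i]) (t : X3) := Normc.normc (f (vec3 t)) `^ q.
have mN f : (forall b, measurable_fun setT (fun t => part b (f (vec3 t)))) -> measurable_fun
  setT (N f).
  by move=> mf; exact: (measurableT_comp (measurable_powR q) (nm f mf)).
have NE f : (LqN q f `^ q = \int[mu3]_t (N f t)%:E)%E.
  rewrite /LqN (poweR_Lnorm mu3 _ (lt0r_neq0 q0)); apply: eq_integral => t _.
  by rewrite /= ger0_norm ?normc_ge0.
pose k2 := (kappa / 2) `^ q.
have k20 : 0 < k2 by rewrite powR_gt0// divr_gt0.
have key : ((k2 * M)%:E <= LqN q F `^ q + LqN q G `^ q)%E.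
  have N0 f t : [set: X3] t -> (0 <= (N f t)%:E)%E by move=> _; rewrite lee_fin powR_ge0.
  have mNE f : (forall b, measurable_fun setT (fun t => part b (f (vec3 t)))) ->
      measurable_fun setT (fun t : X3 => (N f t)%:E).
    by move=> mf; apply/measurable_EFinP; exact: mN.
  have mAE : measurable_fun setT (fun t : X3 => (A t)%:E) by exact/measurable_EFinP.
  have A0E t : [set: X3] t -> (0 <= (A t)%:E)%E by move=> _; rewrite lee_fin.
  have k2E : (0 <= k2%:E)%E by rewrite lee_fin ltW.
  rewrite !NE -(ge0_integralD mu3 measurableT (N0 F) (mNE F mF) (N0 G) (mNE G mG)).
  rewrite EFinM -iA -(ge0_integralZl mu3 measurableT mAE A0E k2E).
  apply: ge0_le_integralT => t; first by rewrite mule_ge0// lee_fin// ltW.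
  rewrite -EFinM -EFinD lee_fin.
  have [->|[-> Ht]] := H t; first by rewrite mulr0 addr_ge0 ?powR_ge0.
  rewrite mulr1 /N /k2.
  have [h|h] := leP (kappa / 2) (Normc.normc (F (vec3 t))).
    apply: (@le_trans _ _ (Normc.normc (F (vec3 t)) `^ q)); last by rewrite lerDl powR_ge0.
    by rewrite ge0_ler_powR ?nnegrE ?normc_ge0 ?divr_ge0 ?(ltW q0) ?(ltW k0).
  apply: (@le_trans _ _ (Normc.normc (G (vec3 t)) `^ q)); last by rewrite lerDr powR_ge0.
  rewrite ge0_ler_powR ?nnegrE ?normc_ge0 ?divr_ge0 ?(ltW q0) ?(ltW k0)//.
  by move: h Ht; lra.
have e0 : 0 <= kappa / 2 * (M / 2) `^ q^-1 by rewrite mulr_ge0 ?powR_ge0// divr_ge0// ltW.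
have eE : (kappa / 2 * (M / 2) `^ q^-1) `^ q = k2 * (M / 2).
  by rewrite powRM ?powR_ge0 ?divr_ge0 ?(ltW k0)// -powRrM mulVf ?gt_eqF// powRr1// divr_ge0// ltW.
have LF' : (LqN q F `^ q <= (k2 * (M / 2))%:E)%E.
  rewrite -eE -poweR_EFin; apply: gt0_ler_poweR; first exact: ltW.
  - by rewrite in_itv/= leey andbT Lnorm_ge0.
  - by rewrite in_itv/= leey andbT lee_fin.
  - exact: ltW.
have LG' : ((k2 * (M / 2))%:E <= LqN q G `^ q)%E.
  have [fG|] := boolP (LqN q G `^ q \is a fin_num)%E; last first.
    by rewrite ge0_fin_numE ?poweR_ge0// -leNgt leye_eq => /eqP ->; rewrite leey.
  move: key; have fF : (LqN q F `^ q \is a fin_num)%E.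
    by rewrite ge0_fin_numE ?poweR_ge0// (le_lt_trans LF')// ltry.
  rewrite -(fineK fG) -(fineK fF) -EFinD !lee_fin => key.
  move: LF'; rewrite -(fineK fF) lee_fin => LF'.
  by move: key LF'; rewrite mulrA; move: (fine _) (fine _) (k2 * M) => a b c; lra.
rewrite leNgt; apply/negP => LG; move: LG'.
have : (LqN q G `^ q < (k2 * (M / 2))%:E)%E.
  have fG : (LqN q G \is a fin_num)%E by rewrite ge0_fin_numE ?Lnorm_ge0// (lt_trans LG)// ltry.
  move: LG; rewrite -(fineK fG) lte_fin => LG.
  rewrite -eE poweR_EFin lte_fin gt0_ltr_powR// ?nnegrE// fine_ge0//; exact: Lnorm_ge0.
by move=> h1 h2; move: (lt_le_trans h1 h2); rewrite ltxx.
Qed.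

End Slabs.

Section LowerBound.
Variables (R : realType) (l1 l2 : R) (Q : induced_covering l1 l2).
Local Notation mu3 := (@lebesgue3 R).
Local Notation S := (shear l1 l2).
Local Notation I := (cov_index Q).
Local Notation h := (@cov_elt R l1 l2 Q).

Lemma part_sum b (J : Type) (s : seq J) (f : J -> R[i]) :
  part b (\sum_(i <- s) f i) = \sum_(i <- s) part b (f i).
Proof.
elim: s => [|i s IH]; first by rewrite !big_nil; case: b.
rewrite !big_cons -IH; case: (f i) => u v; case: (\sum_(_ <- _) _) => u' v'.
by case: b {IH}.
Qed.

Lemma active_finite (C n : R) : 1 <= C -> finite_set [set i : I | bibounded C (S n *m h i)].
Proof.
move=> C1; have [K HK] := bibounded_count Q C1.
apply: contrapT => /(@infinite_set_fset _ _ K.+1)[X XA XK].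
have := HK n X (fset_uniq X) (fun i iX => XA i iX).
by rewrite leqNgt XK.
Qed.

(** As soon as J contains every index that meets the sheared support, the
    partition of unity adds the amplitudes up to the density itself. *)
Lemma partition_sum C m n (J : {fset I}) t :
  (forall (i : I) eta, region eta -> cov_phi i ((S n)^T *m eta) != 0 -> bibounded C (S n *m h i)) ->
  (forall i : I, bibounded C (S n *m h i) -> i \in J) ->
  \sum_(i <- J) piece_part true m n i t = density m t /\ \sum_(i <- J) piece_part false m n i t = 0.
Proof.
move=> HC HJ.
have [d0|d0] := eqVneq (density m t) 0.
  by rewrite /piece_part d0; split; rewrite big1// => i _; rewrite mul0r.
have rt := density_region d0.
pose xi := (S n)^T *m vec3 t.
have xi0 : dual_orbit xi.
  rewrite /dual_orbit/= /xi.
  have [/andP[h1 _] _ _] := rt.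
  have -> : ((S n)^T *m vec3 t) ord0 0 = vec3 t 0 0.
    by rewrite mxE sum_ord3 !mxE/= !mul0r !addr0 mul1r.
  by rewrite gt_eqF// (lt_le_trans _ h1).
have E : \sum_(i <- J) cov_phi i xi = 1.
  rewrite -(cov_phi_sum Q xi0) (fsbigTE J)// => i iJ.
  apply/eqP/negPn/negP => p0; move/negP: iJ; apply; apply: HJ.
  exact: HC rt p0.
have P b : \sum_(i <- J) piece_part b m n i t = density m t * part b (\sum_(i <- J) cov_phi i xi).
  by rewrite part_sum mulr_sumr.
by rewrite !P E; split; rewrite /= ?mulr1 ?mulr0.
Qed.

Lemma phase_bound_eq : 2 * pi * (4 * (16 * pi)^-1) = 2^-1 :> R.
Proof.
have p0 : pi != 0 :> R by rewrite gt_eqF// pi_gt0.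
by rewrite invfM mulrCA !mulrA (mulrAC _ pi) -(mulrA _ pi) divff// mulr1; lra.
Qed.

(** For S x in a cube of half-side 1 / (16 pi), the phase 2 pi <S x, t> is at
    most 1 / 2 on the support of the density, so the wave stays above 1 / 2 and
    no cancellation occurs. The factor <S e_2, t> = n t_1 + t_2 is at least n
    there. *)
Lemma cosc_density_ge m k : exists2 c : R, 0 < c & forall (n : nat) (x : 'cV[R]_3),
  (forall j, `|(S n%:R *m x) j 0| <= (16 * pi)^-1) ->
  c * n%:R ^+ k <= Normc.normc (cosc (density m) (fun=> 0) (S n%:R) (delta_mx 1 0) k x).
Proof.
pose G := \int[mu3]_t density m t.
have G0 : 0 < G := density_integral_gt0 R m.
exists (2^-1 * 2^-1 * G); first by rewrite !mulr_gt0 ?invr_gt0.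
move=> n x xb; set y := S n%:R *m x in xb.
pose w t := density m t * freq (S n%:R *m delta_mx 1 0) t ^+ k.
have bw := boxed_freq (S n%:R *m delta_mx 1 0) k (ler0n R 2) (boxed_density R m).
have O c : osc (fun t => 0 * freq (S n%:R *m delta_mx 1 0) t ^+ k) y c = 0 :> R.
  rewrite /osc (_ : (fun t => _) = (fun=> 0)); last by apply/funext => t; rewrite !mul0r.
  by rewrite /Rintegral integral0.
have Z : osc w y 0 <= 2 * Normc.normc (cosc (density m) (fun=> 0) (S n%:R) (delta_mx 1 0) k x).
  set N := Normc.normc _.
  have [r1 r2] := Re_Im_le_normc (cosc (density m) (fun=> 0) (S n%:R) (delta_mx 1 0) k x).
  rewrite -/N /cosc/= -/y !O !addr0 in r1 r2.
  rewrite (osc_rotate y (k%:R * (pi / 2)) (ler0n R 2) bw).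
  rewrite (_ : 2 * N = N + N); last by ring.
  by apply: lerD; rewrite (le_trans (ler_norm _))// normrM -[N]mul1r ler_pM// ?ler_norml
    ?cos_geN1 ?cos_le1 ?sin_geN1 ?sin_le1.
have LB : 2^-1 * n%:R ^+ k * G <= osc w y 0.
  rewrite /G -(RintegralZl _ measurableT (boxed_integrable (boxed_density R m))).
  apply: le_Rintegral => //.
  - exact: integrable_scale (boxed_integrable (boxed_density R m)).
  - exact: (boxed_integrable (boxed_wave y 0 (ler0n R 2) bw)).
  move=> t _; rewrite /w.
  have [->|d0] := eqVneq (density m t) 0; first by rewrite mulr0 !mul0r.
  have [/andP[a1 a2] /andP[b1 b2] /andP[c1 c2]] := density_supp d0.
  have vE j : (S n%:R *m (delta_mx 1 0 : 'cV[R]_3)) j 0 = S n%:R j 1 by rewrite -colE mxE.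
  have fE : freq (S n%:R *m delta_mx 1 0) t = 2 * pi * (n%:R * t.1.1 + t.1.2).
    rewrite /freq dotpE !vE !mxE/= ?powR1 mul1r mul0r addr0.
    by congr (_ * (_ + _)); rewrite mul1r.
  have pi1 : 1 <= pi :> R by rewrite (le_trans _ (pi_ge2 R))// ler1n.
  have fn : n%:R <= freq (S n%:R *m delta_mx 1 0) t.
    rewrite fE; apply: (@le_trans _ _ (1 * (n%:R * t.1.1 + t.1.2))).
      rewrite mul1r; have : n%:R <= n%:R * t.1.1 by rewrite ler_peMr// ltW.
      by lra.
    rewrite ler_wpM2r//; last by lra.
    by rewrite addr_ge0 ?mulr_ge0// ltW// (lt_trans _ a1).
  have cw : 2^-1 <= wave y 0 t.
    rewrite /wave addr0; set a := 2 * pi * _.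
    have aB : `|a| <= 2^-1.
      have dB : `|dotp y (vec3 t)| <= 4 * (16 * pi)^-1.
        have e0 : 0 <= (16 * pi)^-1 :> R by rewrite (le_trans _ (xb 0)).
        have tE : dotp y (vec3 t) = y 0 0 * t.1.1 + y 1 0 * t.1.2 + y 2%:R 0 * t.2.
          by rewrite dotpE; congr (_ * _ + _ * _ + _ * _); rewrite mxE.
        rewrite tE; apply: (le_trans (ler_normD _ _)).
        rewrite (_ : 4 * _ = ((16 * pi)^-1 * 2 + (16 * pi)^-1 * 1) + (16 * pi)^-1 * 1);
          last by move: (_^-1) => e; ring.
        move: xb; set e := (16 * pi)^-1 => xb.
        have Q' j (u v : R) : `|u| <= v -> `|y j 0 * u| <= e * v.
          by move=> uv; rewrite normrM ler_pM.
        have [n1 n2 n3] : [/\ `|t.1.1| <= 2, `|t.1.2| <= 1 & `|t.2| <= 1].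
          move: a1 a2 b1 b2 c1 c2; move: t.1.1 t.1.2 t.2 => u v w'.
          by clear; move=> *; split; rewrite ler_norml; lra.
        apply: lerD; last exact: Q'.
        by apply: (le_trans (ler_normD _ _)); apply: lerD; exact: Q'.
      have p2 : 0 <= 2 * pi :> R by rewrite mulr_ge0 ?pi_ge0.
      rewrite /a normrM (ger0_norm p2).
      apply: (le_trans (ler_wpM2l p2 dB)).
      by rewrite phase_bound_eq.
    have := cos_taylor1 0 a; rewrite !add0r cos0 cos_pihalf mulr0 subr0 ler_norml => /andP[q1 _].
    have : a ^+ 2 <= 4^-1.
      rewrite -real_normK ?num_real// (_ : 4^-1 = 2^-1 ^+ 2 :> R); last by rewrite expr2; lra.
      by rewrite lerXn2r ?nnegrE ?invr_ge0.
    by move: q1; lra.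
  have fk : n%:R ^+ k <= freq (S n%:R *m delta_mx 1 0) t ^+ k.
    by rewrite lerXn2r ?nnegrE// (le_trans _ fn).
  rewrite (_ : density m t * _ * _ = wave y 0 t * freq (S n%:R *m delta_mx 1 0) t ^+ k * density
    m t); last by ring.
  by rewrite ler_wpM2r ?density_ge0// ler_pM// ?invr_ge0// exprn_ge0.
have := le_trans LB Z; set N := Normc.normc _ => H.
rewrite (_ : _ * _ ^+ k = 2^-1 * (2^-1 * n%:R ^+ k * G)); last by ring.
by move: H; move: (2^-1 * _ * G) N => u v; lra.
Qed.

Lemma le_normcD (x y : R[i]) : Normc.normc (x + y) <= Normc.normc x + Normc.normc y.
Proof.
have E (z : R[i]) : `|z| = (Normc.normc z)%:C by case: z.
by have := ler_normD x y; rewrite !E -rmorphD lecR.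
Qed.

Lemma partB b (x y : R[i]) : part b (x - y) = part b x - part b y.
Proof. by case: x => ? ?; case: y => ? ?; case: b. Qed.

Lemma inLq_measurable (q : R) (f : 'cV[R]_3 -> R[i]) b : inLq q f ->
  measurable_fun setT (fun t => part b (f (vec3 t))).
Proof. by case: b => -[]. Qed.

(** The partial sums over finite sets of indices that contain the active ones
    all equal the k-th derivative of the full Fourier integral, which is at
    least of order n^k on a slab of fixed volume. These partial sums come close
    to G in L^q, and the bound passes to G. *)
Lemma dstar_ge (q : R) k m : 0 < q -> exists2 c : R, 0 < c & forall (n : nat) G, (0 < n)%N ->
  is_dstar Q q [ffun i : 'I_3 => if i == 1 then k else 0%N] (test_dist l1 l2 m n%:R) G ->
  ((c * n%:R ^+ k)%:E <= LqN q G)%E.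
Proof.
move=> q0; set s := [ffun i => _].
have [c0 c00 Hc0] := cosc_density_ge m k.
have [C C1 HC] := active_bibounded Q.
(* The half-side of the cube in which the phase stays small. *)
pose d : R := (16 * pi)^-1.
have d0 : 0 < d by rewrite invr_gt0 mulr_gt0// pi_gt0.
have dd : - d < d by rewrite gtrN.
pose M : R := (d - - d) * (d - - d) * (d - - d).
have M0 : 0 < M by rewrite !mulr_gt0 ?subr_gt0.
have M20 : 0 < (M / 2) `^ q^-1 by rewrite powR_gt0// divr_gt0.
exists (c0 / 2 * (M / 2) `^ q^-1); first by rewrite !mulr_gt0 ?invr_gt0.
move=> n G n0 [Fi LG conv].
pose kappa := c0 * n%:R ^+ k.
have k0 : 0 < kappa by rewrite mulr_gt0// exprn_gt0// ltr0n.
have e0 : 0 < kappa / 2 * (M / 2) `^ q^-1 by rewrite mulr_gt0// divr_gt0.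
have [J0 HJ0] := conv _ e0.
(* Large enough for the convergence in L^q and for the partition of unity to be
   complete. *)
pose J := (J0 `|` fset_set [set i : I | bibounded C (S n%:R *m h i)])%fset.
have HJ i : bibounded C (S n%:R *m h i) -> i \in J.
  move=> ki; rewrite inE; apply/orP; right.
  by rewrite (in_fset_set (active_finite n%:R C1)); apply/mem_set.
set T := test_dist l1 l2 m n%:R in Fi conv HJ0.
have sumE x : \sum_(i <- J) mderiv s (piece T i) x = cosc (density m) (fun=> 0) (S n%:R)
  (delta_mx 1 0) k x.
  have [B B0 HB] := boxed_piece_part Q.
  rewrite (eq_bigr (fun i => cosc (piece_part true m n%:R i) (piece_part false m n%:R i) (S
    n%:R) (delta_mx 1 0) k x)); last first.
    move=> i _; rewrite /s mderiv_pure (piece_cosc m n%:R i (delta_mx 1 0)).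
    by rewrite (iter_pderiv_cosc _ _ _ (ler0n R 2) (HB true m n%:R i) (HB false m n%:R i)).
  rewrite (cosc_sum _ _ _ _ _ (ler0n R 2) (HB true m n%:R) (HB false m n%:R)).
  have Et := fun t => partition_sum m t (HC n%:R) HJ.
  by rewrite (funext (fun t => (Et t).1)) (funext (fun t => (Et t).2)).
rewrite (_ : c0 / 2 * _ * _ = kappa / 2 * (M / 2) `^ q^-1); last by rewrite /kappa; ring.
apply: (@LqN_ge_of_sum_ge R q kappa M (slab n%:R (- d) d (- d) d (- d) d)
  (fun x => \sum_(i <- J) mderiv s (piece T i) x - G x) G) => //.
- exact: measurable_slab.
- exact: slab_ge0.
- exact: integral_slab.
- move=> b; under eq_fun do rewrite partB part_sum.
  apply: measurable_funB; last exact: inLq_measurable LG.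
  by apply: measurable_sum => i; exact: (inLq_measurable b (Fi i)).
- by move=> b; exact: (inLq_measurable b LG).
- move=> t; have [->|[-> [t1 t2 t3]]] := slab_cases n%:R (- d) d (- d) d (- d) d t; first by left.
  right; split=> //; rewrite (le_trans _ (le_normcD _ _))// subrK sumE; apply: Hc0 => j.
  have [y0 y1 y2] := shear_vec3 l1 l2 n%:R t.
  have : [\/ j = 0, j = 1 | j = 2%:R].
    by case: j => -[|[|[|//]]] ?; [constructor 1|constructor 2|constructor 3]; apply: val_inj.
  by case=> ->; rewrite ?y0 ?y1 ?y2 ler_norml.
- by apply: HJ0; exact: fsubsetUl.
Qed.

End LowerBound.

(** * Conclusion *)

Lemma growth_comparison (R : realType) (c D b : R) k : 0 < c -> 0 <= b ->
  (forall n : nat, (0 < n)%N -> c * n%:R ^+ k <= D * (1 + n%:R) `^ b) -> k%:R <= b.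
Proof.
move=> c0 b0 H; rewrite leNgt; apply/negP => bk.
have g0 : 0 < k%:R - b by rewrite subr_gt0.
pose L := (`|D| * 2 `^ b / c).
have L0 : 0 <= L by rewrite !mulr_ge0 ?powR_ge0// invr_ge0 ltW.
(* Beyond this point n^(k - b) exceeds the ratio of the constants. *)
pose n := (Num.truncn (L `^ (k%:R - b)^-1)).+1.
have n0 : 0 < n%:R :> R by rewrite ltr0n.
have nL : L < n%:R `^ (k%:R - b).
  have {1}-> : L = (L `^ (k%:R - b)^-1) `^ (k%:R - b).
    by rewrite -powRrM mulVf ?lt0r_neq0// powRr1.
  by apply: gt0_ltr_powR; rewrite ?nnegrE ?powR_ge0 ?(ltW n0) ?truncnS_gt//.
have := H n isT; apply/negP; rewrite -ltNge.
apply: (@le_lt_trans _ _ (`|D| * (2 `^ b * n%:R `^ b))).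
  apply: (@le_trans _ _ (`|D| * (1 + n%:R) `^ b)).
    by rewrite ler_wpM2r ?powR_ge0 ?ler_norm.
  rewrite ler_wpM2l// -powRM// ge0_ler_powR// ?nnegrE ?addr_ge0 ?mulr_ge0//.
  by rewrite mulrDl mul1r lerD2r ler1n.
rewrite -powR_mulrn// -[in ltRHS](subrK b k%:R) powRD ?(gt_eqF n0) ?implybT//.
rewrite !mulrA ltr_pM2r ?powR_gt0//.
by rewrite (mulrC c); move: nL; rewrite /L ltr_pdivrMr.
Qed.

Theorem corollary6p1 (R : realType) (p q : R) (k : nat)
    (alpha beta l1 l2 : R) (nrm : 'M[R]_3 -> R) (Q : induced_covering l1 l2) :
  0 < p <= 2 -> 0 < q <= 2 -> 0 <= beta -> matrix_norm nrm ->
  coorbit_embeds_sobolev Q p p (shearlet_weight nrm alpha beta) k q ->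
  k%:R <= beta.
Proof.
move=> /andP[p0 _] /andP[q0 _] b0 Hn [clause _ _].
(* The k-th power of the partial derivative in the second coordinate, the one
   that the shear mixes with the first frequency. *)
pose s : multiindex := [ffun i => if i == 1 then k else 0%N].
have ss : (msize s <= k)%N by rewrite msize_pure.
have [Cc HCc] := clause s ss.
(* Large enough for the p-th power of decay of order 2 N to be integrable. *)
pose N := (Num.truncn p^-1).+1.
have Np : 1 <= N%:R * p by rewrite -ler_pdivrMr// mul1r ltW// truncnS_gt.
have [D D0 HD] := decompN_test_dist_le Q alpha p0 Np Hn b0.
have [c c0 Hc] := dstar_ge Q k (6 * N) q0.
apply: (@growth_comparison _ c (`|Cc| * D) beta k) => // n n0.
have Dn := HD n%:R (ler0n R n).
have [G [dG LG]] := HCc (test_dist l1 l2 (6 * N) n%:R) (le_lt_trans Dn (ltry _)).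
rewrite -lee_fin (le_trans (Hc n G n0 dG))// (le_trans LG)// -mulrA EFinM.
(* Cc may be negative, hence the passage through its absolute value. *)
apply: (@le_trans _ _ (`|Cc|%:E * decompN p p (fun i : cov_index Q =>
    `|\det (cov_elt i)| `^ (2^-1 - p^-1) * shearlet_weight nrm alpha beta (cov_elt i))%R
  (test_dist l1 l2 (6 * N) n%:R))%E).
  by apply: lee_wpmul2r; [exact: poweR_ge0|rewrite lee_fin ler_norm].
by apply: lee_wpmul2l => //; rewrite lee_fin.
Qed.
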